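(* Let Assumptions 1, 2 and 3 (stated in the context) hold. Let $c>0$, $\kappa>0$, $\gamma>0$ satisfy $$\kappa>-\mu,\qquad \gamma>3L,$$ and let the extrapolation coefficients satisfy, for all $k\ge 0$, $$0\le \eta_k\le \bar\eta:=\sqrt{\frac{\kappa+2c+\gamma-3L}{2(\gamma-\mu+3L)}} .$$ Then, for $0<\alpha\le c$ and $\beta>0$ both sufficiently small, the SPPDM sequence satisfies an $\mathcal O(1/K)+\mathcal O(\sigma^2/|\mathcal I|)$ bound. Precisely: there exist $\tau>0$ and $\bar\alpha\in(0,c]$ (depending only on $L,\mu,\kappa,\gamma,c$ and the graph) such that for every $\alpha\in(0,\bar\alpha]$ there is $\bar\beta\in(0,1]$ (depending only on $L,\mu,\kappa,\gamma,c,\alpha$, the graph and the matrices $S_{x,i},S_{y,i}$) such that for every $\beta\in(0,\bar\beta)$ there are constants $C_0>0$, $C_1>0$ depending only on these problem parameters and on $\alpha,\beta$ (in particular not on $K$, $|\mathcal I|$, $\sigma$ or the iterates) such that for every batch size $|\mathcal I|\ge 1$, every $K\ge 1$ and every sequence $\{\mathbf x^k,\mathbf z^k,\boldsymbol\lambda^k\}$ generated by SPPDM, $$\min_{k=0,\ldots,K-1}\mathbb E\big[Q(\mathbf x^k,\boldsymbol\lambda^{k+1})\big]\le C_0\left(\frac{\phi^0-\underline f}{K}+\frac{C_1N\sigma^2}{|\mathcal I|}\right),$$ where $\phi^0$ is the initial potential value (with this $\tau$) defined in the context.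
   Context: Problem. $\mathcal G$ is an undirected connected graph on $\{1,\dots,N\}$ with edge set $\mathcal E$ and degrees $d_i\ge 1$. For each $i$, $f_i:\mathbb R^n\to\mathbb R$ is smooth (possibly nonconvex) and $r_i:\mathbb R^n\to\mathbb R\cup\{+\infty\}$ is proper closed convex. For $\mathbf x=(x_1,\dots,x_N)\in\mathbb R^{Nn}$ put $f(\mathbf x)=\sum_i f_i(x_i)$, $r(\mathbf x)=\sum_i r_i(x_i)$. The incidence matrix $\tilde{\mathbf A}\in\mathbb R^{|\mathcal E|\times N}$ has, in the row of edge $(i,j)$ with $j>i$, entry $1$ in column $i$, $-1$ in column $j$ and zeros elsewhere; $\mathbf A=\tilde{\mathbf A}\otimes I_n$, $\mathbf B=|\mathbf A|$ (entrywise absolute value), $\mathbf D=\mathrm{diag}(d_1,\dots,d_N)\otimes I_n$, so $\mathbf A^\top\mathbf A+\mathbf B^\top\mathbf B=2\mathbf D$. The problem is $\min_{\mathbf x} f(\mathbf x)+r(\mathbf x)$ subject to $\mathbf A\mathbf x=0$, assumed feasible (some $\mathbf x$ has $\mathbf A\mathbf x=0$, $r(\mathbf x)<\infty$). Assumption 1. (i) $f$ is continuously differentiable with $\|\nabla f(\mathbf x)-\nabla f(\mathbf y)\|\le L\|\mathbf x-\mathbf y\|$ for all $\mathbf x,\mathbf y$, $L>0$; and there is $\mu\ge -L$ (possibly negative) with $f(\mathbf x)-f(\mathbf y)-\langle\nabla f(\mathbf y),\mathbf x-\mathbf y\rangle\ge\frac{\mu}{2}\|\mathbf x-\mathbf y\|^2$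 for all $\mathbf x,\mathbf y$. (ii) There is a constant $\underline f>-\infty$ with $f(\mathbf x)+r(\mathbf x)>\underline f$ whenever $\mathbf A\mathbf x=0$. Assumption 2. For each $i$ the epigraph $\{(x_i,y_i): r_i(x_i)\le y_i\}$ is a polyhedral set $\{(x_i,y_i): S_{x,i}x_i+S_{y,i}y_i\ge\zeta_i\}$ with $S_{x,i}\in\mathbb R^{q_i\times n}$, $S_{y,i},\zeta_i\in\mathbb R^{q_i}$. Assumption 3. For each agent $i$, with $\xi\sim\mathcal B_i$ and all $x\in\mathbb R^n$: $\mathbb E[G_i(x,\xi)]=\nabla f_i(x)$ and $\mathbb E\|G_i(x,\xi)-\nabla f_i(x)\|^2\le\sigma^2$, $\sigma>0$. SPPDM algorithm. Parameters: dual step size $\alpha>0$, $\beta>0$, $\gamma>0$, $c>0$, $\kappa>0$, $\eta_k\geq 0$, batch size $|\mathcal I|$. Start from deterministic $\mathbf x^0$ with $r(\mathbf x^0)<\infty$, $\mathbf x^{-1}=\mathbf x^0$, $\mathbf z^0=\mathbf x^0$, $\boldsymbol\lambda^0=-\alpha\mathbf A\mathbf x^0$ (so $\boldsymbol\lambda^1=0$). For $k=0,1,2,\dots$: $\boldsymbol\lambda^{k+1}=\boldsymbol\lambda^k+\alpha\mathbf A\mathbf x^k$; $\mathbf s^k=\mathbf x^k+\eta_k(\mathbf x^k-\mathbf x^{k-1})$; $\mathbf x^{k+1}=\arg\min_{\mathbf x}\big\{f(\mathbf s^k)+\langle\bar G(\mathbf s^k,\boldsymbol\xi^k),\mathbf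 x-\mathbf s^k\rangle+\frac\gamma2\|\mathbf x-\mathbf s^k\|^2+r(\mathbf x)+\langle\boldsymbol\lambda^{k+1},\mathbf A\mathbf x\rangle+\frac c2\|\mathbf A\mathbf x\|^2+\frac c2\|\mathbf B(\mathbf x-\mathbf x^k)\|^2+\frac\kappa2\|\mathbf x-\mathbf z^k\|^2\big\}$; $\mathbf z^{k+1}=\mathbf z^k+\beta(\mathbf x^{k+1}-\mathbf z^k)$. Here the $i$-th block of $\bar G(\mathbf s^k,\boldsymbol\xi^k)$ is $\frac1{|\mathcal I|}\sum_{j=1}^{|\mathcal I|}G_i(s_i^k,\xi_{ij}^k)$ with samples $\xi_{ij}^k\sim\mathcal B_i$ independent across $j$ (and $i$) and independent of the past iterations. Optimality gap. With $\mathrm{prox}_r^1(\mathbf v)=\arg\min_{\mathbf u}\frac12\|\mathbf v-\mathbf u\|^2+r(\mathbf u)$, $$Q(\mathbf x,\boldsymbol\lambda)=\|\mathbf x-\mathrm{prox}_r^1(\mathbf x-\nabla f(\mathbf x)-\mathbf A^\top\boldsymbol\lambda)\|^2+\|\mathbf A\mathbf x\|^2 .$$ Potential. $L_c(\mathbf x,\mathbf z;\boldsymbol\lambda)=f(\mathbf x)+r(\mathbf x)+\langle\boldsymbol\lambda,\mathbf A\mathbf x\rangle+\frac c2\|\mathbf A\mathbf x\|^2+\frac\kappa2\|\mathbf x-\mathbf z\|^2$, $d(\mathbf z;\boldsymbol\lambda)=\min_{\mathbf x}L_c(\mathbf x,\mathbf z;\boldsymbol\lambda)$, $P(\mathbf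 z)=\min_{\mathbf A\mathbf x=0}\{f(\mathbf x)+r(\mathbf x)+\frac\kappa2\|\mathbf x-\mathbf z\|^2\}$, and $$\phi^k=L_c(\mathbf x^k,\mathbf z^k;\boldsymbol\lambda^k)+\tau\|\mathbf x^k-\mathbf x^{k-1}\|^2+2P(\mathbf z^k)-2d(\mathbf z^k;\boldsymbol\lambda^k).$$ *)

(* Defs.v *)
From HB Require Import structures.
From mathcomp Require Import all_boot all_order all_algebra.
From mathcomp Require Import all_classical all_reals all_analysis.

Set Implicit Arguments.
Unset Strict Implicit.
Unset Printing Implicit Defensive.

Import Order.TTheory GRing.Theory Num.Theory.
Import numFieldNormedType.Exports.

Local Open Scope classical_set_scope.
Local Open Scope ring_scope.

(* A stacked vector (x_1, ..., x_N) of R^(N n) is the matrix x : 'M[R]_(N, n)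
   whose i-th row is x_i.  Under this identification (M (x) I_n) x is M *m x,
   for any M with N columns, and the Euclidean inner product of R^(N n) is the
   entrywise (Frobenius) one.  The norm that the library puts on matrices is
   the sup norm (used below only for its topology), hence [enorm]. *)

Section euclidean.
Variables (R : realType) (m n : nat).

Definition inner (x y : 'M[R]_(m, n)) : R :=
  \sum_(i < m) \sum_(j < n) x i j * y i j.

Definition enorm (x : 'M[R]_(m, n)) : R := Num.sqrt (inner x x).

Definition grad (f : 'M[R]_(m, n) -> R) (x : 'M[R]_(m, n)) : 'M[R]_(m, n) :=
  \matrix_(i < m, j < n) 'D_(delta_mx i j) f x.

Definition argmin (F : 'M[R]_(m, n) -> \bar R) : set 'M[R]_(m, n) :=
  [set u | forall v, (F u <= F v)%E].

(* The argument of a minimizer is unique for r proper closed convex; 0 is only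
   the default value of [xget]. *)
Definition prox (r : 'M[R]_(m, n) -> \bar R) (v : 'M[R]_(m, n)) :
    'M[R]_(m, n) :=
  xget 0 (argmin (fun u => (2^-1 * enorm (v - u) ^+ 2)%:E + r u)%E).

Definition proper_fun (r : 'M[R]_(m, n) -> \bar R) : Prop :=
  (forall x, (-oo < r x)%E) /\ exists x, (r x < +oo)%E.

Definition closed_fun (r : 'M[R]_(m, n) -> \bar R) : Prop :=
  closed [set p : 'M[R]_(m, n) * R | (r p.1 <= p.2%:E)%E].

Definition convex_fun (r : 'M[R]_(m, n) -> \bar R) : Prop :=
  forall (x y : 'M[R]_(m, n)) (t : R), 0 <= t <= 1 ->
    (r (t *: x + (1 - t) *: y)%R <= t%:E * r x + (1 - t)%:E * r y)%E.

End euclidean.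

Section graph.
Variables (N : nat) (e : rel 'I_N).

Definition connected_graph : Prop :=
  [/\ (0 < N)%N, symmetric e, irreflexive e & forall i j, connect e i j].

Definition degree (i : 'I_N) : nat := #|[set j | e i j]|.

Definition edges : {set 'I_N * 'I_N} :=
  [set p : 'I_N * 'I_N | e p.1 p.2 && (p.1 < p.2)%N].

Definition incidence (R : realType) : 'M[R]_(#|edges|, N) :=
  \matrix_(l < #|edges|, i < N)
    ((i == (enum_val l).1)%:R - (i == (enum_val l).2)%:R).

Definition abs_incidence (R : realType) : 'M[R]_(#|edges|, N) :=
  map_mx Num.norm (incidence R).

End graph.

Section problem.
Variables (R : realType) (N n : nat) (e : rel 'I_N).
Variables (f : 'I_N -> 'rV[R]_n -> R) (r : 'I_N -> 'rV[R]_n -> \bar R).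

Local Notation vec := 'M[R]_(N, n).
Local Notation dvec := 'M[R]_(#|edges e|, n).
Local Notation A := (incidence e R).
Local Notation B := (abs_incidence e R).

Definition fsum (x : vec) : R := \sum_(i < N) f i (row i x).

Definition rsum (x : vec) : \bar R := (\sum_(i < N) r i (row i x))%E.

Definition feasible : Prop :=
  exists x : vec, A *m x = 0 /\ (rsum x < +oo)%E.

Definition smooth_weakly_convex (L mu : R) : Prop :=
  [/\ forall x : vec, differentiable fsum x,
      continuous (grad fsum),
      forall x y : vec,
        enorm (grad fsum x - grad fsum y) <= L * enorm (x - y)
    & forall x y : vec,
        mu / 2 * enorm (x - y) ^+ 2
          <= fsum x - fsum y - inner (grad fsum y) (x - y)].

Definition bounded_below (f_low : R) : Prop :=
  forall x : vec, A *m x = 0 -> (f_low%:E < (fsum x)%:E + rsum x)%E.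

Definition polyhedral_epigraph (q : 'I_N -> nat)
    (Sx : forall i, 'M[R]_(q i, n)) (Sy zeta : forall i, 'cV[R]_(q i)) : Prop :=
  forall (i : 'I_N) (x : 'rV[R]_n) (y : R),
    (r i x <= y%:E)%E <->
    forall l : 'I_(q i), zeta i l 0 <= (Sx i *m x^T + y *: Sy i) l 0.

Definition gap (x : vec) (lam : dvec) : R :=
  enorm (x - prox rsum (x - grad fsum x - A^T *m lam)) ^+ 2
  + enorm (A *m x) ^+ 2.

Definition Lagr (c kappa : R) (x z : vec) (lam : dvec) : \bar R :=
  ((fsum x + inner lam (A *m x) + c / 2 * enorm (A *m x) ^+ 2
    + kappa / 2 * enorm (x - z) ^+ 2)%:E + rsum x)%E.

Definition dual_value (c kappa : R) (z : vec) (lam : dvec) : \bar R :=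
  ereal_inf [set Lagr c kappa x z lam | x in [set: vec]].

Definition prox_value (kappa : R) (z : vec) : \bar R :=
  ereal_inf [set ((fsum x + kappa / 2 * enorm (x - z) ^+ 2)%:E + rsum x)%E
            | x in [set x : vec | A *m x = 0]].

Definition potential (c kappa tau : R) (x xprev z : vec) (lam : dvec) :
    \bar R :=
  (Lagr c kappa x z lam + (tau * enorm (x - xprev) ^+ 2)%:E
   + 2%:E * prox_value kappa z - 2%:E * dual_value c kappa z lam)%E.

Definition eta_bar (L mu c kappa gamma : R) : R :=
  Num.sqrt ((kappa + 2 * c + gamma - 3 * L) / (2 * (gamma - mu + 3 * L))).

Definition subproblem (c kappa gamma : R) (g s xk zk : vec) (lam : dvec)
    (x : vec) : \bar R :=
  ((fsum s + inner g (x - s) + gamma / 2 * enorm (x - s) ^+ 2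
    + inner lam (A *m x) + c / 2 * enorm (A *m x) ^+ 2
    + c / 2 * enorm (B *m (x - xk)) ^+ 2
    + kappa / 2 * enorm (x - zk) ^+ 2)%:E + rsum x)%E.

End problem.

Section stochastic.
Variables (R : realType) (N n : nat).
Variables (dX : 'I_N -> measure_display) (Xi : forall i, measurableType (dX i)).
Variables (law : forall i, probability (Xi i) R).
Variable (G : forall i, 'rV[R]_n -> Xi i -> 'rV[R]_n).

(* Joint measurability is what makes G_i(s_i, xi) a random vector when s_i is
   itself random. *)
Definition stochastic_gradient (f : 'I_N -> 'rV[R]_n -> R) (sigma : R) : Prop :=
  forall i : 'I_N,
    [/\ forall j : 'I_n,
          measurable_fun setT
            (fun p : g_sigma_algebraType (@open 'rV[R]_n) * Xi i =>
               G p.1 p.2 0 j),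
        forall (x : 'rV[R]_n) (j : 'I_n),
          (law i).-integrable setT (fun xi => (G x xi 0 j)%:E) /\
          ('E_(law i)[fun xi => (G x xi 0 j)%R] = (grad (f i) x 0 j)%:E)%E
      & forall x : 'rV[R]_n,
          ('E_(law i)[fun xi => (enorm (G x xi - grad (f i) x) ^+ 2)%R]
             <= (sigma ^+ 2)%:E)%E].

Section samples.
Variables (d : measure_display) (T : measurableType d) (P : probability T R).

Definition mutually_independent (I : eqType) (dU : I -> measure_display)
    (U : forall i, measurableType (dU i)) (X : forall i, T -> U i) : Prop :=
  forall (J : seq I) (S : forall i, set (U i)),
    uniq J -> (forall i, measurable (S i)) ->
    P (\bigcap_(i in [set` J]) (X i @^-1` S i)) =
    (\prod_(i <- J) P (X i @^-1` S i))%E.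

(* As the only randomness comes from the samples, independence across agents,
   within a batch and from the past iterations is mutual independence of the
   family indexed by (k, i, j). *)
Definition iid_samples (b : nat)
    (xi : nat -> forall i : 'I_N, 'I_b -> {RV P >-> Xi i}) : Prop :=
  (forall k i j (S : set (Xi i)), measurable S ->
     distribution P (xi k i j) S = law i S) /\
  mutually_independent
    (fun (p : nat * 'I_N * 'I_b) => xi p.1.1 p.1.2 p.2 : T -> Xi p.1.2).

Definition batch_gradient (b : nat)
    (xi : nat -> forall i : 'I_N, 'I_b -> {RV P >-> Xi i})
    (k : nat) (w : T) (s : 'M[R]_(N, n)) : 'M[R]_(N, n) :=
  \matrix_(i < N) (b%:R^-1 *: \sum_(j < b) G (row i s) (xi k i j w)).

(* x^k, z^k and lambda^k are [x k], [z k] and [lam k], pathwise in w.  Since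
   0.-1 = 0, [x k.-1] is x^(k-1) with the convention x^(-1) = x^0. *)
Record SPPDM (e : rel 'I_N)
    (f : 'I_N -> 'rV[R]_n -> R) (r : 'I_N -> 'rV[R]_n -> \bar R)
    (alpha beta gamma c kappa : R) (eta : nat -> R) (b : nat)
    (xi : nat -> forall i : 'I_N, 'I_b -> {RV P >-> Xi i})
    (x0 : 'M[R]_(N, n)) (x z : nat -> T -> 'M[R]_(N, n))
    (lam : nat -> T -> 'M[R]_(#|edges e|, n)) : Prop := {
  sppdm_x0 : forall w, x 0%N w = x0;
  sppdm_z0 : forall w, z 0%N w = x0;
  sppdm_lam0 : forall w, lam 0%N w = - (alpha *: (incidence e R *m x0));
  sppdm_lam : forall k w,
    lam k.+1 w = lam k w + alpha *: (incidence e R *m x k w);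
  sppdm_x : forall k w,
    let s := x k w + eta k *: (x k w - x k.-1 w) in
    argmin (subproblem f r c kappa gamma (batch_gradient xi k w s) s
              (x k w) (z k w) (lam k.+1 w)) (x k.+1 w);
  sppdm_z : forall k w, z k.+1 w = z k w + beta *: (x k.+1 w - z k w)
}.

End samples.
End stochastic.

(* Main.v *)
Require Import Defs.
From HB Require Import structures.
From mathcomp Require Import all_boot all_order all_algebra.
From mathcomp Require Import all_classical all_reals all_analysis.
From mathcomp Require Import measurable_realfun ring lra.

Set Implicit Arguments.
Unset Strict Implicit.
Unset Printing Implicit Defensive.

Import Order.TTheory GRing.Theory Num.Theory.
Import numFieldNormedType.Exports.

Local Open Scope classical_set_scope.
Local Open Scope ring_scope.

(** Why the rate holds.  Write [x'] for the minimizer of the augmented Lagrangian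
    with proximal centre [z^k] and multiplier [lambda^(k+1)], and [xb] for the
    minimizer of the proximal problem on the consensus space [A x = 0].

    Along every sample path the potential decreases ([potential_descent]): up to a
    multiple of the squared error of the gradient estimate,
    [phi^(k+1) - phi^k] is at most minus a multiple of the squares of
    [x^(k+1) - x^k], [x^k - x^(k-1)], [A x'] and [x^(k+1) - z^k].  Three estimates
    carry this.  The subproblem is strongly convex with modulus
    [gamma + kappa + 2 c] because every vertex of the graph has an edge
    ([incidence_coercive]); this pays for the extrapolation, which is what the bound
    on [eta_k] says ([eta_bar_margin]).  The distance from [x^k] to [x'] is bounded
    by the two displacements and the noise ([primal_error]), so the terms brought
    by the multiplier step are absorbed for small [alpha].  The distance from [x']
    to [xb] is at most a constant times [|A x'|], a dual error bound that rests on
    the polyhedrality of the regularizers ([dual_error_bound]); it absorbs the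
    terms brought by the motion of the proximal centre for small [beta].

    The dual error bound is a first-order argument.  Lift the regularizers to a
    polyhedron with one height per agent.  The displacement from [xb] to [x']
    violates only [A d = 0], by [A x']; Hoffman's theorem ([hoffman], by
    Fourier-Motzkin elimination) moves it into the kernel of [A] at a
    proportional cost, so that it is admissible from [xb] and, reversed, from
    [x'].  Both points are optimal along it, the multipliers disappear, and strong
    monotonicity of the gradient gives the bound.  The constant depends on the
    coefficients of the polyhedra and not on their right-hand sides.

    The optimality gap at [(x^k, lambda^(k+1))] is bounded by the same four squares
    and the noise ([gap_bound]), and the potential is at least [f_low] ([pot_ge]).
    Summing over [k] gives the pathwise inequality [pathwise_gap_bound], in which
    the only random quantities are the gaps and the errors of the gradient
    estimates.

    It remains to take expectations.  The query point of step [k] is a measurable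
    function of the samples of the earlier steps ([iterates_measurable]), since the
    subproblem depends on its data in a Lipschitz way, and each sample is
    independent of the sigma-algebra of all the others
    ([sample_independent_of_others]).  Averaging the samples of a batch one at a
    time, each new one adds at most [sigma^2] to the second moment of the sum of
    errors because its cross term has mean zero; this gives the mean square error
    [N sigma^2 / b] ([batch_second_moment]) and the theorem. *)

(** * Euclidean geometry of stacked vectors *)

Section euclidean_geometry.
Variables (R : realType) (m n : nat).
Implicit Types (x y u v : 'M[R]_(m, n)) (a : R).

Lemma innerC x y : inner x y = inner y x.
Proof. by apply: eq_bigr => i _; apply: eq_bigr => j _; rewrite mulrC. Qed.

Lemma innerDl x y u : inner (x + y) u = inner x u + inner y u.
Proof.
rewrite /inner -big_split; apply: eq_bigr => i _ /=.
by rewrite -big_split; apply: eq_bigr => j _; rewrite mxE mulrDl.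
Qed.

Lemma innerZl a x u : inner (a *: x) u = a * inner x u.
Proof.
rewrite /inner mulr_sumr; apply: eq_bigr => i _.
by rewrite mulr_sumr; apply: eq_bigr => j _; rewrite mxE mulrA.
Qed.

Lemma innerDr u x y : inner u (x + y) = inner u x + inner u y.
Proof. by rewrite innerC innerDl !(innerC u). Qed.

Lemma innerZr a u x : inner u (a *: x) = a * inner u x.
Proof. by rewrite innerC innerZl innerC. Qed.

Lemma innerNl x u : inner (- x) u = - inner x u.
Proof. by rewrite -scaleN1r innerZl mulN1r. Qed.

Lemma innerNr u x : inner u (- x) = - inner u x.
Proof. by rewrite innerC innerNl innerC. Qed.

Lemma innerBl x y u : inner (x - y) u = inner x u - inner y u.
Proof. by rewrite innerDl innerNl. Qed.

Lemma innerBr u x y : inner u (x - y) = inner u x - inner u y.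
Proof. by rewrite innerDr innerNr. Qed.

Lemma inner0l u : inner 0 u = 0.
Proof. by rewrite -(scale0r 0) innerZl mul0r. Qed.

Lemma inner0r u : inner u 0 = 0.
Proof. by rewrite innerC inner0l. Qed.

Lemma inner_ge0 x : 0 <= inner x x.
Proof. by do 2!(apply: sumr_ge0 => ? _); rewrite -expr2 sqr_ge0. Qed.

Lemma sqr_enorm x : enorm x ^+ 2 = inner x x.
Proof. by rewrite /enorm sqr_sqrtr // inner_ge0. Qed.

Lemma enorm_ge0 x : 0 <= enorm x.
Proof. exact: sqrtr_ge0. Qed.

Lemma enormN x : enorm (- x) = enorm x.
Proof. by rewrite /enorm innerNl innerNr opprK. Qed.

Lemma enormB x y : enorm (x - y) = enorm (y - x).
Proof. by rewrite -enormN opprB. Qed.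

Lemma enorm0 : enorm (0 : 'M[R]_(m, n)) = 0.
Proof. by rewrite /enorm inner0l sqrtr0. Qed.

Lemma enormZ a x : enorm (a *: x) = `|a| * enorm x.
Proof.
by rewrite /enorm innerZl innerZr mulrA -expr2 sqrtrM ?sqr_ge0 // sqrtr_sqr.
Qed.

Lemma inner_le_enorm x y : inner x y <= enorm x * enorm y.
Proof.
have [x0|x0] := eqVneq (enorm x) 0.
  have xy t : 0 <= - 2 * t * inner x y + inner y y.
    have := inner_ge0 (y - t *: x).
    rewrite !(innerBl, innerBr, innerZl, innerZr) -(sqr_enorm x) x0 (innerC y x).
    lra.
  rewrite x0 mul0r leNgt; apply/negP => h.
  have := xy ((inner y y + 1) / (2 * inner x y)).
  have -> : - 2 * ((inner y y + 1) / (2 * inner x y)) * inner x y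
     = - (inner y y + 1) by field; lra.
  lra.
have xp : 0 < enorm x by rewrite lt_def x0 enorm_ge0.
have [y0|y0] := eqVneq (enorm y) 0.
  have xy t : 0 <= - 2 * t * inner x y + inner x x.
    have := inner_ge0 (x - t *: y).
    rewrite !(innerBl, innerBr, innerZl, innerZr) -(sqr_enorm y) y0 (innerC y x).
    lra.
  rewrite y0 mulr0 leNgt; apply/negP => h.
  have := xy ((inner x x + 1) / (2 * inner x y)).
  have -> : - 2 * ((inner x x + 1) / (2 * inner x y)) * inner x y
     = - (inner x x + 1) by field; lra.
  lra.
have yp : 0 < enorm y by rewrite lt_def y0 enorm_ge0.
have := inner_ge0 (enorm y *: x - enorm x *: y).
have -> : inner (enorm y *: x - enorm x *: y) (enorm y *: x - enorm x *: y) =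
  2 * (enorm x * enorm y) * (enorm x * enorm y - inner x y).
  rewrite !(innerBl, innerBr, innerZl, innerZr) -!sqr_enorm (innerC y x).
  by ring.
by rewrite pmulr_rge0 ?subr_ge0 // !mulr_gt0.
Qed.

Lemma enormD x y : enorm (x + y) <= enorm x + enorm y.
Proof.
rewrite -(@ler_pXn2r _ 2) ?nnegrE ?addr_ge0 ?enorm_ge0 //.
rewrite sqr_enorm !(innerDl, innerDr) -!sqr_enorm (innerC y x).
have := inner_le_enorm x y; nra.
Qed.

Lemma enorm_eq0 x : enorm x = 0 -> x = 0.
Proof.
move=> x0; apply/matrixP => i j; rewrite mxE.
have : inner x x = 0 by rewrite -sqr_enorm x0 expr0n.
move=> /eqP; rewrite psumr_eq0; last first.
  by move=> ? _; apply: sumr_ge0 => ? _; rewrite -expr2 sqr_ge0.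
move=> /allP /(_ i); rewrite mem_index_enum => /(_ isT) /eqP /eqP.
rewrite psumr_eq0; last by move=> ? _; rewrite -expr2 sqr_ge0.
move=> /allP /(_ j); rewrite mem_index_enum => /(_ isT).
by rewrite -expr2 sqrf_eq0 => /eqP.
Qed.

Lemma entry_le_enorm x i j : `|x i j| <= enorm x.
Proof.
rewrite -(@ler_pXn2r _ 2) ?nnegrE ?enorm_ge0 // real_normK ?num_real //.
rewrite sqr_enorm /inner (bigD1 i) //= (bigD1 j) //= expr2 -addrA lerDl.
apply: addr_ge0; first by apply: sumr_ge0 => ? _; rewrite -expr2 sqr_ge0.
by do 2!(apply: sumr_ge0 => ? _); rewrite -expr2 sqr_ge0.
Qed.

Lemma enorm_le_entries x a : 0 <= a -> (forall i j, `|x i j| <= a) ->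
  enorm x <= (m * n)%:R * a.
Proof.
move=> a0 xa; rewrite -(@ler_pXn2r _ 2) ?nnegrE ?enorm_ge0 ?mulr_ge0 //.
have le1 : inner x x <= (m * n)%:R * a ^+ 2.
  apply: (@le_trans _ _ (\sum_(i < m) \sum_(j < n) a ^+ 2)).
    apply: ler_sum => i _; apply: ler_sum => j _.
    by rewrite -expr2 -(real_normK (num_real _)) ler_pXn2r ?nnegrE.
  by rewrite !sumr_const !card_ord -mulrnA -[leLHS]mulr_natl mulnC.
rewrite sqr_enorm (le_trans le1) // exprMn ler_wpM2r ?sqr_ge0 //.
by rewrite -natrX ler_nat; case: (m * n)%N => // k; rewrite -{1}[k.+1]expn1 leq_pexp2l.
Qed.

End euclidean_geometry.

Lemma sqr_enorm_rows (R : realType) (m n : nat) (x : 'M[R]_(m, n)) :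
  enorm x ^+ 2 = \sum_(i < m) enorm (row i x) ^+ 2.
Proof.
rewrite sqr_enorm [inner _ _]/inner; apply: eq_bigr => i _.
rewrite sqr_enorm /inner big_ord1.
by apply: eq_bigr => j _; rewrite !mxE.
Qed.

Lemma inner_trmx (R : realType) (m n p : nat) (M : 'M[R]_(p, m))
    (u : 'M[R]_(p, n)) (x : 'M[R]_(m, n)) :
  inner u (M *m x) = inner (M^T *m u) x.
Proof.
rewrite /inner.
transitivity (\sum_(i < p) \sum_(j < n) \sum_(k < m) M i k * u i j * x k j).
  apply: eq_bigr => i _; apply: eq_bigr => j _.
  by rewrite mxE mulr_sumr; apply: eq_bigr => k _; ring.
transitivity (\sum_(k < m) \sum_(j < n) \sum_(i < p) M i k * u i j * x k j).
  rewrite exchange_big /= [RHS]exchange_big; apply: eq_bigr => j _.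
  by rewrite exchange_big.
apply: eq_bigr => k _; apply: eq_bigr => j _.
by rewrite mxE mulr_suml; apply: eq_bigr => i _; rewrite mxE.
Qed.

Lemma enorm_trmx (R : realType) (m n : nat) (M : 'M[R]_(m, n)) :
  enorm M^T = enorm M.
Proof.
rewrite /enorm /inner exchange_big; congr Num.sqrt.
by apply: eq_bigr => i _; apply: eq_bigr => j _; rewrite !mxE.
Qed.

(** The Frobenius norm of [M] bounds its operator norm, whatever the number of
    columns of [x]; this keeps the bound independent of the dimension of the
    agents' variables. *)
Lemma enorm_mulmx (R : realType) (m n p : nat) (M : 'M[R]_(p, m))
    (x : 'M[R]_(m, n)) : enorm (M *m x) <= enorm M * enorm x.
Proof.
rewrite -(@ler_pXn2r _ 2) ?nnegrE ?mulr_ge0 ?enorm_ge0 //.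
rewrite exprMn !sqr_enorm /inner.
have -> : \sum_(i < m) \sum_(j < n) x i j * x i j =
          \sum_(j < n) \sum_(i < m) x i j ^+ 2.
  by rewrite exchange_big.
rewrite exchange_big /= mulr_sumr; apply: ler_sum => j _.
rewrite mulr_suml; apply: ler_sum => i _.
have -> : \sum_(j0 < m) M i j0 * M i j0 = enorm (row i M) ^+ 2.
  by rewrite sqr_enorm /inner big_ord1; apply: eq_bigr => k _; rewrite mxE.
have -> : \sum_(i0 < m) x i0 j ^+ 2 = enorm (col j x)^T ^+ 2.
  by rewrite sqr_enorm /inner big_ord1; apply: eq_bigr => k _; rewrite !mxE.
have -> : (M *m x) i j = inner (row i M) (col j x)^T.
  by rewrite mxE /inner big_ord1; apply: eq_bigr => k _; rewrite !mxE.
rewrite -exprMn -expr2 -[X in X <= _]real_normK ?num_real //.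
rewrite ler_pXn2r ?nnegrE ?mulr_ge0 ?enorm_ge0 // ler_norml inner_le_enorm andbT.
by rewrite lerNl -innerNl (le_trans (inner_le_enorm _ _)) // enormN.
Qed.

(** * Hoffman's error bound for linear inequalities *)

(** Fourier-Motzkin elimination of the first coordinate: each pair of rows with
    coefficients of opposite signs gives one row of the reduced system, whose
    violation at [x] is at most a constant times [v].  Once the other coordinates
    are repaired by induction, the lower and upper bounds for the first one are
    compatible and lie, up to a multiple of [v], on the right sides of its old
    value; the largest of the lower bounds (and of the old value moved down)
    is then a good choice.  The system is consistent because [0] solves it. *)
Lemma hoffman_ord (R : realFieldType) (n : nat) : forall (I : finType)
    (a : I -> 'I_n -> R),
  exists2 theta : R, 0 <= theta &
    forall (b : I -> R) (x : 'I_n -> R) (v : R),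
      (forall i, 0 <= b i) -> 0 <= v ->
      (forall i, \sum_j a i j * x j <= b i + v) ->
      exists2 y : 'I_n -> R, forall i, \sum_j a i j * y j <= b i &
        forall j, `|y j - x j| <= theta * v.
Proof.
elim: n => [|n IHn] I a.
  exists 0 => // b x v b0 _ _; exists x => [i|[]//].
  by rewrite big_ord0.
pose p i := a i ord0.
pose S i (x : 'I_n -> R) := \sum_j a i (lift ord0 j) * x j.
(* the reduced system is indexed by all the pairs: a pair that does not eliminate
   gives back its first row if that row is free of the coordinate, else [0 <= 0] *)
pose el (ik : I * I) (F : I -> R) :=
  if (0 < p ik.1) && (p ik.2 < 0) then F ik.1 / p ik.1 - F ik.2 / p ik.2
  else if p ik.1 == 0 then F ik.1 else 0.
have [th th0 hth] := IHn _ (fun ik j => el ik (fun i => a i (lift ord0 j))).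
have elS ik x : \sum_j el ik (fun i => a i (lift ord0 j)) * x j =
    el ik (fun i => S i x).
  rewrite /el; case: ifP => _; last case: ifP => _ //.
    rewrite /S !mulr_suml -sumrB; apply: eq_bigr => j _; ring.
  by rewrite big1 // => j _; rewrite mul0r.
pose s := \sum_i `|p i|^-1.
have s0 : 0 <= s by apply: sumr_ge0 => i _; rewrite invr_ge0.
have ps i : `|p i|^-1 <= s.
  by rewrite /s (bigD1 i) //= lerDl; apply: sumr_ge0 => j _; rewrite invr_ge0.
pose C := 1 + 2 * s.
have C0 : 0 <= C by rewrite /C; lra.
pose T := \sum_i \sum_j `|a i (lift ord0 j)|.
have T0 : 0 <= T by do 2!(apply: sumr_ge0 => ? _).
pose D := T * (th * C).
have D0 : 0 <= 1 + D by rewrite addr_ge0 ?ler01 // !mulr_ge0.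
exists (th * C + (1 + D) * s); first by rewrite addr_ge0 ?mulr_ge0.
move=> b x v b0 v0 xb.
pose x' j := x (lift ord0 j).
have xb' i : S i x' <= b i + v - p i * x ord0.
  have := xb i; rewrite big_ord_recl -/(p i) -/(S i x') => h; lra.
have [ik|||y' y'b y'x] := hth (fun ik => el ik b) x' (C * v).
- rewrite /el; case: ifP => [/andP[pi pk]|_].
    rewrite subr_ge0; apply: (@le_trans _ _ 0).
      by rewrite mulr_ge0_le0 // invr_le0 ltW.
    by rewrite mulr_ge0 // invr_ge0 ltW.
  by case: ifP.
- by rewrite mulr_ge0.
- move=> ik; rewrite elS /el; case: ifP => [/andP[pi pk]|_].
    have h1 : S ik.1 x' / p ik.1 <= (b ik.1 + v - p ik.1 * x ord0) / p ik.1.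
      by rewrite ler_pM2r ?invr_gt0.
    have h2 : - (S ik.2 x' / p ik.2) <=
              - ((b ik.2 + v - p ik.2 * x ord0) / p ik.2).
      by rewrite lerN2 ler_nM2r ?invr_lt0.
    have h3 := ps ik.1; have h4 := ps ik.2.
    rewrite gtr0_norm // in h3; rewrite ltr0_norm // invrN in h4.
    have e1 : (b ik.1 + v - p ik.1 * x ord0) / p ik.1 =
      b ik.1 / p ik.1 + v * (p ik.1)^-1 - x ord0 by field; rewrite gt_eqF.
    have e2 : (b ik.2 + v - p ik.2 * x ord0) / p ik.2 =
      b ik.2 / p ik.2 + v * (p ik.2)^-1 - x ord0 by field; rewrite lt_eqF.
    have h5 : v * (p ik.1)^-1 <= v * s by rewrite ler_wpM2l.
    have h6 : v * - (p ik.2)^-1 <= v * s by rewrite ler_wpM2l.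
    rewrite e1 in h1; rewrite e2 in h2; rewrite /C; lra.
  case: ifP => [/eqP pi|_]; last by rewrite add0r mulr_ge0.
  have := xb' ik.1; rewrite pi /C => h.
  have : 0 <= s * v by rewrite mulr_ge0.
  lra.
have dS i : `|S i y' - S i x'| <= D * v.
  have -> : S i y' - S i x' = \sum_j a i (lift ord0 j) * (y' j - x' j).
    by rewrite /S -sumrB; apply: eq_bigr => j _; rewrite mulrBr.
  apply: le_trans (ler_norm_sum _ _ _) _.
  rewrite /D -mulrA -mulrA /T.
  apply: (@le_trans _ _ ((\sum_j `|a i (lift ord0 j)|) * (th * (C * v)))).
    rewrite mulr_suml; apply: ler_sum => j _.
    by rewrite normrM ler_wpM2l.
  rewrite ler_wpM2r ?mulr_ge0 // [leRHS](bigD1 i) //= lerDl.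
  by do 2!(apply: sumr_ge0 => ? _).
pose lo i := (b i - S i y') / p i.
pose del := (1 + D) * s * v.
have del0 : 0 <= del by rewrite !mulr_ge0.
(* how far the bound that row [i] puts on the first coordinate can cross its
   old value *)
have dev i : p i * x ord0 - (1 + D) * v <= b i - S i y'.
  have := dS i; rewrite ler_norml => /andP[_ h].
  have := xb' i; lra.
have devs i : (1 + D) * v * `|p i|^-1 <= del.
  rewrite /del [leRHS]mulrAC; apply: ler_wpM2l; last exact: ps.
  by rewrite mulr_ge0.
pose t := \big[Num.max/(x ord0 - del)]_(k | p k < 0) lo k.
have tlo k : p k < 0 -> lo k <= t by move=> pk; apply: le_bigmax_cond.
have tge : x ord0 - del <= t by apply: bigmax_ge_id.
have tle : t <= x ord0 + del.
  apply/bigmax_leP; split; first by lra.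
  move=> k pk; have := devs k; rewrite ltr0_norm // invrN => h.
  apply: le_trans (_ : (p k * x ord0 - (1 + D) * v) / p k <= _).
    by rewrite ler_nM2r ?invr_lt0.
  have -> : (p k * x ord0 - (1 + D) * v) / p k =
    x ord0 - (1 + D) * v / p k by field; rewrite lt_eqF.
  lra.
have thi i : 0 < p i -> t <= lo i.
  move=> pi; apply/bigmax_leP; split.
    have := devs i; rewrite gtr0_norm // => h.
    apply: le_trans (_ : _ <= (p i * x ord0 - (1 + D) * v) / p i) _; last first.
      by rewrite ler_pM2r ?invr_gt0.
    have -> : (p i * x ord0 - (1 + D) * v) / p i =
      x ord0 - (1 + D) * v / p i by field; rewrite gt_eqF.
    lra.
  move=> k pk; have := y'b (i, k); rewrite elS /el /= pi pk /= /lo => h.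
  rewrite !mulrBl; lra.
exists (fun j => if unlift ord0 j is Some j' then y' j' else t).
  move=> i; rewrite big_ord_recl unlift_none -/(p i).
  rewrite (eq_bigr (fun j => a i (lift ord0 j) * y' j)) -/(S i y'); last first.
    by move=> j _; rewrite liftK.
  have [pi|pi|pi] := ltgtP (p i) 0.
  - have := tlo i pi; rewrite /lo ler_ndivrMr // => h; lra.
  - have := thi i pi; rewrite /lo ler_pdivlMr // => h; lra.
  - have := y'b (i, i); rewrite elS /el /= pi ltxx eqxx /=; lra.
move=> j; rewrite mulrDl; case: unliftP => [j' ->|->].
  apply: le_trans (y'x j') _; rewrite -mulrA lerDl.
  by rewrite !mulr_ge0.
rewrite -/del; have : 0 <= th * C * v by rewrite !mulr_ge0.
rewrite ler_norml => h; apply/andP; split; lra.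
Qed.

(** Every point that violates a consistent system by at most [v] is within
    [theta * v] of a solution, where [theta] depends on the coefficients only:
    not on the point, nor on the right-hand sides. *)
Lemma hoffman (R : realFieldType) (I V : finType) (a : I -> V -> R) :
  exists2 theta : R, 0 <= theta &
    forall (b : I -> R) (x : V -> R) (v : R),
      (forall i, 0 <= b i) -> 0 <= v ->
      (forall i, \sum_j a i j * x j <= b i + v) ->
      exists2 y : V -> R, forall i, \sum_j a i j * y j <= b i &
        forall j, `|y j - x j| <= theta * v.
Proof.
have [th th0 h] := hoffman_ord (fun i (j : 'I_#|V|) => a i (enum_val j)).
have reidx F : \sum_(j : V) F j = \sum_(j < #|V|) F (enum_val j) :> R.
  rewrite (reindex (@enum_val V xpredT)) /=; last first.
    by apply: onW_bij; apply: enum_val_bij.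
  by apply: eq_bigl => j.
exists th => // b x v b0 v0 xb.
have [//|//|i|y yb yx] := h b (fun j => x (enum_val j)) v.
  by rewrite -(reidx (fun j => a i j * x j)).
exists (fun j => y (enum_rank j)) => [i|j]; last first.
  by rewrite -{2}(enum_rankK j).
rewrite reidx; under eq_bigr do rewrite enum_valK.
exact: yb.
Qed.

(** * Minimizers of strongly convex functions *)

Section minimizers.
Variables (R : realType) (m n : nat).
Local Notation V := 'M[R]_(m, n).

(** An extended-valued proper closed convex function, given by its effective
    domain [D] and its finite values [rho] there.  Closedness of the epigraph is
    stated with approximating points, and the affine minorant is kept as part of
    the data because a polyhedral epigraph exhibits one. *)
Record closed_convex_on (D : set V) (rho : V -> R) : Prop := {
  cc_convex : forall x y t, D x -> D y -> 0 <= t <= 1 ->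
    D (x + t *: (y - x)) /\
    rho (x + t *: (y - x)) <= rho x + t * (rho y - rho x);
  cc_closed : forall l M,
    (forall eps, 0 < eps ->
       exists u, [/\ D u, rho u <= M + eps & enorm (u - l) <= eps]) ->
    D l /\ rho l <= M;
  cc_minorant : exists a k, forall x, D x -> k + inner a x <= rho x }.

Definition minimizes (D : set V) (F : V -> R) (x : V) : Prop :=
  D x /\ forall y, D y -> F x <= F y.

Lemma nested_intervals_meet (a : R -> R) :
  (forall s t, 0 < s -> 0 < t -> a s - s <= a t + t) ->
  exists l, forall t, 0 < t -> `|a t - l| <= t.
Proof.
move=> h; pose E := [set y | exists2 t, 0 < t & y = a t - t].
have ubE t : 0 < t -> ubound E (a t + t) by move=> t0 _ [s s0 ->]; exact: h.
have E0 : E !=set0 by exists (a 1 - 1); exists 1.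
have hE : has_sup E by split => //; exists (a 1 + 1); exact: ubE.
exists (sup E) => t t0; rewrite ler_distl; apply/andP; split; last first.
  by rewrite -lerBlDr; apply: ub_le_sup; [case: hE|exists t].
by rewrite lerBlDr; apply: ge_sup => //; exact: ubE.
Qed.

Lemma quadratic_lower_bound (p d : V) (k : R) : 0 < k ->
  - (enorm p ^+ 2 / (2 * k)) <= inner p d + k / 2 * enorm d ^+ 2.
Proof.
move=> k0; have := inner_ge0 (p + k *: d).
rewrite !(innerDl, innerDr, innerZl, innerZr) (innerC d p) -!sqr_enorm => h.
have -> : inner p d + k / 2 * enorm d ^+ 2 = - (enorm p ^+ 2 / (2 * k)) +
   (enorm p ^+ 2 + k * inner p d + (k * inner p d + k * (k * enorm d ^+ 2)))
     / (2 * k) by field; rewrite gt_eqF.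
by rewrite lerDl divr_ge0 // mulr_ge0 // ltW.
Qed.

(** A minimizing sequence of a strongly convex function is Cauchy: the midpoint
    of two almost minimizers would otherwise fall below the infimum. *)
Lemma minimizer_exists (D : set V) (rho h : V -> R) (g : V -> V) (k : R) :
  closed_convex_on D rho -> D !=set0 -> 0 < k ->
  (forall x y,
     h x + inner (g x) (y - x) + k / 2 * enorm (y - x) ^+ 2 <= h y) ->
  exists x, minimizes D (fun y => h y + rho y) x.
Proof.
move=> [cvx cl [a [b ab]]] [x0 Dx0] k0 hk.
pose F y := h y + rho y; pose E := [set F y | y in D].
have E0 : E !=set0 by exists (F x0), x0.
have hasE : has_inf E.
  split=> //; exists (h x0 - enorm (g x0 + a) ^+ 2 / (2 * k) + b + inner a x0).
  move=> _ [y Dy <-]; rewrite /F; have := hk x0 y; have := ab y Dy.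
  have := quadratic_lower_bound (g x0 + a) (y - x0) k0.
  rewrite innerDl (innerBr a); lra.
have Einf y : D y -> inf E <= F y.
  by move=> Dy; apply: ge_inf; [case: hasE|exists y].
(* the sequence is indexed by a positive tolerance instead of an integer *)
have near t : exists u, 0 < t -> D u /\ F u <= inf E + k / 4 * t ^+ 2.
  have [t0|t0] := ltP 0 t; last by exists 0 => ?; lra.
  have [|_ [u Du <-] hu] := @inf_adherent _ E (k / 4 * t ^+ 2) _ hasE.
    by rewrite mulr_gt0 ?exprn_gt0 // divr_gt0.
  by exists u => _; split=> //; exact: ltW.
have [u hu] := choice near.
have cauchy s t : 0 < s -> 0 < t -> enorm (u s - u t) <= s + t.
  move=> s0 t0; have [Ds Fs] := hu s s0; have [Dt Ft] := hu t t0.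
  pose w := u s + 2^-1 *: (u t - u s).
  have [|Dw rw] := cvx (u s) (u t) 2^-1 Ds Dt; first by apply/andP; split; lra.
  have Fw := Einf w Dw.
  have e1 : u s - w = 2^-1 *: (u s - u t).
    by apply/matrixP => i j; rewrite !mxE; lra.
  have e2 : u t - w = - (2^-1 *: (u s - u t)).
    by apply/matrixP => i j; rewrite !mxE; lra.
  have := hk w (u s); have := hk w (u t).
  rewrite e1 e2 enormN innerNr enormZ exprMn gtr0_norm ?invr_gt0 // -/w in rw *.
  move=> h1 h2; rewrite /F in Fw Fs Ft.
  have h3 : k / 4 * (enorm (u s - u t) ^+ 2) <= k / 4 * (s ^+ 2 + t ^+ 2) by lra.
  rewrite ler_pM2l ?divr_gt0 // in h3.
  rewrite -(@ler_pXn2r _ 2) ?nnegrE ?enorm_ge0 ?addr_ge0 ?ltW //; nra.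
have lim ij : exists l, forall t, 0 < t -> `|u t ij.1 ij.2 - l| <= t.
  apply: nested_intervals_meet => s t s0 t0.
  have := entry_le_enorm (u s - u t) ij.1 ij.2; rewrite !mxE ler_norml.
  by move=> /andP[_]; have := cauchy s t s0 t0; lra.
have [l hl] := choice lim.
pose x : V := \matrix_(i, j) l (i, j).
pose C : R := (m * n)%:R + 1.
have C0 : 1 <= C by rewrite /C lerDr.
have ux t : 0 < t -> enorm (u t - x) <= C * t.
  move=> t0; apply: (@le_trans _ _ ((m * n)%:R * t)); last first.
    by rewrite /C mulrDl lerDl mul1r ltW.
  apply: enorm_le_entries; first exact: ltW.
  by move=> i j; rewrite !mxE; exact: (hl (i, j)).
pose G := enorm (g x).
have G0 : 0 <= G by exact: enorm_ge0.
have [|Dx rx] := cl x (inf E - h x).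
  move=> eps eps0.
  pose t := Num.min 1 (eps / (C * (1 + G + k))).
  have dn0 : 0 < C * (1 + G + k) by apply: mulr_gt0; lra.
  have t0 : 0 < t by rewrite lt_min ltr01 divr_gt0.
  have t1 : t <= 1 by rewrite ge_min lexx.
  have te : C * t * (1 + G + k) <= eps.
    have : t <= eps / (C * (1 + G + k)) by rewrite ge_min lexx orbT.
    by rewrite ler_pdivlMr // => ?; lra.
  have [Du Fu] := hu t t0; have un := ux t t0; exists (u t); split=> //.
    have := hk x (u t); have := inner_le_enorm (- g x) (u t - x).
    rewrite innerNl enormN -/G => i1 i2.
    have : 0 <= k / 2 * enorm (u t - x) ^+ 2.
      by rewrite mulr_ge0 ?sqr_ge0 // divr_ge0 ?(ltW k0).
    have i3 : G * enorm (u t - x) <= G * (C * t) by rewrite ler_wpM2l.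
    have i4 : k / 4 * t ^+ 2 <= k * (C * t).
      rewrite -mulrA ler_pM2l //; nra.
    have : 0 <= C * t by rewrite mulr_ge0; lra.
    rewrite /F in Fu; lra.
  apply: le_trans un _; apply: le_trans te; rewrite ler_peMr //; last by lra.
  by rewrite mulr_ge0; lra.
exists x; split=> // y Dy; have := Einf y Dy; rewrite /F; lra.
Qed.

(** First-order optimality without subdifferentials: compare the minimizer with
    the points of the segment that leads to [y]. *)
Lemma minimizer_variational (D : set V) (rho h : V -> R) (p : V) (k : R) x :
  closed_convex_on D rho ->
  (forall y, h y <= h x + inner p (y - x) + k / 2 * enorm (y - x) ^+ 2) ->
  minimizes D (fun y => h y + rho y) x ->
  forall y, D y -> 0 <= inner p (y - x) + (rho y - rho x).
Proof.
move=> cc hup [Dx xmin] y Dy.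
set B := inner _ _ + _; rewrite leNgt; apply/negP => Blt0.
pose C := `|k / 2| * enorm (y - x) ^+ 2 + 1.
have C1 : 1 <= C by rewrite /C lerDr mulr_ge0 ?sqr_ge0.
have key t : 0 < t -> t <= 1 -> 0 <= B + t * C.
  move=> t0 t1; have tb : 0 <= t <= 1 by rewrite ltW.
  have [Dw rw] := cc_convex cc Dx Dy tb.
  have := xmin _ Dw; have := hup (x + t *: (y - x)).
  have -> : x + t *: (y - x) - x = t *: (y - x) by rewrite addrAC subrr add0r.
  rewrite innerZr enormZ exprMn gtr0_norm // => h1 h2.
  have kn : k / 2 * enorm (y - x) ^+ 2 <= C.
    by rewrite /C (@le_trans _ _ (`|k / 2| * enorm (y - x) ^+ 2)) ?lerDl //
       ler_wpM2r ?sqr_ge0 // ler_norm.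
  have : 0 <= t * (B + t * C).
    have : t * t * (k / 2 * enorm (y - x) ^+ 2) <= t * t * C.
      by rewrite ler_wpM2l // mulr_ge0 // ltW.
    rewrite /B; lra.
  by rewrite pmulr_rge0.
pose t := Num.min 1 (- B / (2 * C)).
have t0 : 0 < t by rewrite lt_min ltr01 divr_gt0 //; lra.
have := key t t0; rewrite ge_min lexx => /(_ isT).
have : t * (2 * C) <= - B.
  rewrite -ler_pdivlMr; last lra.
  by rewrite ge_min lexx orbT.
lra.
Qed.

End minimizers.

(** * One iteration: descent of the potential *)

Lemma subBB (V : zmodType) (a b d : V) : (a - b) - (a - d) = d - b.
Proof. by rewrite opprB addrC addrA subrK. Qed.

Section norm_identities.
Variables (R : realType) (m n : nat).
Implicit Types x y u v p q r : 'M[R]_(m, n).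

Lemma sqr_enormD u v :
  enorm (u + v) ^+ 2 = enorm u ^+ 2 + 2 * inner u v + enorm v ^+ 2.
Proof. by rewrite !sqr_enorm !(innerDl, innerDr) (innerC v u); ring. Qed.

Lemma sqr_enormB u v :
  enorm (u - v) ^+ 2 = enorm u ^+ 2 - 2 * inner u v + enorm v ^+ 2.
Proof. by rewrite sqr_enormD innerNr enormN; ring. Qed.

Lemma enormD_le u v (a b : R) :
  enorm u <= a -> enorm v <= b -> enorm (u + v) <= a + b.
Proof. by move=> ua vb; apply: le_trans (enormD _ _) (lerD ua vb). Qed.

Lemma young_inner u v (k : R) : 0 < k ->
  inner u v <= k / 4 * enorm v ^+ 2 + k^-1 * enorm u ^+ 2.
Proof.
move=> k0; have k20 : 0 < k / 2 by rewrite divr_gt0.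
have := quadratic_lower_bound (- u) v k20; rewrite innerNl enormN.
have -> : enorm u ^+ 2 / (2 * (k / 2)) = k^-1 * enorm u ^+ 2.
  by field; rewrite gt_eqF.
lra.
Qed.

(** Two variational inequalities at [u] and [v] cancel the nonsmooth terms;
    if moreover [p - q - r] is strongly monotone along [u - v], then [r] alone
    controls the distance. *)
Lemma variational_distance u v p q r (a k : R) :
  0 <= inner p (v - u) + a -> 0 <= inner q (u - v) - a ->
  k * enorm (u - v) ^+ 2 <= inner (p - q - r) (u - v) ->
  k * enorm (u - v) <= enorm r.
Proof.
move=> h1 h2 h3; have [uv0|uv0] := eqVneq (enorm (u - v)) 0.
  by rewrite uv0 mulr0 enorm_ge0.
have uvp : 0 < enorm (u - v) by rewrite lt_def uv0 enorm_ge0.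
rewrite -(ler_pM2r uvp) -mulrA -expr2 (le_trans h3) //.
have := inner_le_enorm (- r) (u - v); rewrite enormN.
move: h1; rewrite -(opprB u v) innerNr.
move: h2; rewrite innerNl !innerBl; lra.
Qed.

Lemma sqrD3_le (a b d : R) :
  (a + b + d) ^+ 2 <= 3 * (a ^+ 2 + b ^+ 2 + d ^+ 2).
Proof.
have := sqr_ge0 (a - b); have := sqr_ge0 (a - d); have := sqr_ge0 (b - d).
rewrite !expr2; lra.
Qed.

Lemma sqrD5_le (a b d e s : R) : (a + b + d + e + s) ^+ 2 <=
  5 * (a ^+ 2 + b ^+ 2 + d ^+ 2 + e ^+ 2 + s ^+ 2).
Proof.
have := sqr_ge0 (a - b); have := sqr_ge0 (a - d); have := sqr_ge0 (a - e).
have := sqr_ge0 (a - s); have := sqr_ge0 (b - d); have := sqr_ge0 (b - e).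
have := sqr_ge0 (b - s); have := sqr_ge0 (d - e); have := sqr_ge0 (d - s).
have := sqr_ge0 (e - s); rewrite !expr2; lra.
Qed.

End norm_identities.

Section iteration.
Variables (R : realType) (N n p : nat).
Local Notation V := 'M[R]_(N, n).
Variables (A B : 'M[R]_(p, N)).
Variables (f : V -> R) (gf : V -> V) (D : set V) (rho : V -> R).
Variables (L mu c kappa gamma : R).
Hypotheses (L_gt0 : 0 < L) (mu_ge : - L <= mu) (c_gt0 : 0 < c).
Hypotheses (kappa_gt0 : 0 < kappa) (kappa_gt : - mu < kappa).
Hypotheses (gamma_gt : 3 * L < gamma).
Hypothesis AB_ge : forall x : V,
  2 * enorm x ^+ 2 <= enorm (A *m x) ^+ 2 + enorm (B *m x) ^+ 2.
Hypothesis gf_lip : forall x y, enorm (gf x - gf y) <= L * enorm (x - y).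
Hypothesis f_low_quad : forall x y,
  mu / 2 * enorm (x - y) ^+ 2 <= f x - f y - inner (gf y) (x - y).

Let mu_kappa_gt0 : 0 < mu + kappa.
Proof. by rewrite addrC -(opprK mu) subr_gt0. Qed.

Let gamma_gt0 : 0 < gamma.
Proof. by rewrite (lt_trans _ gamma_gt) // mulr_gt0. Qed.

Let L_gamma_ge0 : 0 <= L + gamma.
Proof. by rewrite addr_ge0 ?ltW. Qed.

(** Exchanging the roles of [x] and [y] in the lower bound costs a gradient
    difference, hence the constant [3 * L] instead of the usual [L]; it is
    enough because [gamma > 3 * L]. *)
Lemma smooth_upper_bound x y :
  f x <= f y + inner (gf y) (x - y) + 3 * L / 2 * enorm (x - y) ^+ 2.
Proof.
have := f_low_quad y x; rewrite (enormB y x) -(opprB x y) innerNr => h.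
have := inner_le_enorm (gf x - gf y) (x - y); rewrite innerBl => h2.
have : enorm (gf x - gf y) * enorm (x - y) <= L * enorm (x - y) * enorm (x - y).
  by rewrite ler_wpM2r ?enorm_ge0.
rewrite -mulrA -expr2 => h3.
have : - L * enorm (x - y) ^+ 2 <= mu * enorm (x - y) ^+ 2.
  by rewrite ler_wpM2r ?sqr_ge0.
lra.
Qed.

Definition lag (lam : 'M[R]_(p, n)) (z x : V) : R :=
  f x + inner lam (A *m x) + c / 2 * enorm (A *m x) ^+ 2
    + kappa / 2 * enorm (x - z) ^+ 2.

Definition grad_lag (lam : 'M[R]_(p, n)) (z x : V) : V :=
  gf x + A^T *m lam + c *: (A^T *m (A *m x)) + kappa *: (x - z).

Lemma lag_diff lam z x y : lag lam z y - lag lam z x =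
  f y - f x - inner (gf x) (y - x) + inner (grad_lag lam z x) (y - x)
  + c / 2 * enorm (A *m (y - x)) ^+ 2 + kappa / 2 * enorm (y - x) ^+ 2.
Proof.
have -> : y = x + (y - x) by rewrite addrC subrK.
set d := y - x; rewrite (_ : x + d - x = d); last by rewrite addrAC subrr add0r.
rewrite /lag /grad_lag (addrAC x d (- z)) !mulmxDr !sqr_enormD.
rewrite !(innerDl, innerDr, innerZl) -!inner_trmx; lra.
Qed.

Lemma lag_lower lam z x y :
  lag lam z x + inner (grad_lag lam z x) (y - x)
    + (mu + kappa) / 2 * enorm (y - x) ^+ 2 <= lag lam z y.
Proof.
have := lag_diff lam z x y; have := f_low_quad y x.
have : 0 <= c / 2 * enorm (A *m (y - x)) ^+ 2.
  by rewrite mulr_ge0 ?sqr_ge0 // divr_ge0 // ltW.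
lra.
Qed.

Lemma lag_upper lam z x y : lag lam z y <=
  lag lam z x + inner (grad_lag lam z x) (y - x)
    + (3 * L + c * enorm A ^+ 2 + kappa) / 2 * enorm (y - x) ^+ 2.
Proof.
have := lag_diff lam z x y; have := smooth_upper_bound y x.
have : c / 2 * enorm (A *m (y - x)) ^+ 2 <=
       c / 2 * (enorm A ^+ 2 * enorm (y - x) ^+ 2).
  rewrite ler_wpM2l ?divr_ge0 ?(ltW c_gt0) // -exprMn.
  by rewrite ler_pXn2r ?nnegrE ?mulr_ge0 ?enorm_ge0 // enorm_mulmx.
lra.
Qed.

Lemma grad_lag_monotone lam z x y :
  (mu + kappa) * enorm (x - y) ^+ 2 <=
  inner (grad_lag lam z x - grad_lag lam z y) (x - y).
Proof.
have := lag_lower lam z x y; have := lag_lower lam z y x.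
rewrite innerBl (enormB y x) -(opprB x y) innerNr; lra.
Qed.

Hypothesis rho_cc : closed_convex_on D rho.

Lemma lag_minimizer_var lam z x :
  minimizes D (fun y => lag lam z y + rho y) x -> forall y, D y ->
  0 <= inner (grad_lag lam z x) (y - x) + (rho y - rho x).
Proof. by apply: minimizer_variational rho_cc _ => y; exact: lag_upper. Qed.

(** ** Exact minimizers, dual value and potential *)

Variables (xs : 'M[R]_(p, n) -> V -> V) (xb : V -> V) (theta : R).
Hypothesis xsP : forall lam z,
  minimizes D (fun y => lag lam z y + rho y) (xs lam z).
Hypothesis xbP : forall z,
  minimizes (D `&` [set y | A *m y = 0]) (fun y => lag 0 z y + rho y) (xb z).
Hypothesis dual_error : forall lam z,
  enorm (xs lam z - xb z) <= theta * enorm (A *m xs lam z).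

Definition dual_opt lam z := lag lam z (xs lam z) + rho (xs lam z).

Definition primal_opt z := lag 0 z (xb z) + rho (xb z).

Definition pot tau lam z x xm := lag lam z x + rho x
  + tau * enorm (x - xm) ^+ 2 + 2 * primal_opt z - 2 * dual_opt lam z.

Lemma dual_opt_ascent lam u z : dual_opt lam z
  + inner u (A *m xs (lam + u) z) <= dual_opt (lam + u) z.
Proof.
have := (xsP lam z).2 _ (xsP (lam + u) z).1.
rewrite /dual_opt /lag innerDl; lra.
Qed.

(** Danskin-type bounds: moving the proximal centre changes both optimal values
    by the change of the proximal term at one of the two minimizers, and the
    leading parts cancel in the difference. *)
Lemma duality_gap_center lam z u :
  primal_opt (z + u) - dual_opt lam (z + u)
  <= primal_opt z - dual_opt lam z + kappa * inner (xs lam (z + u) - xb z) u.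
Proof.
have := (xsP lam z).2 _ (xsP lam (z + u)).1.
have := (xbP (z + u)).2 _ (xbP z).1.
rewrite /primal_opt /dual_opt /lag !opprD !addrA.
rewrite !(sqr_enormB (_ - z) u) innerBl.
have := innerBl (xs lam (z + u)) z u; have := innerBl (xb z) z u.
move=> -> ->.
have hk v : enorm (v - z - u) ^+ 2 =
   enorm (v - z) ^+ 2 - 2 * (inner v u - inner z u) + enorm u ^+ 2.
  by rewrite sqr_enormB innerBl.
lra.
Qed.

Lemma lag_minimizer_center_lip lam z z1 :
  (mu + kappa) * enorm (xs lam z1 - xs lam z) <= kappa * enorm (z1 - z).
Proof.
have -> : kappa * enorm (z1 - z) = enorm (kappa *: (z - z1)).
  by rewrite enormZ gtr0_norm // enormB.
have v1 := lag_minimizer_var (xsP lam z1) (xsP lam z).1.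
have v2 := lag_minimizer_var (xsP lam z) (xsP lam z1).1.
apply: (variational_distance v1 (q := grad_lag lam z (xs lam z))).
  by rewrite opprB.
apply: le_trans (grad_lag_monotone lam z _ _) _.
rewrite le_eqVlt; apply/orP; left; apply/eqP; congr inner.
by apply/matrixP => i j; rewrite !mxE; ring.
Qed.

(** ** The proximal primal step *)

Section step.
Variables (lam : 'M[R]_(p, n)) (z x xm g x1 : V) (eta etab : R).
Hypotheses (eta_ge0 : 0 <= eta) (eta_le : eta <= etab).
Hypotheses (Dx : D x) (Dx1 : D x1).
Let s := x + eta *: (x - xm).
Let step_grad : V := g + gamma *: (x1 - s) + A^T *m lam
  + c *: (A^T *m (A *m x1)) + c *: (B^T *m (B *m (x1 - x)))
  + kappa *: (x1 - z).
Hypothesis x1_var : forall y, D y ->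
  0 <= inner step_grad (y - x1) + (rho y - rho x1).
Let dl := enorm (x1 - x).
Let dm := enorm (x - xm).
Let e := enorm (g - gf s).
Let w := enorm (x1 - z).

(** The coercivity of [A^T A + B^T B] makes the subproblem strongly convex with
    modulus [gamma + kappa + 2 c]; the price of the extrapolation is quadratic in
    the previous displacement. *)
Lemma primal_descent : lag lam z x1 + rho x1 <= lag lam z x + rho x
  - inner (g - gf s) (x1 - x) + (gamma - mu) / 2 * eta ^+ 2 * dm ^+ 2
  - (gamma + kappa + 2 * c) / 2 * dl ^+ 2.
Proof.
have := x1_var Dx; have := smooth_upper_bound x1 s; have := f_low_quad x s.
have dxs : enorm (x - s) ^+ 2 = eta ^+ 2 * dm ^+ 2.
  by rewrite enormB /s addrAC subrr add0r enormZ exprMn ger0_norm.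
have exs : x - s = (x1 - s) - (x1 - x) by rewrite subBB.
have exx : x - x1 = - (x1 - x) by rewrite opprB.
rewrite {2}exs exx innerNr innerBr dxs.
have ex1s := sqr_enormB (x1 - s) (x1 - x); rewrite -exs dxs in ex1s.
have ex1z := sqr_enormB (x1 - z) (x1 - x).
rewrite subBB in ex1z.
have eA := sqr_enormB (A *m x1) (A *m (x1 - x)).
rewrite -mulmxBr (_ : x1 - (x1 - x) = x) in eA; last first.
  by rewrite opprB addrC subrK.
have gs := congr1 (fun t => gamma * t) ex1s.
have [us eus] : exists u, u = x1 - s by exists (x1 - s).
have [uz euz] : exists u, u = x1 - z by exists (x1 - z).
rewrite /step_grad -eus -euz in gs ex1z *.
rewrite !(innerDl, innerZl) -!inner_trmx -!sqr_enorm.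
have AB := AB_ge (x1 - x).
have hB : 0 <= enorm (B *m (x1 - x)) ^+ 2 by rewrite sqr_ge0.
have lA : inner lam (A *m x1) - inner lam (A *m x) = inner lam (A *m (x1 - x)).
  by rewrite mulmxBr innerBr.
have hcAB : c * (2 * enorm (x1 - x) ^+ 2) <=
   c * (enorm (A *m (x1 - x)) ^+ 2 + enorm (B *m (x1 - x)) ^+ 2).
  by rewrite ler_wpM2l // ltW.
have hcB : 0 <= c * enorm (B *m (x1 - x)) ^+ 2 by rewrite mulr_ge0 // ltW.
have hL : 0 <= (gamma - 3 * L) * enorm us ^+ 2.
  by rewrite mulr_ge0 ?sqr_ge0 // subr_ge0 ltW.
rewrite /lag /dl innerNl ex1z eA -euz => h1 h2 h3.
lra.
Qed.

Lemma extrapolated_step_le : enorm (x1 - s) <= dl + etab * dm.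
Proof.
have -> : x1 - s = (x1 - x) - eta *: (x - xm) by rewrite /s opprD addrA.
apply: le_trans (enormD _ _) _; rewrite enormN enormZ ger0_norm //.
by rewrite lerD2l ler_wpM2r ?enorm_ge0.
Qed.

Definition primal_const := 1 + ((L + gamma) * (1 + etab) + 1
  + c * enorm B ^+ 2) / (mu + kappa).

Lemma enorm_BtB (v : V) : enorm (B^T *m (B *m v)) <= enorm B ^+ 2 * enorm v.
Proof.
apply: le_trans (enorm_mulmx _ _) _.
by rewrite enorm_trmx expr2 -mulrA ler_wpM2l ?enorm_ge0 ?enorm_mulmx.
Qed.

(** The new iterate minimizes a perturbed Lagrangian, so that strong convexity
    bounds its distance to the exact minimizer by the perturbation. *)
Lemma primal_error x' : minimizes D (fun y => lag lam z y + rho y) x' ->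
  enorm (x - x') <= primal_const * (dl + dm + e).
Proof.
move=> x'min; have x'var := lag_minimizer_var x'min.
have mk := mu_kappa_gt0; have Lg := L_gamma_ge0.
pose r := (gf x1 - gf s) - (g - gf s) - gamma *: (x1 - s)
          - c *: (B^T *m (B *m (x1 - x))).
have rle : enorm r <=
    ((L + gamma) * (1 + etab) + 1 + c * enorm B ^+ 2) * (dl + dm + e).
  have st := extrapolated_step_le.
  have h1 := enormD (gf x1 - gf s - (g - gf s) - gamma *: (x1 - s))
     (- (c *: (B^T *m (B *m (x1 - x))))).
  have h2 := enormD (gf x1 - gf s - (g - gf s)) (- (gamma *: (x1 - s))).
  have h3 := enormD (gf x1 - gf s) (- (g - gf s)).
  rewrite enormN enormZ gtr0_norm // in h1.
  rewrite enormN enormZ gtr0_norm in h2; last exact: gamma_gt0.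
  rewrite enormN in h3.
  have h4 := gf_lip x1 s.
  have h5 : c * enorm (B^T *m (B *m (x1 - x))) <= c * (enorm B ^+ 2 * dl).
    by rewrite ler_wpM2l ?(ltW c_gt0) //; exact: enorm_BtB.
  have h6 : (L + gamma) * enorm (x1 - s) <= (L + gamma) * (dl + etab * dm).
    by rewrite ler_wpM2l.
  have dl0 : 0 <= dl by exact: enorm_ge0.
  have dm0 : 0 <= dm by exact: enorm_ge0.
  have e0 : 0 <= e by exact: enorm_ge0.
  have et0 : 0 <= etab by exact: le_trans eta_le.
  have t1 : (L + gamma) * (dl + etab * dm) <=
            (L + gamma) * ((1 + etab) * (dl + dm + e)).
    rewrite ler_wpM2l //.
    have : 0 <= etab * dl by rewrite mulr_ge0.
    have : 0 <= etab * e by rewrite mulr_ge0.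
    lra.
  have t2 : c * (enorm B ^+ 2 * dl) <= c * (enorm B ^+ 2 * (dl + dm + e)).
    by rewrite ler_wpM2l ?(ltW c_gt0) // ler_wpM2l ?sqr_ge0 //; lra.
  rewrite -/r in h1; rewrite -/e in h3; lra.
have d1 : (mu + kappa) * enorm (x1 - x') <= enorm r.
  rewrite -[leRHS]enormN.
  apply: (variational_distance (x1_var (proj1 x'min))
            (a := rho x' - rho x1)).
    have := x'var _ Dx1; set q := inner _ _; instantiate (1 := grad_lag lam z x').
    by rewrite -/q; lra.
  apply: le_trans (grad_lag_monotone lam z x1 x') _.
  rewrite le_eqVlt; apply/orP; left; apply/eqP; congr inner.
  by apply/matrixP => i j; rewrite !mxE; ring.
have d2 : enorm (x1 - x') <=
  ((L + gamma) * (1 + etab) + 1 + c * enorm B ^+ 2) / (mu + kappa)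
    * (dl + dm + e).
  rewrite mulrAC ler_pdivlMr // mulrC; exact: le_trans d1 rle.
have := enormD (x - x1) (x1 - x'); rewrite addrA subrK (enormB x) -/dl.
have := enorm_ge0 (x - xm); rewrite -/dm.
have := enorm_ge0 (g - gf s); rewrite -/e /primal_const => h1 h2 h3.
lra.
Qed.

Variables (lam0 : 'M[R]_(p, n)) (alpha beta tau d2 : R).
Hypothesis lamE : lam = lam0 + alpha *: (A *m x).
Hypotheses (alpha_gt0 : 0 < alpha) (beta_gt0 : 0 < beta) (beta_le1 : beta <= 1).
Hypothesis beta_center : 16 * beta * kappa <= mu + kappa.
Hypothesis beta_theta : 16 * kappa * beta * theta ^+ 2 <= alpha.
Let d1 := (gamma + kappa + 2 * c) / 2 - tau.
Hypothesis d1_gt0 : 0 < d1.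
Hypothesis d2_le : d2 + (gamma - mu) / 2 * eta ^+ 2 <= tau.
Let Ca := 3 * (enorm A * primal_const) ^+ 2.
Hypothesis alpha_d1 : alpha * Ca <= d1 / 4.
Hypothesis alpha_d2 : alpha * Ca <= d2 / 2.
Hypothesis alpha_le1 : alpha * Ca <= 1.
Let v := enorm (A *m xs lam z).

(** The multiplier step raises the Lagrangian by [alpha |A x|^2] and twice the dual
    value by [2 alpha <A x, A x'>], where [x'] is the exact minimizer; together
    they make [alpha |A (x - x')|^2 - alpha |A x'|^2].  The first term is a primal
    error, absorbed by the primal descent when [alpha] is small, and the second is
    the decrease of the infeasibility.  Moving the proximal centre decreases the
    potential by a multiple of [beta |x1 - z|^2], up to a product of [x1 - z] with
    the distance between the two minimizers; the dual error bound turns it into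
    [|A x'|], absorbed when [beta] is small compared with [alpha]. *)
Lemma potential_descent :
  pot tau lam (z + beta *: (x1 - z)) x1 x <= pot tau lam0 z x xm
    - d1 / 2 * dl ^+ 2 - d2 / 2 * dm ^+ 2 - alpha / 2 * v ^+ 2
    - kappa * beta / 4 * w ^+ 2 + (d1^-1 + 1) * e ^+ 2.
Proof.
have hp := primal_descent.
have hd := dual_opt_ascent lam0 (alpha *: (A *m x)) z; rewrite -lamE in hd.
have hz := duality_gap_center lam z (beta *: (x1 - z)).
have hy := young_inner (- (g - gf s)) (x1 - x) d1_gt0.
rewrite innerNl enormN -/dl -/e in hy.
have eta_dm : (d2 + (gamma - mu) / 2 * eta ^+ 2) * dm ^+ 2 <= tau * dm ^+ 2.
  by rewrite ler_wpM2r ?sqr_ge0.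
have hl : lag lam z x = lag lam0 z x + alpha * enorm (A *m x) ^+ 2.
  by rewrite /lag lamE innerDl innerZl sqr_enorm; ring.
have hA : alpha * enorm (A *m x) ^+ 2 - 2 * (alpha * inner (A *m x) (A *m xs lam z))
    = alpha * enorm (A *m (x - xs lam z)) ^+ 2 - alpha * v ^+ 2.
  by rewrite mulmxBr sqr_enormB -/v; ring.
have hpe : alpha * enorm (A *m (x - xs lam z)) ^+ 2
    <= d1 / 4 * dl ^+ 2 + d2 / 2 * dm ^+ 2 + e ^+ 2.
  have : enorm (A *m (x - xs lam z)) ^+ 2 <= Ca * (dl ^+ 2 + dm ^+ 2 + e ^+ 2).
    have := sqrD3_le dl dm e; rewrite /Ca.
    set q := enorm A * primal_const; set S2 := _ + e ^+ 2; set S := (_ + _ + e).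
    move=> hS; have -> : 3 * q ^+ 2 * S2 = q ^+ 2 * (3 * S2) by ring.
    apply: le_trans (_ : q ^+ 2 * S ^+ 2 <= _); last first.
      by rewrite ler_wpM2l ?sqr_ge0.
    have pe := primal_error (xsP lam z).
    have q0 : 0 <= q * (dl + dm + e).
      rewrite /q -mulrA; apply: mulr_ge0; first exact: enorm_ge0.
      exact: le_trans (enorm_ge0 _) pe.
    rewrite -exprMn ler_pXn2r ?nnegrE ?enorm_ge0 //.
    apply: le_trans (enorm_mulmx _ _) _; rewrite /q -mulrA.
    by rewrite ler_wpM2l ?enorm_ge0 //; exact: primal_error.
  rewrite -(ler_pM2l alpha_gt0) => h; apply: le_trans h _.
  have i1 : alpha * Ca * dl ^+ 2 <= d1 / 4 * dl ^+ 2.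
    by rewrite ler_wpM2r ?sqr_ge0.
  have i2 : alpha * Ca * dm ^+ 2 <= d2 / 2 * dm ^+ 2.
    by rewrite ler_wpM2r ?sqr_ge0.
  have i3 : alpha * Ca * e ^+ 2 <= 1 * e ^+ 2 by rewrite ler_wpM2r ?sqr_ge0.
  lra.
have hw : kappa / 2 * (enorm (x1 - (z + beta *: (x1 - z))) ^+ 2 - w ^+ 2)
    <= - (kappa * beta / 2 * w ^+ 2).
  have -> : x1 - (z + beta *: (x1 - z)) = (1 - beta) *: (x1 - z).
    by apply/matrixP => i j; rewrite !mxE; ring.
  rewrite enormZ exprMn -/w real_normK ?num_real //.
  have : 0 <= beta * (1 - beta) * (kappa * w ^+ 2).
    apply: mulr_ge0; first by rewrite mulr_ge0 ?subr_ge0 ?(ltW beta_gt0).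
    by rewrite mulr_ge0 ?sqr_ge0 ?(ltW kappa_gt0).
  lra.
have hc : 2 * (kappa * inner (xs lam (z + beta *: (x1 - z)) - xb z)
      (beta *: (x1 - z))) <= kappa * beta / 4 * w ^+ 2 + alpha / 2 * v ^+ 2.
  have w0 : 0 <= w by exact: enorm_ge0.
  have v0 : 0 <= v by exact: enorm_ge0.
  rewrite innerZr.
  set x2 := xs lam (z + _).
  have l1 := lag_minimizer_center_lip lam z (z + beta *: (x1 - z)).
  rewrite -/x2 addrAC subrr add0r enormZ gtr0_norm // -/w in l1.
  have l2 : enorm (x2 - xs lam z) <= w / 16.
    rewrite -(ler_pM2l mu_kappa_gt0) (le_trans l1) //.
    have : 16 * beta * kappa * w <= (mu + kappa) * w by rewrite ler_wpM2r.
    lra.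
  have l3 := dual_error lam z; rewrite -/v in l3.
  have l4 := enormD (x2 - xs lam z) (xs lam z - xb z).
  rewrite addrA subrK in l4.
  have l5 := inner_le_enorm (x2 - xb z) (x1 - z); rewrite -/w in l5.
  have l6 : enorm (x2 - xb z) * w <= (w / 16 + theta * v) * w.
    by rewrite ler_wpM2r //; lra.
  have kb0 : 0 < kappa * beta by rewrite mulr_gt0.
  have l7 : kappa * beta * inner (x2 - xb z) (x1 - z) <=
       kappa * beta * ((w / 16 + theta * v) * w).
    by rewrite ler_wpM2l ?(ltW kb0) //; lra.
  have l8 : 16 * kappa * beta * theta ^+ 2 * v ^+ 2 <= alpha * v ^+ 2.
    by rewrite ler_wpM2r ?sqr_ge0.
  have l9 : 0 <= kappa * beta * (w - 8 * (theta * v)) ^+ 2.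
    by rewrite mulr_ge0 ?sqr_ge0 ?(ltW kb0).
  rewrite sqrrB in l9; lra.
rewrite innerZl in hd.
have hl1 : lag lam (z + beta *: (x1 - z)) x1 = lag lam z x1
   + kappa / 2 * (enorm (x1 - (z + beta *: (x1 - z))) ^+ 2 - w ^+ 2).
  by rewrite /lag -/w; ring.
rewrite /pot hl1 -/dm -/dl; rewrite -/dl -/dm in hp.
rewrite /d1 in hpe hy *; lra.
Qed.

Definition gap_const :=
  let Cx := 1 + enorm A * primal_const in
  let Cu := 2 + L * etab + 1 + gamma * (1 + etab)
            + c * enorm A * (Cx + enorm A) + c * enorm B ^+ 2 + kappa in
  5 * (Cu + Cx) ^+ 2.

(** The new iterate is itself the proximal point of a perturbation of the
    argument of the gap, so the gap is controlled by that perturbation. *)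
Lemma gap_bound u : D u ->
  (forall y, D y ->
     0 <= inner (u - (x - gf x - A^T *m lam)) (y - u) + (rho y - rho u)) ->
  enorm (x - u) ^+ 2 + enorm (A *m x) ^+ 2 <=
  gap_const * (dl ^+ 2 + dm ^+ 2 + e ^+ 2 + v ^+ 2 + w ^+ 2).
Proof.
move=> Du uvar.
have dl0 : 0 <= dl by exact: enorm_ge0.
have dm0 : 0 <= dm by exact: enorm_ge0.
have e0 : 0 <= e by exact: enorm_ge0.
have v0 : 0 <= v by exact: enorm_ge0.
have w0 : 0 <= w by exact: enorm_ge0.
have A0 : 0 <= enorm A by exact: enorm_ge0.
have et0 : 0 <= etab by exact: le_trans eta_le.
have L0 := ltW L_gt0; have c0 := ltW c_gt0; have g0 := ltW gamma_gt0.
have k0 := ltW kappa_gt0.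
have P0 : 0 <= primal_const.
  rewrite /primal_const addr_ge0 // divr_ge0 ?(ltW mu_kappa_gt0) //.
  by rewrite !addr_ge0 // mulr_ge0 ?sqr_ge0 ?addr_ge0.
have pe := primal_error (xsP lam z).
pose T := dl + dm + e + v + w.
pose Cx := 1 + enorm A * primal_const.
have AP0 : 0 <= enorm A * primal_const by rewrite mulr_ge0.
have hAx : enorm (A *m x) <= Cx * T.
  have := enormD (A *m (x - xs lam z)) (A *m xs lam z).
  rewrite -mulmxDr subrK -/v => h1.
  have h2 := enorm_mulmx A (x - xs lam z).
  have h3 : enorm A * enorm (x - xs lam z) <= enorm A * (primal_const * (dl + dm + e)).
    by rewrite ler_wpM2l.
  have : 0 <= enorm A * primal_const * (v + w) by rewrite mulr_ge0 ?addr_ge0.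
  rewrite /Cx /T; lra.
pose r := (x1 - x) + (gf x - gf s) - (g - gf s) - gamma *: (x1 - s)
   - c *: (A^T *m (A *m x1)) - c *: (B^T *m (B *m (x1 - x))) - kappa *: (x1 - z).
have ux1 : 1 * enorm (u - x1) <= enorm r.
  apply: (variational_distance (uvar _ Dx1) (q := step_grad)).
    by rewrite opprB; exact: x1_var.
  rewrite mul1r sqr_enorm le_eqVlt; apply/orP; left; apply/eqP; congr inner.
  by apply/matrixP => i j; rewrite !mxE; ring.
have rle : enorm r <= dl + L * (etab * dm) + e + gamma * (dl + etab * dm)
   + c * (enorm A * (Cx * T + enorm A * dl)) + c * (enorm B ^+ 2 * dl) + kappa * w.
  rewrite /r; (apply: enormD_le; [apply: enormD_le; [apply: enormD_le; [apply: enormD_le;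
    [apply: enormD_le; [apply: enormD_le|]|]|]|]|]);
    rewrite ?enormN ?enormZ ?(gtr0_norm c_gt0) ?(gtr0_norm gamma_gt0)
      ?(gtr0_norm kappa_gt0) //.
  - apply: le_trans (gf_lip _ _) _; rewrite ler_wpM2l // enormB /s addrAC subrr.
    by rewrite add0r enormZ ger0_norm // ler_wpM2r.
  - by rewrite ler_wpM2l // extrapolated_step_le.
  - rewrite ler_wpM2l // (le_trans (enorm_mulmx _ _)) //.
    rewrite enorm_trmx ler_wpM2l //.
    have -> : A *m x1 = A *m x + A *m (x1 - x) by rewrite -mulmxDr addrC subrK.
    by apply: enormD_le => //; exact: enorm_mulmx.
  - by rewrite ler_wpM2l //; exact: enorm_BtB.
pose Cu := 2 + L * etab + 1 + gamma * (1 + etab)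
            + c * enorm A * (Cx + enorm A) + c * enorm B ^+ 2 + kappa.
have T0 : 0 <= T by rewrite !addr_ge0.
have hxu : enorm (x - u) <= Cu * T.
  have := enormD (x - x1) (x1 - u); rewrite addrA subrK (enormB x x1) -/dl.
  rewrite (enormB x1 u) => h; rewrite mul1r in ux1.
  have q1 : L * (etab * dm) <= L * etab * T.
    by rewrite -mulrA ler_wpM2l // ler_wpM2l // /T; lra.
  have q2 : gamma * (dl + etab * dm) <= gamma * ((1 + etab) * T).
    rewrite ler_wpM2l //.
    have : etab * dm <= etab * T by rewrite ler_wpM2l // /T; lra.
    have : dl <= T by rewrite /T; lra.
    lra.
  have q3 : c * (enorm A * (Cx * T + enorm A * dl)) <=
            c * (enorm A * ((Cx + enorm A) * T)).
    do 2!(apply: ler_wpM2l => //).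
    have : enorm A * dl <= enorm A * T by rewrite ler_wpM2l // /T; lra.
    lra.
  have q4 : c * (enorm B ^+ 2 * dl) <= c * (enorm B ^+ 2 * T).
    by rewrite ler_wpM2l // ler_wpM2l ?sqr_ge0 // /T; lra.
  have q5 : kappa * w <= kappa * T by rewrite ler_wpM2l // /T; lra.
  have q6 : dl + dl + e <= 3 * T by rewrite /T; lra.
  rewrite /Cu; lra.
have hs := sqrD5_le dl dm e v w; rewrite -/T in hs.
have ug : enorm (x - u) ^+ 2 + enorm (A *m x) ^+ 2 <= ((Cu + Cx) * T) ^+ 2.
  apply: le_trans (_ : (enorm (x - u) + enorm (A *m x)) ^+ 2 <= _).
    have : 0 <= enorm (x - u) * enorm (A *m x) by rewrite mulr_ge0 ?enorm_ge0.
    rewrite !expr2; lra.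
  have s0 : 0 <= enorm (x - u) + enorm (A *m x) by rewrite addr_ge0 ?enorm_ge0.
  have s1 : enorm (x - u) + enorm (A *m x) <= (Cu + Cx) * T by rewrite mulrDl lerD.
  by rewrite ler_pXn2r ?nnegrE // (le_trans s0).
apply: le_trans ug _; rewrite exprMn.
have -> : gap_const = (Cu + Cx) ^+ 2 * 5 by rewrite mulrC.
by rewrite -mulrA; apply: ler_wpM2l; rewrite ?sqr_ge0.
Qed.

End step.

(** Both the Lagrangian and the constrained optimal value dominate the dual value. *)
Lemma pot_ge tau lam z x xm f_low : 0 <= tau -> D x ->
  (forall y, D y -> A *m y = 0 -> f_low <= f y + rho y) ->
  f_low <= pot tau lam z x xm.
Proof.
move=> tau0 Dx lowP; have [[Db Ab] _] := xbP z; rewrite /= in Ab.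
have h1 := (xsP lam z).2 _ Dx; have h2 := (xsP lam z).2 _ Db.
have h3 := lowP _ Db Ab.
have : 0 <= tau * enorm (x - xm) ^+ 2 by rewrite mulr_ge0 ?sqr_ge0.
have : 0 <= kappa / 2 * enorm (xb z - z) ^+ 2.
  by rewrite mulr_ge0 ?sqr_ge0 // divr_ge0 // ltW.
have eb l : lag l z (xb z) = f (xb z) + kappa / 2 * enorm (xb z - z) ^+ 2.
  by rewrite /lag Ab inner0r enorm0; ring.
rewrite /pot /primal_opt /dual_opt eb; rewrite eb in h2; lra.
Qed.

(** ** Summation along a trajectory *)

Section trajectory.
Variables (x z g u : nat -> V) (lam : nat -> 'M[R]_(p, n)) (eta : nat -> R).
Variables (alpha beta tau d2 etab m0 f_low : R).
Let s k := x k + eta k *: (x k - x k.-1).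
Hypotheses (Dx : forall k, D (x k)) (Du : forall k, D (u k)).
Hypothesis lamE : forall k, lam k.+1 = lam k + alpha *: (A *m x k).
Hypothesis zE : forall k, z k.+1 = z k + beta *: (x k.+1 - z k).
Hypothesis x_var : forall k y, D y ->
  0 <= inner (g k + gamma *: (x k.+1 - s k) + A^T *m lam k.+1
        + c *: (A^T *m (A *m x k.+1)) + c *: (B^T *m (B *m (x k.+1 - x k)))
        + kappa *: (x k.+1 - z k)) (y - x k.+1) + (rho y - rho (x k.+1)).
Hypothesis u_var : forall k y, D y ->
  0 <= inner (u k - (x k - gf (x k) - A^T *m lam k.+1)) (y - u k)
       + (rho y - rho (u k)).
Hypotheses (eta_ge0 : forall k, 0 <= eta k) (eta_le : forall k, eta k <= etab).
Hypotheses (alpha_gt0 : 0 < alpha) (beta_gt0 : 0 < beta) (beta_le1 : beta <= 1).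
Hypothesis beta_center : 16 * beta * kappa <= mu + kappa.
Hypothesis beta_theta : 16 * kappa * beta * theta ^+ 2 <= alpha.
Let d1 := (gamma + kappa + 2 * c) / 2 - tau.
Hypotheses (d1_gt0 : 0 < d1) (tau_ge0 : 0 <= tau).
Hypothesis d2_le : forall k, d2 + (gamma - mu) / 2 * eta k ^+ 2 <= tau.
Let Ca := 3 * (enorm A * primal_const etab) ^+ 2.
Hypotheses (alpha_d1 : alpha * Ca <= d1 / 4) (alpha_d2 : alpha * Ca <= d2 / 2).
Hypothesis alpha_le1 : alpha * Ca <= 1.
Hypothesis lowP : forall y, D y -> A *m y = 0 -> f_low <= f y + rho y.
Hypotheses (m0_gt0 : 0 < m0) (m0_d1 : m0 <= d1 / 2) (m0_d2 : m0 <= d2 / 2).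
Hypotheses (m0_alpha : m0 <= alpha / 2) (m0_beta : m0 <= kappa * beta / 4).

Lemma sum_gap_le K :
  \sum_(k < K) (enorm (x k - u k) ^+ 2 + enorm (A *m x k) ^+ 2) <=
  gap_const etab * (m0^-1 * (pot tau (lam 0%N) (z 0%N) (x 0%N) (x 0%N) - f_low)
    + (1 + (d1^-1 + 1) / m0) * \sum_(k < K) enorm (g k - gf (s k)) ^+ 2).
Proof.
pose e k := enorm (g k - gf (s k)).
pose S k := enorm (x k.+1 - x k) ^+ 2 + enorm (x k - x k.-1) ^+ 2
   + enorm (A *m xs (lam k.+1) (z k)) ^+ 2 + enorm (x k.+1 - z k) ^+ 2.
pose ph k := pot tau (lam k) (z k) (x k) (x k.-1).
have descent k : m0 * S k <= ph k - ph k.+1 + (d1^-1 + 1) * e k ^+ 2.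
  have := potential_descent (eta_ge0 k) (eta_le k) (Dx k) (Dx k.+1)
    (@x_var k) (lamE k) alpha_gt0 beta_gt0 beta_le1 beta_center beta_theta
    d1_gt0 (d2_le k) alpha_d1 alpha_d2 alpha_le1.
  rewrite -zE -/(ph k) -/(ph k.+1) -/(e k) -/d1.
  have le0 (a b : R) (t : R) : a <= b -> a * t ^+ 2 <= b * t ^+ 2.
    by move=> ab; rewrite ler_wpM2r ?sqr_ge0.
  have := le0 _ _ (enorm (x k.+1 - x k)) m0_d1.
  have := le0 _ _ (enorm (x k - x k.-1)) m0_d2.
  have := le0 _ _ (enorm (A *m xs (lam k.+1) (z k))) m0_alpha.
  have := le0 _ _ (enorm (x k.+1 - z k)) m0_beta.
  rewrite /S; lra.
have sumS : m0 * \sum_(k < K) S k <=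
    ph 0%N - ph K + (d1^-1 + 1) * \sum_(k < K) e k ^+ 2.
  elim: K => [|K IH]; first by rewrite !big_ord0 subrr !mulr0 addr0.
  by rewrite !big_ord_recr /=; have := descent K; lra.
have phK : f_low <= ph K by exact: pot_ge.
have G0 : 0 <= gap_const etab by rewrite /gap_const mulr_ge0 ?sqr_ge0.
apply: le_trans (_ : gap_const etab * \sum_(k < K) (S k + e k ^+ 2) <= _).
  rewrite mulr_sumr; apply: ler_sum => k _.
  rewrite (_ : S k + e k ^+ 2 =
    enorm (x k.+1 - x k) ^+ 2 + enorm (x k - x k.-1) ^+ 2 + e k ^+ 2
    + enorm (A *m xs (lam k.+1) (z k)) ^+ 2 + enorm (x k.+1 - z k) ^+ 2).
    have h := gap_bound (eta_ge0 k) (eta_le k) (Dx k.+1) (@x_var k)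
      (Du k) (@u_var k).
    exact: h.
  by rewrite /S; ring.
rewrite ler_wpM2l // big_split /= mulrDl mul1r.
have : \sum_(k < K) S k <=
    m0^-1 * (ph 0%N - f_low + (d1^-1 + 1) * \sum_(k < K) e k ^+ 2).
  rewrite mulrC ler_pdivlMr // mulrC; lra.
rewrite -/(ph 0%N); move: (\sum_(k < K) e k ^+ 2) => E.
rewrite mulrDr mulrCA mulrA; lra.
Qed.

End trajectory.
End iteration.

(** * Polyhedral functions and the dual error bound *)

Section polyhedral_function.
Variables (R : realType) (n q : nat) (r : 'rV[R]_n -> \bar R).
Variables (Sx : 'M[R]_(q, n)) (Sy zeta : 'cV[R]_q).
Hypothesis r_proper : proper_fun r.
Hypothesis r_epi : forall (x : 'rV[R]_n) (y : R), (r x <= y%:E)%E <->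
  forall l : 'I_q, zeta l 0 <= (Sx *m x^T + y *: Sy) l 0.

Lemma epi_entry (x : 'rV[R]_n) y (l : 'I_q) :
  (Sx *m x^T + y *: Sy) l 0 = inner (row l Sx) x + y * Sy l 0.
Proof.
rewrite !mxE /inner big_ord1; congr (_ + _).
by apply: eq_bigr => j _; rewrite !mxE.
Qed.

Lemma epi_le (x : 'rV[R]_n) (y : R) : (r x <= y%:E)%E <->
  forall l, zeta l 0 <= inner (row l Sx) x + y * Sy l 0.
Proof. by rewrite r_epi; split=> h l; have := h l; rewrite epi_entry. Qed.

Lemma finite_value x : (r x < +oo)%E -> r x = (fine (r x))%:E.
Proof. by move=> xoo; rewrite fineK // fin_real // r_proper.1 xoo. Qed.

Lemma epi_Sy_ge0 l : 0 <= Sy l 0.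
Proof.
have [x0 x0oo] := r_proper.2; have ex := finite_value x0oo.
rewrite leNgt; apply/negP => sl.
pose s := inner (row l Sx) x0 - zeta l 0.
have : (r x0 <= (Num.max (fine (r x0)) ((s + 1) / - Sy l 0))%:E)%E.
  by rewrite ex lee_fin le_max lexx.
move=> /epi_le /(_ l); apply/negP; rewrite -ltNge.
have : (s + 1) / - Sy l 0 <= Num.max (fine (r x0)) ((s + 1) / - Sy l 0).
  by rewrite le_max lexx orbT.
rewrite ler_pdivrMr ?oppr_gt0 // /s; lra.
Qed.

Lemma epi_Sy_gt0 : exists l, 0 < Sy l 0.
Proof.
have [x0 x0oo] := r_proper.2; have ex := finite_value x0oo.
apply: contrapT => h.
have sy0 l : Sy l 0 = 0.
  apply/eqP; rewrite eq_le epi_Sy_ge0 andbT leNgt.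
  by apply/negP => sl; apply: h; exists l.
have : (r x0 <= (fine (r x0) - 1)%:E)%E.
  apply/epi_le => l; rewrite sy0 mulr0.
  have /epi_le /(_ l) : (r x0 <= (fine (r x0))%:E)%E by rewrite -ex.
  by rewrite sy0 mulr0.
by rewrite {1}ex lee_fin; lra.
Qed.

Let F l x := (zeta l 0 - inner (row l Sx) x) / Sy l 0.
Let Y l0 x := \big[Num.max/F l0 x]_(l | 0 < Sy l 0) F l x.

Lemma polyhedral_value l0 x : 0 < Sy l0 0 -> (r x < +oo)%E -> r x = (Y l0 x)%:E.
Proof.
move=> l00 xoo; have ex := finite_value xoo.
have Fle l y : 0 < Sy l 0 -> (zeta l 0 <= inner (row l Sx) x + y * Sy l 0) =
    (F l x <= y).
  by move=> sl; rewrite /F ler_pdivrMr // lerBlDl.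
have /epi_le hx : (r x <= (fine (r x))%:E)%E by rewrite -ex.
apply/eqP; rewrite eq_le {2}ex lee_fin; apply/andP; split; last first.
  apply/bigmax_leP; split; first by rewrite -Fle.
  by move=> l sl; rewrite -Fle.
apply/epi_le => l; have := epi_Sy_ge0 l; rewrite le_eqVlt => /orP[/eqP sl|sl].
  by have := hx l; rewrite -sl !mulr0.
by rewrite Fle //; exact: le_bigmax_cond.
Qed.

(** A polyhedral function is the restriction of a Lipschitz function (a maximum
    of affine ones) to a closed polyhedron; this description passes to sums, which
    are therefore closed. *)
Lemma polyhedral_lipschitz : exists (Z : 'rV[R]_n -> R) (C : R), [/\ 0 <= C,
  forall x, (r x < +oo)%E -> r x = (Z x)%:E,
  forall x y, Z x <= Z y + C * enorm (x - y),
  forall l, (forall eps, 0 < eps ->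
     exists2 u, (r u < +oo)%E & enorm (u - l) <= eps) -> (r l < +oo)%E
  & exists a k, forall x, k + inner a x <= Z x].
Proof.
have [l0 l00] := epi_Sy_gt0.
pose C := \sum_(l < q) enorm (row l Sx) / Sy l 0.
have C0 : 0 <= C.
  by apply: sumr_ge0 => l _; rewrite divr_ge0 ?enorm_ge0 ?epi_Sy_ge0.
have FC l x y : 0 < Sy l 0 -> F l x <= F l y + C * enorm (x - y).
  move=> sl; have : enorm (row l Sx) / Sy l 0 * enorm (x - y) <= C * enorm (x - y).
    rewrite ler_wpM2r ?enorm_ge0 // /C (bigD1 l) //= lerDl.
    by apply: sumr_ge0 => i _; rewrite divr_ge0 ?enorm_ge0 ?epi_Sy_ge0.
  move=> h; apply: le_trans (lerD (lexx _) h).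
  rewrite /F -lerBlDl -mulrBl mulrAC ler_pM2r ?invr_gt0 //.
  have := inner_le_enorm (row l Sx) (y - x); rewrite innerBr (enormB y x); lra.
exists (Y l0), C; split=> //.
- by move=> x; exact: polyhedral_value.
- move=> x y; apply/bigmax_leP; split.
    by apply: le_trans (FC l0 x y l00) _; rewrite lerD2r; apply: le_bigmax_cond.
  by move=> l sl; apply: le_trans (FC l x y sl) _; rewrite lerD2r; apply: le_bigmax_cond.
- move=> x hx.
  apply: (@le_lt_trans _ _ (Y l0 x)%:E); last exact: ltry.
  apply/epi_le => l.
  have := epi_Sy_ge0 l; rewrite le_eqVlt => /orP[/eqP sl|sl]; last first.
    have : F l x <= Y l0 x by exact: le_bigmax_cond.
    by rewrite /F ler_pdivrMr // lerBlDl.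
  rewrite -sl mulr0 addr0 leNgt; apply/negP => hl.
  pose eps := (zeta l 0 - inner (row l Sx) x) / (enorm (row l Sx) + 1).
  have d0 : 0 < enorm (row l Sx) + 1 by rewrite ltr_wpDl ?enorm_ge0.
  have eps0 : 0 < eps by rewrite divr_gt0 // subr_gt0.
  have [u uoo ux] := hx eps eps0.
  have /epi_le /(_ l) : (r u <= (fine (r u))%:E)%E by rewrite -finite_value.
  rewrite -sl mulr0 addr0 => zu.
  have := inner_le_enorm (row l Sx) (u - x); rewrite innerBr => h.
  have : enorm (row l Sx) * enorm (u - x) <= enorm (row l Sx) * eps.
    by rewrite ler_wpM2l ?enorm_ge0.
  have : eps * (enorm (row l Sx) + 1) = zeta l 0 - inner (row l Sx) x.
    by rewrite /eps divfK // gt_eqF.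
  lra.
- exists (- (Sy l0 0)^-1 *: row l0 Sx), (zeta l0 0 / Sy l0 0) => x.
  apply: le_trans (_ : F l0 x <= _); last exact: bigmax_ge_id.
  by rewrite innerZl /F; lra.
Qed.

End polyhedral_function.

Section polyhedral_sum.
Variables (R : realType) (N n : nat) (r : 'I_N -> 'rV[R]_n -> \bar R).
Variables (q : 'I_N -> nat).
Variables (Sx : forall i, 'M[R]_(q i, n)) (Sy zeta : forall i, 'cV[R]_(q i)).
Hypothesis r_proper : forall i, proper_fun (r i).
Hypothesis r_epi : polyhedral_epigraph r Sx Sy zeta.
Local Notation V := 'M[R]_(N, n).

Definition dom_sum : set V := [set x | (rsum r x < +oo)%E].

Definition val_sum (x : V) : R := fine (rsum r x).

Lemma dom_sumP x : dom_sum x <-> forall i, (r i (row i x) < +oo)%E.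
Proof.
rewrite /dom_sum /= /rsum; split=> [h i|h].
  rewrite ltey; apply/eqP => ri; move: h; rewrite ltey => /eqP; apply.
  apply/eqP; rewrite esum_eqy; first by apply/existsP; exists i; rewrite ri eqxx.
  by move=> j _; rewrite gt_eqF // (r_proper j).1.
by apply: lte_sum_pinfty => i _; exact: h.
Qed.

Lemma rsumE x : dom_sum x -> rsum r x = (val_sum x)%:E.
Proof.
move=> xoo; rewrite /val_sum fineK // fin_real // xoo andbT.
rewrite ltNye; apply/eqP => /eqP; rewrite /rsum esum_eqNy => /existsP[i /andP[_ /eqP e]].
by have := (r_proper i).1 (row i x); rewrite e.
Qed.

Lemma val_sumE x : dom_sum x -> val_sum x = \sum_i fine (r i (row i x)).
Proof.
move=> xoo; apply: EFin_inj; rewrite -rsumE // /rsum -sumEFin.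
apply: eq_bigr => i _; apply: finite_value; first exact: r_proper.
by move/dom_sumP: xoo.
Qed.

(** The epigraph of the sum, lifted to one height per agent: it is the
    polyhedron on which the error bound for linear inequalities is used. *)
Definition lifted_epi (x : V) (y : 'I_N -> R) : Prop :=
  forall i (l : 'I_(q i)),
    zeta i l 0 <= inner (row l (Sx i)) (row i x) + y i * Sy i l 0.

Lemma lifted_epi_le x y : lifted_epi x y ->
  dom_sum x /\ val_sum x <= \sum_i y i.
Proof.
move=> E; have ry i : (r i (row i x) <= (y i)%:E)%E.
  by apply/(epi_le (r_epi i)) => l; exact: E.
have Dx : dom_sum x.
  by apply/dom_sumP => i; apply: le_lt_trans (ry i) _; exact: ltry.
split=> //; rewrite val_sumE //; apply: ler_sum => i _.
rewrite -lee_fin -finite_value //; move/dom_sumP: Dx; exact.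
Qed.

Lemma lifted_epi_val x : dom_sum x ->
  lifted_epi x (fun i => fine (r i (row i x))).
Proof.
move=> /dom_sumP Dx i; apply/(epi_le (r_epi i)).
by rewrite -finite_value.
Qed.

Lemma closed_convex_sum : closed_convex_on dom_sum val_sum.
Proof.
have /choice[Z /choice[C hZ]] : forall i, exists Z C, [/\ 0 <= C,
  forall x, (r i x < +oo)%E -> r i x = (Z x)%:E,
  forall x y, Z x <= Z y + C * enorm (x - y),
  forall l, (forall eps, 0 < eps ->
     exists2 u, (r i u < +oo)%E & enorm (u - l) <= eps) -> (r i l < +oo)%E
  & exists a k, forall x, k + inner a x <= Z x].
  by move=> i; exact: polyhedral_lipschitz (r_proper i) (r_epi i).
have valZ x : dom_sum x -> val_sum x = \sum_i Z i (row i x).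
  move=> Dx; rewrite val_sumE //; apply: eq_bigr => i _.
  by have [_ hz _ _ _] := hZ i; rewrite hz //; move/dom_sumP: Dx; exact.
have row_le (u v : V) i : enorm (row i u - row i v) <= enorm (u - v).
  rewrite -linearB /= -(@ler_pXn2r _ 2) ?nnegrE ?enorm_ge0 //.
  rewrite (sqr_enorm_rows (u - v)) (bigD1 i) //= lerDl.
  by apply: sumr_ge0 => j _; rewrite sqr_ge0.
split.
- move=> x y t Dx Dy /andP[t0 t1].
  have Ex := lifted_epi_val Dx; have Ey := lifted_epi_val Dy.
  pose a i := fine (r i (row i x)) +
     t * (fine (r i (row i y)) - fine (r i (row i x))).
  have [|Dw vw] := @lifted_epi_le (x + t *: (y - x)) a.
    move=> i l; have h1 := Ex i l; have h2 := Ey i l.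
    rewrite linearD linearZ linearB /= !(innerDr, innerZr, innerNr) /a.
    have := ler_wpM2l t0 h2; have t10 : 0 <= 1 - t by lra.
    have := ler_wpM2l t10 h1; lra.
  split=> //; apply: le_trans vw _; rewrite !val_sumE // /a big_split /=.
  by rewrite -mulr_sumr sumrB.
- move=> l M h.
  have Dl : dom_sum l.
    apply/dom_sumP => i; have [_ _ _ hcl _] := hZ i; apply: hcl => eps eps0.
    have [u [Du _ ul]] := h eps eps0; exists (row i u).
      by move/dom_sumP: Du; exact.
    by apply: le_trans (row_le u l i) _.
  split=> //; rewrite leNgt; apply/negP => Ml.
  pose CC := \sum_i C i.
  have CC0 : 0 <= CC by apply: sumr_ge0 => i _; have [] := hZ i.
  pose eps := (val_sum l - M) / (CC + 2).
  have eps0 : 0 < eps by rewrite divr_gt0 ?subr_gt0 //; lra.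
  have [u [Du uM ul]] := h eps eps0.
  have : val_sum l <= val_sum u + CC * eps.
    rewrite !valZ // /CC mulr_suml -big_split /=; apply: ler_sum => i _.
    have [Ci0 _ hlip _ _] := hZ i; apply: le_trans (hlip _ (row i u)) _.
    by rewrite lerD2l ler_wpM2l // (le_trans (row_le l u i)) // enormB.
  have : eps * (CC + 2) = val_sum l - M by rewrite /eps divfK //; lra.
  lra.
- have /choice[a /choice[k hak]] : forall i, exists a k,
      forall x, k + inner a x <= Z i x by move=> i; have [] := hZ i.
  exists (\matrix_(i, j) a i 0 j), (\sum_i k i) => x Dx.
  rewrite valZ // [inner _ _]/inner -big_split /=; apply: ler_sum => i _.
  apply: le_trans (hak i (row i x)); rewrite lerD2l /inner big_ord1.
  by apply: ler_sum => j _; rewrite !mxE.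
Qed.

End polyhedral_sum.

Lemma closed_convex_ker (R : realType) (N n p : nat) (A : 'M[R]_(p, N))
    (D : set 'M[R]_(N, n)) rho : closed_convex_on D rho ->
  closed_convex_on (D `&` [set x | A *m x = 0]) rho.
Proof.
move=> [cvx cl mino]; split.
- move=> x y t [Dx /= Ax] [Dy /= Ay] t01.
  have [Dw rw] := cvx x y t Dx Dy t01; split=> //; split=> //=.
  by rewrite mulmxDr -scalemxAr mulmxBr Ax Ay subr0 scaler0 addr0.
- move=> l M h; have [|Dl rl] := cl l M.
    by move=> eps eps0; have [u [[Du _] ru ul]] := h eps eps0; exists u.
  split=> //; split=> //=; apply: enorm_eq0; apply/eqP.
  rewrite eq_le enorm_ge0 andbT leNgt; apply/negP => Al0.
  pose eps := enorm (A *m l) / (enorm A + 1).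
  have d0 : 0 < enorm A + 1 by rewrite ltr_wpDl ?enorm_ge0.
  have [|u [[_ /= Au] _ ul]] := h (eps / 2); first by rewrite !divr_gt0.
  have := enorm_mulmx A (l - u); rewrite mulmxBr Au subr0 enormB => h1.
  have : enorm A * enorm (u - l) <= enorm A * (eps / 2).
    by rewrite ler_wpM2l ?enorm_ge0.
  have : eps * (enorm A + 1) = enorm (A *m l) by rewrite /eps divfK // gt_eqF.
  have : 0 <= enorm A by exact: enorm_ge0.
  have : 0 < eps by rewrite divr_gt0.
  nra.
- by have [a [k hk]] := mino; exists a, k => x [Dx _]; exact: hk.
Qed.

Lemma sum_delta (R : pzRingType) (I : finType) (F : I -> R) i :
  \sum_j (i == j)%:R * F j = F i.
Proof.
rewrite (bigD1 i) //= eqxx mul1r big1 ?addr0 // => j /negPf ji.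
by rewrite eq_sym ji mul0r.
Qed.

(** [th] is a Hoffman constant of the lifted polyhedra intersected with the kernel
    of [A], in the form in which it is used: [xl] and [xb] satisfy the variational
    inequalities of the Lagrangian and of the constrained problem for the same
    strongly monotone field [h]. *)
Definition dual_error_constant (R : realType) (N n p : nat) (A : 'M[R]_(p, N))
    (q : 'I_N -> nat) (Sx : forall i, 'M[R]_(q i, n)) (Sy : forall i, 'cV[R]_(q i))
    (th : R) : Prop :=
  forall (zeta : forall i, 'cV[R]_(q i)) (r : 'I_N -> 'rV[R]_n -> \bar R)
    (h : 'M[R]_(N, n) -> 'M[R]_(N, n)) (a b : R) (xl xb : 'M[R]_(N, n))
    (u v : 'M[R]_(p, n)),
  (forall i, proper_fun (r i)) -> polyhedral_epigraph r Sx Sy zeta ->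
  0 <= a -> 0 < b ->
  enorm (h xl - h xb) <= a * enorm (xl - xb) ->
  b * enorm (xl - xb) ^+ 2 <= inner (h xl - h xb) (xl - xb) ->
  dom_sum r xl -> dom_sum r xb -> A *m xb = 0 ->
  (forall y, dom_sum r y ->
     0 <= inner (h xl + A^T *m u) (y - xl) + (val_sum r y - val_sum r xl)) ->
  (forall y, dom_sum r y -> A *m y = 0 ->
     0 <= inner (h xb + A^T *m v) (y - xb) + (val_sum r y - val_sum r xb)) ->
  enorm (xl - xb) <= a / b * th * enorm (A *m xl).

(** The displacement from [xb] to [xl] in the lifted epigraph violates [A d = 0]
    by [A xl] only, so Hoffman's bound yields a nearby displacement in the kernel
    of [A] that can be added at [xb] and subtracted at [xl] without leaving the
    epigraph.  Testing the optimality of both points along it compares the two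
    values of [h], since the multipliers vanish on the kernel, and strong
    monotonicity concludes.  The right-hand sides [zeta] enter the linear system
    only through the slacks at [xl] and [xb], on which Hoffman's constant does not
    depend. *)
Lemma dual_error_bound (R : realType) (N n p : nat) (A : 'M[R]_(p, N))
    (q : 'I_N -> nat) (Sx : forall i, 'M[R]_(q i, n)) (Sy : forall i, 'cV[R]_(q i)) :
  exists2 th : R, 0 <= th & dual_error_constant A Sx Sy th.
Proof.
pose I : finType := ({i : 'I_N & 'I_(q i)} + 'I_p * 'I_n)%type.
pose V : finType := ('I_N * 'I_n + 'I_N)%type.
(* the boolean chooses between [>=] and [<=]; the variables are the entries of the
   displacement and one height per agent *)
pose coef (k : I * bool) (j : V) : R := (if k.2 then 1 else -1) *
  match k.1, j with
  | inl il, inl ij => (tag il == ij.1)%:R * Sx (tag il) (tagged il) ij.2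
  | inl il, inr i => (tag il == i)%:R * Sy (tag il) (tagged il) 0
  | inr lj, inl ij => A lj.1 ij.1 * (lj.2 == ij.2)%:R
  | inr _, inr _ => 0
  end.
have [th th0 hoff] := hoffman coef.
exists ((N * n)%:R * th); first by rewrite mulr_ge0.
move=> zeta r h a b xl xb u v r_proper r_epi a0 b0 hlip hmono Dl Db Axb lvar bvar.
pose pt (x : 'M[R]_(N, n)) (y : 'I_N -> R) (j : V) :=
  match j with inl ij => x ij.1 ij.2 | inr i => y i end.
have coefE k x y : \sum_j coef k j * pt x y j = (if k.2 then 1 else -1) *
  match k.1 with
  | inl il => inner (row (tagged il) (Sx (tag il))) (row (tag il) x)
              + y (tag il) * Sy (tag il) (tagged il) 0
  | inr lj => (A *m x) lj.1 lj.2
  end.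
  case: k => k s; under eq_bigr do rewrite /coef -mulrA.
  rewrite -mulr_sumr; congr (_ * _); rewrite big_sumType /=.
  case: k => [[i l]|[l j]] /=.
    congr (_ + _); last first.
      rewrite mulrC -(sum_delta (fun i' => Sy i l 0 * y i')).
      by apply: eq_bigr => i' _; rewrite mulrA.
    rewrite -(pair_bigA _ (fun i' j => (i == i')%:R * Sx i l j * x i' j)) /=.
    rewrite -[RHS](sum_delta (fun i' => inner (row l (Sx i)) (row i' x)) i).
    apply: eq_bigr => i' _; rewrite /inner big_ord1 mulr_sumr.
    by apply: eq_bigr => j _; rewrite !mxE mulrA.
  rewrite [X in _ + X]big1 ?addr0; last by move=> i _; rewrite mul0r.
  rewrite -(pair_bigA _ (fun i' j' => A l i' * (j == j')%:R * x i' j')) /= mxE.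
  apply: eq_bigr => i _; rewrite -(sum_delta (fun j' => A l i * x i j')).
  by apply: eq_bigr => j' _; rewrite mulrAC mulrC.
pose yl i := fine (r i (row i xl)); pose yb i := fine (r i (row i xb)).
have El := lifted_epi_val r_proper r_epi Dl : lifted_epi _ _ _ xl yl.
have Eb := lifted_epi_val r_proper r_epi Db : lifted_epi _ _ _ xb yb.
(* the slacks at [xl] and [xb]; they are nonnegative, so the system is consistent *)
pose bnd (k : I * bool) : R := match k.1 with
  | inl il => if k.2
      then inner (row (tagged il) (Sx (tag il))) (row (tag il) xl)
              + yl (tag il) * Sy (tag il) (tagged il) 0 - zeta (tag il) (tagged il) 0
      else inner (row (tagged il) (Sx (tag il))) (row (tag il) xb)
              + yb (tag il) * Sy (tag il) (tagged il) 0 - zeta (tag il) (tagged il) 0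
  | inr _ => 0 end.
have nA0 : 0 <= enorm (A *m xl) by exact: enorm_ge0.
have bnd0 k : 0 <= bnd k.
  case: k => [[[i l]|[l j]] s] //=; rewrite /bnd /=.
  by case: s; rewrite subr_ge0; [exact: El|exact: Eb].
have viol k : \sum_j coef k j * pt (xl - xb) (fun i => yl i - yb i) j <=
    bnd k + enorm (A *m xl).
  rewrite coefE; case: k => [[[i l]|[l j]] s] /=; rewrite /bnd /=.
    rewrite linearB innerDr innerNr /=.
    have := El i l; have := Eb i l; case: s; lra.
  have := entry_le_enorm (A *m xl) l j; rewrite ler_norml => /andP[h1 h2].
  rewrite mulmxBr Axb subr0 add0r; case: s; lra.
have [D Dle Dnear] := hoff bnd _ _ bnd0 nA0 viol.
pose dx : 'M[R]_(N, n) := \matrix_(i, j) D (inl (i, j)).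
pose dy i := D (inr i).
have DE j : D j = pt dx dy j by case: j => [[i j]|i] //=; rewrite mxE.
have Dc k : \sum_j coef k j * pt dx dy j <= bnd k.
  by apply: le_trans (Dle k); rewrite le_eqVlt; apply/orP; left; apply/eqP;
     apply: eq_bigr => j _; rewrite DE.
have Adx : A *m dx = 0.
  apply/matrixP => l j; rewrite [RHS]mxE; apply/eqP; rewrite eq_le.
  have := Dc (inr (l, j), true); have := Dc (inr (l, j), false).
  rewrite !coefE /bnd /= => h1 h2; apply/andP; split; lra.
have [|Db' vb'] := lifted_epi_le r_proper r_epi (x := xb + dx) (y := fun i => yb i + dy i).
  move=> i l; have := Dc (inl (Tagged (fun i => 'I_(q i)) l), false).
  rewrite coefE /bnd /= linearD innerDr /=; lra.
have [|Dl' vl'] := lifted_epi_le r_proper r_epi (x := xl - dx) (y := fun i => yl i - dy i).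
  move=> i l; have := Dc (inl (Tagged (fun i => 'I_(q i)) l), true).
  rewrite coefE /bnd /= linearB innerDr innerNr /=; lra.
have hb := bvar _ Db'; rewrite mulmxDr Axb Adx addr0 in hb.
have {hb} := hb erefl; rewrite addrAC subrr add0r.
have := lvar _ Dl'; rewrite addrAC subrr add0r innerNr.
rewrite !innerDl -!inner_trmx Adx !inner0r.
move: vb' vl'; rewrite big_split /= sumrB.
rewrite (val_sumE r_proper Dl) (val_sumE r_proper Db) -/yl -/yb.
rewrite -!/(yl _) -!/(yb _) => vb' vl' h1 h2.
have hd : 0 <= inner (h xb - h xl) dx by rewrite innerBl; lra.
have near : enorm (xl - xb - dx) <= (N * n)%:R * (th * enorm (A *m xl)).
  apply: enorm_le_entries; first by rewrite mulr_ge0.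
  move=> i j; have := Dnear (inl (i, j)); rewrite !mxE /= distrC.
  by rewrite !mxE.
have key : b * enorm (xl - xb) ^+ 2 <=
    a * enorm (xl - xb) * ((N * n)%:R * (th * enorm (A *m xl))).
  apply: le_trans hmono _.
  apply: le_trans (_ : inner (h xl - h xb) (xl - xb - dx) <= _).
    by rewrite [leRHS]innerBr -(opprB (h xb)) !innerNl opprK lerDl.
  apply: le_trans (inner_le_enorm _ _) _.
  by apply: ler_pM; rewrite ?enorm_ge0.
have [d0|d0] := eqVneq (enorm (xl - xb)) 0.
  by rewrite d0 !mulr_ge0 // invr_ge0 ltW.
have dp : 0 < enorm (xl - xb) by rewrite lt_def d0 enorm_ge0.
rewrite -(ler_pM2r dp) -(ler_pM2l b0) -expr2.
apply: le_trans key _; rewrite le_eqVlt; apply/orP; left; apply/eqP.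
by field; rewrite gt_eqF.
Qed.

(** * The algorithm's minimization problems *)

(** Each edge contributes [2 (|x_i|^2 + |x_j|^2)], and every vertex is on an
    edge. *)
Lemma incidence_coercive (R : realType) (N n : nat) (e : rel 'I_N)
    (x : 'M[R]_(N, n)) :
  connected_graph e -> (forall i, (1 <= degree e i)%N) ->
  2 * enorm x ^+ 2 <= enorm (incidence e R *m x) ^+ 2
                      + enorm (abs_incidence e R *m x) ^+ 2.
Proof.
move=> [_ esym eirr _] deg.
have sub_delta (j : 'I_N) (k : 'I_n) : \sum_i (i == j)%:R * x i k = x j k.
  by rewrite -[RHS](sum_delta (fun i => x i k)); under eq_bigr do rewrite eq_sym.
have Ax l k : (incidence e R *m x) l k = x (enum_val l).1 k - x (enum_val l).2 k.
  rewrite mxE -!sub_delta -sumrB; apply: eq_bigr => i _.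
  by rewrite mxE mulrBl.
have Bx l k : (abs_incidence e R *m x) l k = x (enum_val l).1 k + x (enum_val l).2 k.
  rewrite mxE -!sub_delta -big_split; apply: eq_bigr => i _ /=.
  rewrite !mxE -mulrDl; congr (_ * _).
  have := enum_valP l; rewrite inE => /andP[_ lt12].
  have [->|_] := eqVneq i (enum_val l).1; last by rewrite sub0r normrN normr_nat add0r.
  have [e12|_] := eqVneq (enum_val l).1 (enum_val l).2.
    by rewrite -e12 ltnn in lt12.
  by rewrite subr0 addr0 normr1.
pose F k i := x i k ^+ 2.
have -> : enorm (incidence e R *m x) ^+ 2 + enorm (abs_incidence e R *m x) ^+ 2 =
    2 * \sum_(k < n) \sum_(l < #|edges e|) (F k (enum_val l).1 + F k (enum_val l).2).
  rewrite [\sum_(k < n) _]exchange_big /= !sqr_enorm /inner -big_split /=.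
  rewrite mulr_sumr; apply: eq_bigr => l _; rewrite -big_split mulr_sumr /=.
  by apply: eq_bigr => k _; rewrite Ax Bx /F; ring.
rewrite ler_wpM2l // sqr_enorm /inner exchange_big /=; apply: ler_sum => k _.
have nbr i : exists j, e i j.
  have /card_gt0P[j] := deg i; rewrite inE => eij.
  by exists j.
pose inc (i : 'I_N) (l : 'I_#|edges e|) := (i == (enum_val l).1) || (i == (enum_val l).2).
have incP i : exists l, inc i l.
  have [j eij] := nbr i.
  have [lt|lt|eq_ij] := ltngtP i j; last 1 first.
  - by move: eij; rewrite (val_inj eq_ij) eirr.
  - have h : (i, j) \in edges e by rewrite inE eij lt.
    by exists (enum_rank_in h (i, j)); rewrite /inc enum_rankK_in // eqxx.
  - have h : (j, i) \in edges e by rewrite inE esym eij lt.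
    by exists (enum_rank_in h (j, i)); rewrite /inc enum_rankK_in // eqxx orbT.
apply: le_trans (_ : \sum_i \sum_(l < #|edges e|) (inc i l)%:R * F k i <= _).
  apply: ler_sum => i _; rewrite -expr2 -/(F k i) -mulr_suml ler_peMl ?sqr_ge0 //.
  have [l il] := incP i; rewrite (bigD1 l) //= il lerDl.
  by apply: sumr_ge0 => ? _; rewrite ler0n.
rewrite exchange_big; apply: ler_sum => l _ /=.
apply: le_trans (_ : \sum_i ((i == (enum_val l).1)%:R * F k i
                       + (i == (enum_val l).2)%:R * F k i) <= _).
  apply: ler_sum => i _; rewrite -mulrDl ler_wpM2r ?sqr_ge0 //.
  by rewrite /inc; case: (_ == _); case: (_ == _); rewrite /= ?addr0 ?add0r // lerDl.
have dF j : \sum_i (i == j)%:R * F k i = F k j.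
  by rewrite -[RHS](sum_delta (F k)); under eq_bigr do rewrite eq_sym.
by rewrite big_split /= !dF.
Qed.

Section composite_minimization.
Variables (R : realType) (N n : nat) (r : 'I_N -> 'rV[R]_n -> \bar R).
Variables (q : 'I_N -> nat).
Variables (Sx : forall i, 'M[R]_(q i, n)) (Sy zeta : forall i, 'cV[R]_(q i)).
Hypothesis r_proper : forall i, proper_fun (r i).
Hypothesis r_epi : polyhedral_epigraph r Sx Sy zeta.
Local Notation V := 'M[R]_(N, n).
Local Notation D := (dom_sum r).
Local Notation rho := (val_sum r).
Hypothesis D_ex : exists x0 : V, D x0.

Lemma ereal_inf_attained (S : set (\bar R)) a : S a -> (forall b, S b -> (a <= b)%E) ->
  ereal_inf S = a.
Proof.
move=> Sa lb; apply/eqP; rewrite eq_le; apply/andP; split.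
  exact: ereal_inf_lbound.
exact: le_ereal_inf_tmp.
Qed.

Lemma argmin_sumP (h : V -> R) x :
  argmin (fun y => ((h y)%:E + rsum r y)%E) x <->
  minimizes D (fun y => h y + rho y) x.
Proof.
split=> [xmin|[Dx xmin] y].
  have Dx : D x.
    have [x0 Dx0] := D_ex; have := xmin x0; rewrite (rsumE r_proper Dx0) -EFinD => hx.
    rewrite /dom_sum /= -(@lteD2lE _ (h x)%:E) //.
    by apply: le_lt_trans hx _; rewrite addey ?ltry.
  split=> // y Dy; rewrite -lee_fin !EFinD -!(rsumE r_proper) //; exact: xmin.
have [Dy|Dy] := pselect (D y).
  by rewrite !(rsumE r_proper) // -!EFinD lee_fin; exact: xmin.
have -> : rsum r y = +oo%E.
  by apply/eqP; rewrite -leye_eq leNgt; apply/negP.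
by rewrite addey ?leey.
Qed.

(** ** Proximal map of the regularizer *)

Lemma prox_var v : D (prox (rsum r) v) /\ forall y, D y ->
  0 <= inner (prox (rsum r) v - v) (y - prox (rsum r) v)
       + (rho y - rho (prox (rsum r) v)).
Proof.
have cc := closed_convex_sum r_proper r_epi.
pose h u := 2^-1 * enorm (v - u) ^+ 2.
have hdiff x y : h y = h x + inner (x - v) (y - x) + 1 / 2 * enorm (y - x) ^+ 2.
  rewrite /h (_ : v - y = (v - x) - (y - x)); last by rewrite opprB addrA subrK.
  by rewrite sqr_enormB -(opprB v x) innerNl; lra.
have [|||x0 x0min] := @minimizer_exists _ _ _ D rho h (fun x => x - v) 1 cc.
- exact: D_ex.
- by [].
- by move=> x y; rewrite -hdiff.
have pmin : minimizes D (fun y => h y + rho y) (prox (rsum r) v).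
  apply/argmin_sumP; rewrite /prox; case: xgetP => [u -> //|/(_ x0)].
  by move=> /(_ _)/= hn; exfalso; apply: hn; apply/argmin_sumP.
split; first by case: pmin.
by apply: (minimizer_variational (k := 1) cc _ pmin) => y; rewrite -hdiff.
Qed.

Lemma prox_lip v v' : enorm (prox (rsum r) v - prox (rsum r) v') <= enorm (v - v').
Proof.
have [Dv hv] := prox_var v; have [Dv' hv'] := prox_var v'.
rewrite -[leLHS]mul1r -(enormN (v - v')).
have h2 := hv' _ Dv; rewrite -(opprB (rho (prox (rsum r) v'))) in h2.
apply: (variational_distance (hv _ Dv') h2).
rewrite mul1r sqr_enorm le_eqVlt; apply/orP; left; apply/eqP; congr inner.
by apply/matrixP => i j; rewrite !mxE; ring.
Qed.

(** ** The subproblem of one iteration *)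

Section subproblem_solution.
Variables (e : rel 'I_N) (f : 'I_N -> 'rV[R]_n -> R) (c kappa gamma : R).
Hypotheses (c_gt0 : 0 < c) (kappa_gt0 : 0 < kappa) (gamma_gt0 : 0 < gamma).
Local Notation A := (incidence e R).
Local Notation B := (abs_incidence e R).

Implicit Types (g s xk zk x : V) (lam : 'M[R]_(#|edges e|, n)).

Definition sub_smooth (g s xk zk : V) (lam : 'M[R]_(#|edges e|, n)) (x : V) : R :=
  fsum f s + inner g (x - s) + gamma / 2 * enorm (x - s) ^+ 2
    + inner lam (A *m x) + c / 2 * enorm (A *m x) ^+ 2
    + c / 2 * enorm (B *m (x - xk)) ^+ 2 + kappa / 2 * enorm (x - zk) ^+ 2.

Definition sub_grad (g s xk zk : V) (lam : 'M[R]_(#|edges e|, n)) (x : V) : V :=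
  g + gamma *: (x - s) + A^T *m lam + c *: (A^T *m (A *m x))
    + c *: (B^T *m (B *m (x - xk))) + kappa *: (x - zk).

Lemma sub_smooth_diff g s xk zk lam x y :
  sub_smooth g s xk zk lam y = sub_smooth g s xk zk lam x
    + inner (sub_grad g s xk zk lam x) (y - x)
    + (gamma + kappa) / 2 * enorm (y - x) ^+ 2
    + c / 2 * enorm (A *m (y - x)) ^+ 2 + c / 2 * enorm (B *m (y - x)) ^+ 2.
Proof.
have -> : y = x + (y - x) by rewrite addrC subrK.
set d := y - x; rewrite (_ : x + d - x = d); last by rewrite addrAC subrr add0r.
rewrite /sub_smooth /sub_grad !(addrAC x d).
have [us eus] : exists u, u = x - s by exists (x - s).
have [uz euz] : exists u, u = x - zk by exists (x - zk).
have [uB euB] : exists u, u = x - xk by exists (x - xk).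
rewrite -eus -euz -euB !mulmxDr !sqr_enormD.
rewrite !(innerDl, innerDr, innerZl) -!inner_trmx; lra.
Qed.

Lemma subproblem_exists g s xk zk lam :
  exists x, argmin (subproblem f r c kappa gamma g s xk zk lam) x.
Proof.
have cc := closed_convex_sum r_proper r_epi.
have [|||x xmin] := @minimizer_exists _ _ _ D rho
  (sub_smooth g s xk zk lam) (sub_grad g s xk zk lam) (gamma + kappa) cc.
- exact: D_ex.
- exact: addr_gt0.
- move=> x y; rewrite (sub_smooth_diff g s xk zk lam x y).
  rewrite -[leRHS]addrA lerDl addr_ge0 // mulr_ge0 ?sqr_ge0 ?divr_ge0 ?(ltW c_gt0) //.
by exists x; apply/argmin_sumP.
Qed.

Lemma subproblem_var g s xk zk lam x :
  argmin (subproblem f r c kappa gamma g s xk zk lam) x ->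
  D x /\ forall y, D y ->
    0 <= inner (sub_grad g s xk zk lam x) (y - x) + (rho y - rho x).
Proof.
move=> /argmin_sumP xmin; split; first by case: xmin.
apply: (minimizer_variational (closed_convex_sum r_proper r_epi)
  (k := gamma + kappa + c * enorm A ^+ 2 + c * enorm B ^+ 2)) xmin => y.
have hM (M : 'M[R]_(#|edges e|, N)) :
    c / 2 * enorm (M *m (y - x)) ^+ 2 <= c / 2 * (enorm M ^+ 2 * enorm (y - x) ^+ 2).
  rewrite ler_wpM2l ?divr_ge0 ?(ltW c_gt0) // -exprMn.
  by rewrite ler_pXn2r ?nnegrE ?mulr_ge0 ?enorm_ge0 // enorm_mulmx.
rewrite -/(sub_smooth g s xk zk lam y) -/(sub_smooth g s xk zk lam x).
have := sub_smooth_diff g s xk zk lam x y; have := hM A; have := hM B; lra.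
Qed.

(** The subproblem minimizes a fixed strongly convex function minus the linear
    function given by this vector, up to a constant. *)
Definition sub_data (g s xk zk : V) (lam : 'M[R]_(#|edges e|, n)) : V :=
  gamma *: s - g - A^T *m lam + c *: (B^T *m (B *m xk)) + kappa *: zk.

Lemma subproblem_lip g s xk zk lam x g' s' xk' zk' lam' x' :
  argmin (subproblem f r c kappa gamma g s xk zk lam) x ->
  argmin (subproblem f r c kappa gamma g' s' xk' zk' lam') x' ->
  (gamma + kappa) * enorm (x - x') <=
  enorm (sub_data g s xk zk lam - sub_data g' s' xk' zk' lam').
Proof.
move=> /subproblem_var[Dx hx] /subproblem_var[Dx' hx'].
have h2 := hx' _ Dx; rewrite -(opprB (rho x')) in h2.
rewrite -(enormN (_ - sub_data _ _ _ _ _)).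
apply: (variational_distance (hx _ Dx') h2).
have -> : sub_grad g s xk zk lam x - sub_grad g' s' xk' zk' lam' x'
    - - (sub_data g s xk zk lam - sub_data g' s' xk' zk' lam')
  = (gamma + kappa) *: (x - x') + c *: (A^T *m (A *m (x - x')))
    + c *: (B^T *m (B *m (x - x'))).
  rewrite /sub_grad /sub_data !mulmxBr.
  move: (A^T *m (A *m x)) (A^T *m (A *m x')) (A^T *m lam) (A^T *m lam').
  move: (B^T *m (B *m x)) (B^T *m (B *m x')).
  move: (B^T *m (B *m xk)) (B^T *m (B *m xk')) => b1 b2 b3 b4 a1 a2 a3 a4.
  apply/matrixP => i j; rewrite !mxE.
  by ring.
rewrite !innerDl !innerZl -!inner_trmx -!sqr_enorm -addrA lerDl.
by rewrite addr_ge0 // mulr_ge0 ?sqr_ge0 // ltW.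
Qed.

End subproblem_solution.
End composite_minimization.

(** * The pathwise bound *)

(** The bound on the extrapolation is the one that leaves a positive part of
    [tau] after paying for the extrapolation term of the primal descent. *)
Lemma eta_bar_margin (R : realType) (L mu c kappa gamma eta : R) :
  0 < L -> 0 < c -> 0 < kappa -> 3 * L < gamma -> mu <= L ->
  0 <= eta <= eta_bar L mu c kappa gamma ->
  (kappa + 2 * c + gamma - 3 * L) / 4 * (3 * L / (gamma - mu + 3 * L))
    + (gamma - mu) / 2 * eta ^+ 2 <= (kappa + 2 * c + gamma - 3 * L) / 4.
Proof.
move=> L0 c0 k0 g0 muL /andP[eta0 etab].
set M := kappa + 2 * c + gamma - 3 * L; have M0 : 0 < M by rewrite /M; lra.
have Q0 : 0 < gamma - mu + 3 * L by lra.
have eta2 : eta ^+ 2 <= M / (2 * (gamma - mu + 3 * L)).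
  rewrite -[leRHS]sqr_sqrtr; last by rewrite divr_ge0 ?(ltW M0) // mulr_ge0 ?(ltW Q0).
  by rewrite ler_pXn2r ?nnegrE // sqrtr_ge0.
have : (gamma - mu) / 2 * eta ^+ 2 <=
       (gamma - mu) / 2 * (M / (2 * (gamma - mu + 3 * L))).
  by rewrite ler_wpM2l //; lra.
have -> : (gamma - mu) / 2 * (M / (2 * (gamma - mu + 3 * L))) =
    M / 4 - M / 4 * (3 * L / (gamma - mu + 3 * L)) by field; rewrite gt_eqF.
lra.
Qed.

Section pathwise.
Variables (R : realType) (N n : nat) (e : rel 'I_N).
Variables (L mu c kappa gamma : R).
Hypotheses (graph_e : connected_graph e) (deg : forall i, (1 <= degree e i)%N).
Hypotheses (L_gt0 : 0 < L) (mu_ge : - L <= mu) (c_gt0 : 0 < c).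
Hypotheses (kappa_gt0 : 0 < kappa) (kappa_gt : - mu < kappa).
Hypotheses (gamma_gt : 3 * L < gamma).
Variables (q : 'I_N -> nat).
Variables (Sx : forall i, 'M[R]_(q i, n)) (Sy zeta : forall i, 'cV[R]_(q i)).
Variables (f : 'I_N -> 'rV[R]_n -> R) (r : 'I_N -> 'rV[R]_n -> \bar R).
Variable (f_low : R).
Hypothesis n_gt0 : (0 < n)%N.
Hypothesis r_proper : forall i, proper_fun (r i).
Hypothesis r_epi : polyhedral_epigraph r Sx Sy zeta.
Hypothesis feas : feasible e r.
Hypothesis f_smooth : smooth_weakly_convex f L mu.
Hypothesis f_bounded : bounded_below e f r f_low.

Local Notation V := 'M[R]_(N, n).
Local Notation dvec := 'M[R]_(#|edges e|, n).
Local Notation A := (incidence e R).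
Local Notation B := (abs_incidence e R).
Local Notation D := (dom_sum r).
Local Notation rho := (val_sum r).
Local Notation gf := (grad (fsum f)).
Local Notation lagr := (lag A (fsum f) c kappa).

Let D_ex : exists x0 : V, D x0.
Proof. by have [x0 [_ Dx0]] := feas; exists x0. Qed.

Let gf_lip (x y : V) : enorm (gf x - gf y) <= L * enorm (x - y).
Proof. by have [_ _ h _] := f_smooth. Qed.

Let f_quad (x y : V) : mu / 2 * enorm (x - y) ^+ 2 <=
  fsum f x - fsum f y - inner (gf y) (x - y).
Proof. by have [_ _ _ h] := f_smooth. Qed.

Let mu_kappa_gt0 : 0 < mu + kappa.
Proof. by rewrite addrC -(opprK mu) subr_gt0. Qed.

Let cc := closed_convex_sum r_proper r_epi.

Lemma curvature_le : mu <= L.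
Proof.
have [N0 _ _ _] := graph_e.
pose x : V := delta_mx (Ordinal N0) (Ordinal n_gt0).
have x0 : 0 < enorm x.
  apply: lt_le_trans (entry_le_enorm x (Ordinal N0) (Ordinal n_gt0)).
  by rewrite mxE !eqxx normr1.
have := f_quad x 0; have := f_quad 0 x; rewrite (enormB 0 x) sub0r innerNr !subr0.
have := inner_le_enorm (gf x - gf 0) x; rewrite innerBl.
have : enorm (gf x - gf 0) * enorm x <= L * enorm x * enorm x.
  by rewrite ler_wpM2r ?enorm_ge0 // -{2}(subr0 x) gf_lip.
rewrite -mulrA -expr2 => h1 h2 h3 h4.
have : mu * enorm x ^+ 2 <= L * enorm x ^+ 2 by lra.
by rewrite ler_pM2r // exprn_gt0.
Qed.

Lemma lag_minimizer_exists (lam : dvec) (z : V) :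
  exists x, minimizes D (fun y => lagr lam z y + rho y) x.
Proof.
apply: (minimizer_exists (k := mu + kappa) (g := grad_lag A gf c kappa lam z) cc) => //.
by move=> x y; exact: lag_lower.
Qed.

Lemma constrained_minimizer_exists (z : V) : exists x,
  minimizes (D `&` [set y | A *m y = 0]) (fun y => lagr 0 z y + rho y) x.
Proof.
apply: (minimizer_exists (k := mu + kappa) (g := grad_lag A gf c kappa 0 z)
  (closed_convex_ker A cc)) => //.
  by have [x0 [Ax0 Dx0]] := feas; exists x0.
by move=> x y; exact: lag_lower.
Qed.

Lemma dual_valueE lam z x : minimizes D (fun y => lagr lam z y + rho y) x ->
  dual_value f r c kappa z lam = (lagr lam z x + rho x)%:E.
Proof.
move=> xmin; have /argmin_sumP xarg := xmin.
have -> : (lagr lam z x + rho x)%:E = Lagr f r c kappa x z lam.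
  by rewrite /Lagr (rsumE r_proper) //; case: xmin.
apply: ereal_inf_attained; first by exists x.
by move=> _ [y _ <-]; exact: (xarg r_proper D_ex).
Qed.

Lemma prox_valueE z x :
  minimizes (D `&` [set y | A *m y = 0]) (fun y => lagr 0 z y + rho y) x ->
  prox_value e f r kappa z = (lagr 0 z x + rho x)%:E.
Proof.
move=> [[Dx /= Ax] xmin].
have lagE y : A *m y = 0 -> lagr 0 z y = fsum f y + kappa / 2 * enorm (y - z) ^+ 2.
  by move=> Ay; rewrite /lag Ay inner0r enorm0; ring.
apply: ereal_inf_attained.
  by exists x => //; rewrite (rsumE r_proper) // lagE.
move=> _ [y /= Ay <-].
have [Dy|Dy] := pselect (D y).
  by rewrite (rsumE r_proper) // -lagE // -EFinD lee_fin; exact: xmin.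
have -> : rsum r y = +oo%E by apply/eqP; rewrite -leye_eq leNgt; apply/negP.
by rewrite addey ?leey.
Qed.

Lemma minimizers_close (th : R) (lam : dvec) (z xl xb : V) :
  dual_error_constant A Sx Sy th ->
  minimizes D (fun y => lagr lam z y + rho y) xl ->
  minimizes (D `&` [set y | A *m y = 0]) (fun y => lagr 0 z y + rho y) xb ->
  enorm (xl - xb) <= (L + kappa) / (mu + kappa) * th * enorm (A *m xl).
Proof.
move=> th_bound lmin bmin; have [[Db /= Ab] _] := bmin.
have lvar := lag_minimizer_var mu_ge c_gt0 gf_lip f_quad cc lmin.
have bvar := lag_minimizer_var mu_ge c_gt0 gf_lip f_quad (closed_convex_ker A cc) bmin.
pose h x := gf x + kappa *: (x - z).
have hE lam' x : grad_lag A gf c kappa lam' z x = h x + A^T *m (lam' + c *: (A *m x)).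
  rewrite /grad_lag /h mulmxDr -scalemxAr [RHS]addrA [LHS]addrAC.
  by congr (_ + _); rewrite addrAC.
have hB x y : h x - h y = (gf x - gf y) + kappa *: (x - y).
  by apply/matrixP => i j; rewrite /h !mxE; ring.
apply: (th_bound zeta r h _ _ _ _ (lam + c *: (A *m xl)) (0 + c *: (A *m xb))) => //.
- by rewrite addr_ge0 ?ltW.
- rewrite hB mulrDl; apply: enormD_le => //.
  by rewrite enormZ gtr0_norm.
- rewrite hB innerDl innerZl -sqr_enorm mulrDl lerD2r.
  have := f_quad xl xb; have := f_quad xb xl.
  rewrite (enormB xb) -(opprB xl xb) innerNr innerBl; lra.
- by case: lmin.
- by move=> y Dy; rewrite -hE; exact: lvar.
- by move=> y Dy Ay; rewrite -hE; apply: bvar; split.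
Qed.

End pathwise.

(** The potential decreases along every sample path up to the squared error of
    the gradient estimate; nothing here is random.  The order of the quantifiers
    is the one in which the constants may depend on the data. *)
Lemma pathwise_gap_bound (R : realType) (N : nat) (e : rel 'I_N)
    (L mu c kappa gamma : R) :
  connected_graph e -> (forall i : 'I_N, (1 <= degree e i)%N) ->
  0 < L -> - L <= mu -> 0 < c -> 0 < kappa -> - mu < kappa -> 3 * L < gamma ->
  exists tau alpha_bar : R,
    [/\ 0 < tau, 0 < alpha_bar, alpha_bar <= c &
  forall alpha : R, 0 < alpha -> alpha <= alpha_bar ->
  forall (n : nat) (q : 'I_N -> nat)
    (Sx : forall i, 'M[R]_(q i, n)) (Sy : forall i, 'cV[R]_(q i)),
  (0 < n)%N ->
  exists beta_bar : R, [/\ 0 < beta_bar, beta_bar <= 1 &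
  forall beta : R, 0 < beta -> beta < beta_bar ->
  exists C0 C1 : R, [/\ 0 < C0, 0 < C1 &
  forall (f : 'I_N -> 'rV[R]_n -> R) (r : 'I_N -> 'rV[R]_n -> \bar R)
    (zeta : forall i, 'cV[R]_(q i)) (f_low : R) (eta : nat -> R)
    (x0 : 'M[R]_(N, n)),
  (forall i, proper_fun (r i)) -> feasible e r -> smooth_weakly_convex f L mu ->
  bounded_below e f r f_low -> polyhedral_epigraph r Sx Sy zeta ->
  (forall k, 0 <= eta k <= eta_bar L mu c kappa gamma) -> (rsum r x0 < +oo)%E ->
  exists ph : R, [/\ f_low <= ph,
    potential f r c kappa tau x0 x0 x0 (- (alpha *: (incidence e R *m x0))) = ph%:E &
    forall (g x z : nat -> 'M[R]_(N, n)) (lam : nat -> 'M[R]_(#|edges e|, n)),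
    let s k := x k + eta k *: (x k - x k.-1) in
    x 0%N = x0 -> z 0%N = x0 -> lam 0%N = - (alpha *: (incidence e R *m x0)) ->
    (forall k, lam k.+1 = lam k + alpha *: (incidence e R *m x k)) ->
    (forall k, argmin (subproblem f r c kappa gamma (g k) (s k) (x k) (z k) (lam k.+1))
       (x k.+1)) ->
    (forall k, z k.+1 = z k + beta *: (x k.+1 - z k)) ->
    forall K, \sum_(k < K) gap f r (x k) (lam k.+1) <=
      C0 * ((ph - f_low)
         + C1 * \sum_(k < K) enorm (g k - grad (fsum f) (s k)) ^+ 2)]]]].
Proof.
move=> graph_e deg L0 mu_ge c0 k0 k_gt g_gt.
pose A := incidence e R; pose B := abs_incidence e R.
pose M := kappa + 2 * c + gamma - 3 * L; have M0 : 0 < M by rewrite /M; lra.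
(* the primal descent gains [M / 2 + 3 * L / 2] and the extrapolation allowed by
   [eta_bar] loses less than [M / 4]: this [tau] leaves a margin on both sides *)
pose tau := M / 4; have tau0 : 0 < tau by rewrite divr_gt0.
(* capping at [L] keeps [d2] positive even if [mu > L] *)
pose mu' := Num.min mu L.
have mu'L : mu' <= L by rewrite ge_min lexx orbT.
pose d1 := (gamma + kappa + 2 * c) / 2 - tau.
have d10 : 0 < d1 by rewrite /d1 /tau /M; lra.
pose d2 := tau * (3 * L / (gamma - mu' + 3 * L)).
have q0 : 0 < gamma - mu' + 3 * L by lra.
have d20 : 0 < d2 by rewrite mulr_gt0 // divr_gt0 // mulr_gt0.
pose etab := eta_bar L mu c kappa gamma.
pose Ca := 3 * (enorm A * primal_const B L mu c kappa gamma etab) ^+ 2.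
have Ca0 : 0 <= Ca by rewrite mulr_ge0 ?sqr_ge0.
have Ca1 : 0 < Ca + 1 by lra.
(* here and in [beta_bar] below, [+ 1] keeps the denominators positive *)
pose alpha_bar := Num.min c
  (Num.min (d1 / 4) (Num.min (d2 / 2) 1) / (Ca + 1)).
have mk0 : 0 < mu + kappa by lra.
exists tau, alpha_bar; split => //.
- by rewrite lt_min c0 divr_gt0 // !lt_min ltr01 !divr_gt0.
- by rewrite ge_min lexx.
move=> alpha alpha0 alpha_le n q Sx Sy n0.
have alphaCa t : Num.min (d1 / 4) (Num.min (d2 / 2) 1) <= t -> alpha * Ca <= t.
  move=> ht; apply: le_trans ht.
  have : alpha <= Num.min (d1 / 4) (Num.min (d2 / 2) 1) / (Ca + 1).
    by apply: le_trans alpha_le _; rewrite ge_min lexx orbT.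
  rewrite ler_pdivlMr //; lra.
have [th th0 thP] := @dual_error_bound R N n _ A q Sx Sy.
pose theta := (L + kappa) / (mu + kappa) * th.
have th2 : 0 < theta ^+ 2 + 1 by rewrite ltr_wpDl ?sqr_ge0.
pose beta_bar := Num.min 1 (Num.min ((mu + kappa) / (16 * kappa))
                               (alpha / (16 * kappa * (theta ^+ 2 + 1)))).
exists beta_bar; split.
- by rewrite !lt_min ltr01 !divr_gt0 ?mulr_gt0.
- by rewrite ge_min lexx.
move=> beta beta0 beta_lt.
have beta1 : beta <= 1 by rewrite (le_trans (ltW beta_lt)) // ge_min lexx.
have beta_center : 16 * beta * kappa <= mu + kappa.
  have : beta <= (mu + kappa) / (16 * kappa).
    by rewrite (le_trans (ltW beta_lt)) // !ge_min lexx !orbT.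
  by rewrite ler_pdivlMr ?mulr_gt0 //; lra.
have beta_theta : 16 * kappa * beta * theta ^+ 2 <= alpha.
  have : beta <= alpha / (16 * kappa * (theta ^+ 2 + 1)).
    by rewrite (le_trans (ltW beta_lt)) // !ge_min lexx !orbT.
  rewrite ler_pdivlMr ?mulr_gt0 //.
  have : 0 < kappa * beta by rewrite mulr_gt0.
  lra.
pose m0 := Num.min (Num.min (d1 / 2) (d2 / 2)) (Num.min (alpha / 2) (kappa * beta / 4)).
have m00 : 0 < m0 by rewrite !lt_min !divr_gt0 // mulr_gt0.
pose Gc := gap_const A B L mu c kappa gamma etab.
have Gc0 : 0 <= Gc by rewrite /Gc /gap_const mulr_ge0 ?sqr_ge0.
pose C1 := m0 + d1^-1 + 1.
have C10 : 0 < C1 by rewrite !addr_gt0 // invr_gt0.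
exists ((Gc + 1) / m0), C1; split => //; first by rewrite divr_gt0 // ltr_wpDl.
move=> f r zeta f_low eta x0 r_proper feas f_smooth f_bdd r_epi eta_bd Dx0.
have [_ _ gf_lip f_quad] := f_smooth.
have muL := curvature_le graph_e n0 f_smooth.
have mu'E : mu' = mu by rewrite /mu' min_l.
have cc := closed_convex_sum r_proper r_epi.
have D_ex : exists x0, dom_sum r x0 by exists x0.
have [xs xsP] := choice (fun lz : 'M[R]_(#|edges e|, n) * 'M[R]_(N, n) =>
  lag_minimizer_exists c0 k_gt r_proper r_epi feas f_smooth lz.1 lz.2).
have [xb xbP] := choice
  (constrained_minimizer_exists c0 k_gt r_proper r_epi feas f_smooth).
have dual_err lam z : enorm (xs (lam, z) - xb z) <= theta * enorm (A *m xs (lam, z)).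
  exact: (minimizers_close L0 mu_ge c0 k0 k_gt r_proper r_epi f_smooth thP
    (xsP (lam, z)) (xbP z)).
pose xs' lam z := xs (lam, z).
have low y : dom_sum r y -> A *m y = 0 -> f_low <= fsum f y + val_sum r y.
  move=> Dy Ay; have := f_bdd y Ay; rewrite (rsumE r_proper Dy) -EFinD lte_fin.
  exact: ltW.
pose lam0 := - (alpha *: (A *m x0)).
pose ph := pot A (fsum f) (val_sum r) c kappa xs' xb tau lam0 x0 x0 x0.
exists ph; split.
- exact: (pot_ge k0 (xs := xs') (fun lam z => xsP (lam, z)) xbP _ _ _ (ltW tau0) Dx0 low).
- rewrite /potential (prox_valueE r_proper (xbP x0)).
  rewrite (dual_valueE r_proper feas (xsP (lam0, x0))).
  by rewrite /Lagr (rsumE r_proper Dx0).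
move=> g x z lam s x0E z0E lam0E lamE xE zE K.
have xvar k := subproblem_var r_proper r_epi D_ex c0 (xE k).
have Dx k : dom_sum r (x k) by case: k => [|k]; [rewrite x0E|case: (xvar k)].
pose u k := prox (rsum r) (x k - grad (fsum f) (x k) - A^T *m lam k.+1).
have uvar k := prox_var r_proper r_epi D_ex
   (x k - grad (fsum f) (x k) - A^T *m lam k.+1).
have eta0 k : 0 <= eta k by have /andP[] := eta_bd k.
have etale k : eta k <= etab by have /andP[] := eta_bd k.
have d2le k : d2 + (gamma - mu) / 2 * eta k ^+ 2 <= tau.
  by rewrite /d2 mu'E; exact: eta_bar_margin.
have AB (y : 'M[R]_(N, n)) : 2 * enorm y ^+ 2 <= enorm (A *m y) ^+ 2 + enorm (B *m y) ^+ 2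
  by exact: incidence_coercive.
have m0d1 : m0 <= d1 / 2 by rewrite !ge_min lexx.
have m0d2 : m0 <= d2 / 2 by rewrite !ge_min lexx !orbT.
have m0a : m0 <= alpha / 2 by rewrite !ge_min lexx !orbT.
have m0b : m0 <= kappa * beta / 4 by rewrite !ge_min lexx !orbT.
have aC1 : alpha * Ca <= d1 / 4 by apply: alphaCa; rewrite ge_min lexx.
have aC2 : alpha * Ca <= d2 / 2 by apply: alphaCa; rewrite !ge_min lexx !orbT.
have aC3 : alpha * Ca <= 1 by apply: alphaCa; rewrite !ge_min lexx !orbT.
have key := sum_gap_le L0 mu_ge c0 k0 k_gt g_gt AB gf_lip f_quad cc
  (fun lam z => xsP (lam, z)) xbP dual_err Dx (fun k => (uvar k).1) lamE zE
  (fun k => (xvar k).2) (fun k => (uvar k).2) eta0 etale alpha0 beta0 beta1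
  beta_center beta_theta d10 (ltW tau0) d2le aC1 aC2 aC3 low m00 m0d1 m0d2 m0a m0b K.
apply: le_trans key _; rewrite x0E z0E lam0E -/lam0.
set E := \sum_(k < K) _.
have E0 : 0 <= E by apply: sumr_ge0 => k _; rewrite sqr_ge0.
rewrite -/Gc -/d1 -[pot _ _ _ _ _ _ _ _ _ _ _ _]/ph.
have phl : f_low <= ph.
  exact: (pot_ge k0 (xs := xs') (fun lam z => xsP (lam, z)) xbP _ _ _ (ltW tau0) Dx0 low).
have -> : (Gc + 1) / m0 * (ph - f_low + C1 * E) =
   (Gc + 1) * (m0^-1 * (ph - f_low) + (1 + (d1^-1 + 1) / m0) * E).
  by rewrite /C1; field; rewrite !gt_eqF.
rewrite ler_wpM2r ?lerDl // addr_ge0 ?mulr_ge0 ?subr_ge0 ?invr_ge0 ?(ltW m00) //.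
by rewrite addr_ge0 // divr_ge0 ?(ltW m00) // addr_ge0 ?invr_ge0 ?(ltW d10).
Qed.

(** * Measurability of random matrices *)

Section matrix_measurability.
Context (d : measure_display) (T : measurableType d) (R : realType).

Definition mx_measurable (m n : nat) (X : T -> 'M[R]_(m, n)) : Prop :=
  forall i j, measurable_fun setT (fun w => X w i j).

(** Matrices with rational entries make the sup-norm topology second
    countable, so entrywise measurability suffices. *)
Lemma mx_measurable_preimage (m n : nat) (X : T -> 'M[R]_(m, n))
    (U : set 'M[R]_(m, n)) :
  mx_measurable X ->
  (forall x, U x -> exists2 eps : R, 0 < eps &
     forall y, enorm (y - x) < eps -> U y) ->
  measurable (X @^-1` U).
Proof.
move=> mX Uo.
pose box (c : 'M[rat]_(m, n)) (k : nat) : set 'M[R]_(m, n) :=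
  [set y | forall i j, `|y i j - ratr (c i j)| < k.+1%:R^-1].
pose F (ck : 'M[rat]_(m, n) * nat) : set T :=
  [set w | box ck.1 ck.2 `<=` U /\ box ck.1 ck.2 (X w)].
have -> : X @^-1` U = \bigcup_ck F ck.
  apply/seteqP; split=> w /=; last by move=> [[c k] _ [/= cU]]; exact: cU.
  move=> /Uo[eps eps0 epsU].
  pose C : R := (m * n)%:R * 2 + 1.
  have C0 : 0 < C by rewrite ltr_wpDl // mulr_ge0.
  pose k := Num.truncn (C / eps).
  have kC : C / eps < k.+1%:R by apply: truncnS_gt.
  have k1 : 0 < k.+1%:R^-1 :> R by rewrite invr_gt0 ltr0n.
  have rat_near ij : exists c : rat, `|X w ij.1 ij.2 - ratr c| < k.+1%:R^-1.
    have [|c] := @rat_in_itvoo R (X w ij.1 ij.2 - k.+1%:R^-1)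
       (X w ij.1 ij.2 + k.+1%:R^-1).
      by rewrite ltrD2l (lt_trans _ k1) // oppr_lt0.
    by rewrite in_itv /= => /andP[c1 c2]; exists c; rewrite distrC ltr_distl c1 c2.
  have [c hc] := choice rat_near.
  exists (\matrix_(i, j) c (i, j), k) => //; split=> /= [y yb|i j]; last first.
    by rewrite mxE; exact: (hc (i, j)).
  apply: epsU; apply: le_lt_trans (_ : (m * n)%:R * (2 * k.+1%:R^-1) < _).
    apply: enorm_le_entries; first by rewrite mulr_ge0 // ltW.
    move=> i j; have h1 := yb i j; have h2 := hc (i, j); rewrite !mxE in h1 h2 *.
    have -> : y i j - X w i j = (y i j - ratr (c (i, j))) - (X w i j - ratr (c (i, j))).
      by rewrite opprB subrKA.
    rewrite (le_trans (ler_normB _ _)) // mulr_natl mulr2n; apply: lerD; exact: ltW.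
  have : C / k.+1%:R < eps.
    by rewrite ltr_pdivrMr ?ltr0n // mulrC -ltr_pdivrMr.
  by apply: le_lt_trans; rewrite mulrA ler_wpM2r ?(ltW k1) // /C lerDl.
apply: countable_bigcupT_measurable; first exact: countableP.
move=> [c k]; rewrite /F /=.
have [cU|cU] := pselect (box c k `<=` U); last first.
  rewrite (_ : [set w | _] = set0) //.
  by apply/seteqP; split=> w //= -[].
have -> : [set w | box c k `<=` U /\ box c k (X w)] =
  \bigcap_(ij in [set: 'I_m * 'I_n])
    ((fun w => X w ij.1 ij.2) @^-1` [set y | `|y - ratr (c ij.1 ij.2)| < k.+1%:R^-1]).
  apply/seteqP; split=> w /= => [[_ h] [i j] _|h]; first exact: h.
  by split=> // i j; exact: (h (i, j)).
apply: fin_bigcap_measurable => // -[i j] _ /=.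
rewrite -[X in measurable X]setTI; apply: mX => //.
rewrite (_ : [set y | _] =
   `](ratr (c i j) - k.+1%:R^-1), (ratr (c i j) + k.+1%:R^-1)[%classic) //.
by apply/seteqP; split=> y /=; rewrite in_itv /= ltr_distl.
Qed.

Lemma mx_measurable_borel (m n : nat) (X : T -> 'M[R]_(m, n)) : mx_measurable X ->
  measurable_fun setT (X : T -> g_sigma_algebraType (@open 'M[R]_(m, n))).
Proof.
move=> mX; apply: (@measurability _ _ T (g_sigma_algebraType (@open 'M[R]_(m, n))) setT X
  (@open 'M[R]_(m, n))) => // _ [U oU <-].
rewrite setTI; apply: mx_measurable_preimage mX _ => x Ux.
have /nbhs_ballP[eps /= eps0 epsU] : nbhs x U by exact: open_nbhs_nbhs.
exists eps => // y yx; apply: epsU; split=> // i j.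
rewrite /ball /= distrC; apply: le_lt_trans yx.
by have := entry_le_enorm (y - x) i j; rewrite !mxE.
Qed.

Lemma lipschitz_mx_measurable (m n : nat) (X : T -> 'M[R]_(m, n))
    (F : 'M[R]_(m, n) -> R) (C : R) :
  mx_measurable X -> (forall x y, `|F x - F y| <= C * enorm (x - y)) ->
  measurable_fun setT (fun w => F (X w)).
Proof.
move=> mX FC; apply: (measurability _ (RGenOInfty.measurableE R)).
move=> _ [_ [a ->] <-]; rewrite setTI.
rewrite (_ : _ @^-1` _ = X @^-1` [set x | a < F x]); last first.
  by apply/seteqP; split=> w /=; rewrite in_itv /= andbT.
apply: mx_measurable_preimage mX _ => x /= ax.
have C1 : 0 < `|C| + 1 by rewrite ltr_wpDl.
exists ((F x - a) / (`|C| + 1)); first by rewrite divr_gt0 // subr_gt0.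
move=> y; rewrite ltr_pdivlMr // => yx.
have := FC y x; rewrite ler_norml => /andP[h _].
have := ler_norm C; have := enorm_ge0 (y - x) => e0 CC.
have : C * enorm (y - x) <= `|C| * enorm (y - x) by rewrite ler_wpM2r.
lra.
Qed.

Lemma lipschitz_mx_measurable_mx (m n p q : nat) (X : T -> 'M[R]_(m, n))
    (F : 'M[R]_(m, n) -> 'M[R]_(p, q)) (C : R) :
  mx_measurable X -> (forall x y, enorm (F x - F y) <= C * enorm (x - y)) ->
  mx_measurable (fun w => F (X w)).
Proof.
move=> mX FC i j.
apply: (lipschitz_mx_measurable (F := fun x => F x i j) mX) => x y.
by apply: le_trans (FC x y); have := entry_le_enorm (F x - F y) i j; rewrite !mxE.
Qed.

Lemma mx_measurable_cst (m n : nat) (x : 'M[R]_(m, n)) : mx_measurable (fun=> x).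
Proof. by move=> i j; exact: measurable_cst. Qed.

Lemma mx_measurableD (m n : nat) (X Y : T -> 'M[R]_(m, n)) :
  mx_measurable X -> mx_measurable Y -> mx_measurable (fun w => X w + Y w).
Proof.
move=> mX mY i j; under eq_fun do rewrite mxE.
by apply: measurable_funD; [exact: mX|exact: mY].
Qed.

Lemma mx_measurableZ (m n : nat) (a : R) (X : T -> 'M[R]_(m, n)) :
  mx_measurable X -> mx_measurable (fun w => a *: X w).
Proof.
move=> mX i j; under eq_fun do rewrite mxE.
by apply: measurable_funM => //; exact: mX.
Qed.

Lemma mx_measurableN (m n : nat) (X : T -> 'M[R]_(m, n)) :
  mx_measurable X -> mx_measurable (fun w => - X w).
Proof.
move=> mX; under eq_fun do rewrite -scaleN1r; exact: mx_measurableZ.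
Qed.

Lemma mx_measurableB (m n : nat) (X Y : T -> 'M[R]_(m, n)) :
  mx_measurable X -> mx_measurable Y -> mx_measurable (fun w => X w - Y w).
Proof. by move=> mX mY; apply: mx_measurableD => //; exact: mx_measurableN. Qed.

Lemma mx_measurable_mul (m n p : nat) (M : 'M[R]_(p, m)) (X : T -> 'M[R]_(m, n)) :
  mx_measurable X -> mx_measurable (fun w => M *m X w).
Proof.
move=> mX; apply: (lipschitz_mx_measurable_mx (F := mulmx M) (C := enorm M) mX).
by move=> x y; rewrite -mulmxBr; exact: enorm_mulmx.
Qed.

Lemma mx_measurable_row (m n : nat) (X : T -> 'M[R]_(m, n)) i :
  mx_measurable X -> mx_measurable (fun w => row i (X w)).
Proof. by move=> mX k j; under eq_fun do rewrite mxE; exact: mX. Qed.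

Lemma mx_measurable_sum (m n : nat) (I : Type) (r : seq I) (Q : pred I)
    (X : I -> T -> 'M[R]_(m, n)) :
  (forall i, Q i -> mx_measurable (X i)) ->
  mx_measurable (fun w => \sum_(i <- r | Q i) X i w).
Proof.
move=> mX j k.
have -> : (fun w => (\sum_(i <- r | Q i) X i w) j k) =
    (fun w => \sum_(i <- r) if Q i then X i w j k else 0).
  by apply/funext => w; rewrite summxE big_mkcond.
by apply: measurable_sum => i; case Qi: (Q i); [exact: mX|exact: measurable_cst].
Qed.

Lemma mx_measurable_sqr_enorm (m n : nat) (X : T -> 'M[R]_(m, n)) :
  mx_measurable X -> measurable_fun setT (fun w => enorm (X w) ^+ 2).
Proof.
move=> mX; under eq_fun do rewrite sqr_enorm /inner.
apply: measurable_sum => i; apply: measurable_sum => j.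
by apply: measurable_funM; exact: mX.
Qed.

End matrix_measurability.

(** * Independence of a sample from all the others *)

Section independence.
Context (d : measure_display) (T : measurableType d) (R : realType).
Variable (P : probability T R).
Variables (I : eqType) (dU : I -> measure_display).
Variables (U : forall i, measurableType (dU i)) (X : forall i, T -> U i).
Hypothesis mX : forall i, measurable_fun setT (X i).

(** A pi-system generating the sigma-algebra of all the samples but one. *)
Definition other_events (i0 : I) : set (set T) :=
  [set E | exists (J : seq I) (S : forall i, set (U i)),
     [/\ uniq J, i0 \notin J, forall i, measurable (S i) &
         E = \bigcap_(i in [set` J]) (X i @^-1` S i)]].

Lemma other_events_setI i0 : setI_closed (other_events i0).
Proof.
move=> _ _ [J [S [uJ nJ mS ->]]] [J' [S' [uJ' nJ' mS' ->]]].
exists (undup (J ++ J')), (fun i => (if i \in J then S i else setT)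
   `&` (if i \in J' then S' i else setT)); split.
- exact: undup_uniq.
- by rewrite mem_undup mem_cat negb_or nJ.
- by move=> i; apply: measurableI; case: ifP.
apply/seteqP; split=> [w [h h'] i /= _|w h].
  by split; case: ifP => // ij; [exact: h|exact: h'].
split=> i /= ij.
  have [] := h i; first by rewrite /= mem_undup mem_cat ij.
  by rewrite ij.
have [] := h i; first by rewrite /= mem_undup mem_cat ij orbT.
by rewrite ij.
Qed.

Lemma other_events_measurable i0 A : <<s other_events i0 >> A -> measurable A.
Proof.
move=> sA; apply: sA; split; first exact: sigma_algebra_measurable.
move=> _ [J [S [_ _ mS ->]]]; apply: fin_bigcap_measurable => //.
by move=> i _; rewrite -[X in measurable X]setTI; exact: mX.
Qed.

Lemma other_sample_measurable i0 i : i != i0 ->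
  measurable_fun (setT : set (g_sigma_algebraType (other_events i0))) (X i).
Proof.
move=> ii0 _ B mB; rewrite setTI; apply: sub_sigma_algebra.
exists [:: i], (dfwith (fun j => [set: U j]) i B); split => //.
- by rewrite inE eq_sym.
- move=> j; have [<-|ij] := eqVneq i j; first by rewrite dfwithin.
  by rewrite dfwithout.
apply/seteqP; split=> [w Bw j /=|w /(_ i)].
  by rewrite inE => /eqP ->; rewrite dfwithin.
by rewrite /= mem_head dfwithin; exact.
Qed.

Lemma sample_independent_of_others i0 A B : mutually_independent P X ->
  <<s other_events i0 >> A -> measurable B ->
  P (A `&` X i0 @^-1` B) = (P A * P (X i0 @^-1` B))%E.
Proof.
move=> indep sA mB.
have mXB : measurable (X i0 @^-1` B).
  by rewrite -[X in measurable X]setTI; exact: mX.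
pose T' := g_sigma_algebraType (other_events i0).
pose ok (A : set T') := P (A `&` X i0 @^-1` B) = (P A * P (X i0 @^-1` B))%E.
apply: (@dynkin_induction _ T' (other_events i0) ok) => //.
- exact: other_events_setI.
- by rewrite /ok setTI probability_setT mul1e.
- move=> _ [J [S [uJ nJ mS ->]]]; rewrite /ok.
  pose S' := dfwith S i0 B.
  have S'E i : i \in J -> S' i = S i.
    move=> iJ; rewrite /S' dfwithout //.
    by apply: contraNneq nJ => ->.
  have mS' i : measurable (S' i).
    have [<-|ii] := eqVneq i0 i; first by rewrite /S' dfwithin.
    by rewrite /S' dfwithout.
  have h1 := indep J S uJ mS.
  have /indep/(_ mS') : uniq (i0 :: J) by rewrite /= nJ.
  rewrite big_cons {2}/S' dfwithin muleC.
  rewrite (eq_big_seq (fun i => P (X i @^-1` S i))); last first.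
    by move=> i iJ; rewrite S'E.
  rewrite -h1 => <-; congr (P _); apply/seteqP; split=> w.
    move=> [hw Bw] i /=; rewrite inE => /predU1P[->|iJ].
      by rewrite /S' dfwithin.
    by rewrite S'E //; exact: hw.
  move=> hw; split; last first.
    by have := hw i0; rewrite /= mem_head /S' dfwithin; exact.
  move=> i /= iJ; have := hw i; rewrite /= inE iJ orbT S'E //; exact.
- move=> S mS; rewrite /ok => hS.
  have mS1 : measurable (S : set T) by exact: other_events_measurable mS.
  have PSfin : (P S = (fine (P S))%:E)%E by rewrite fineK // fin_num_measure.
  have PCfin : (P (X i0 @^-1` B) = (fine (P (X i0 @^-1` B)))%:E)%E.
    by rewrite fineK // fin_num_measure.
  have PCoo : (P (X i0 @^-1` B) < +oo)%E by rewrite PCfin ltry.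
  transitivity (P (X i0 @^-1` B) - P (S `&` X i0 @^-1` B))%E.
    rewrite (setIC S) -(measureD mXB mS1 PCoo); congr (P _).
    by rewrite setIC setDE.
  rewrite hS; transitivity ((1 - P S) * P (X i0 @^-1` B))%E; last first.
    by congr (_ * _)%E; apply/esym; exact: probability_setC.
  by rewrite PSfin PCfin -EFinM -!EFinB -EFinM; congr EFin; ring.
- move=> F mF tF hF; rewrite /ok.
  have mF1 k : measurable (F k : set T) by exact: other_events_measurable (mF k).
  have PCfin : (P (X i0 @^-1` B) = (fine (P (X i0 @^-1` B)))%:E)%E.
    by rewrite fineK // fin_num_measure.
  rewrite setI_bigcupl measure_semi_bigcup; last first.
  - by apply: bigcup_measurable => k _; exact: measurableI.
  - exact: trivIset_setIr.
  - by move=> k; exact: measurableI.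
  rewrite measure_semi_bigcup //; last exact: bigcup_measurable.
  rewrite muleC PCfin -nneseriesZl //; apply: eq_eseriesr => k _.
  by rewrite muleC -PCfin; exact: hF.
Qed.

End independence.

(** If the law of [X] does not depend on what [Y] reveals, the average over both
    may be computed by freezing [Y] first. *)
Lemma integral_independent (d d' d2 : measure_display) (T : measurableType d)
    (T' : measurableType d') (U : measurableType d2) (R : realType)
    (P : probability T R) (law : probability U R) (Y : T -> T') (X : T -> U)
    (h : T' * U -> \bar R) :
  measurable_fun setT Y -> measurable_fun setT X ->
  (forall A B, measurable A -> measurable B ->
     P (Y @^-1` A `&` X @^-1` B) = (P (Y @^-1` A) * law B)%E) ->
  measurable_fun setT h -> (forall p, (0 <= h p)%E) ->
  (\int[P]_w h (Y w, X w) = \int[P]_w \int[law]_u h (Y w, u))%E.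
Proof.
move=> mY mX indep mh h0.
pose Yr : {mfun T >-> T'} := mfun_Sub (mem_set mY).
pose Z : {mfun T >-> (T' * U)%type} := mfun_Sub (mem_set (measurable_fun_pair mY mX)).
transitivity (\int[distribution P Z]_p h p)%E.
  by rewrite ge0_integral_distribution.
transitivity (\int[(distribution P Yr \x law)%E]_p h p)%E.
  apply: eq_measure_integral => A mA _; apply/esym.
  by apply: product_measure_unique => // B C mB mC; exact: indep.
rewrite fubini_tonelli1 // /fubini_F ge0_integral_distribution //.
- exact: measurable_fun_fubini_tonelli_F.
- by move=> y; apply: integral_ge0.
Qed.

(** * Variance of the mini-batch gradient *)

(** The other summands cancel in each difference quotient. *)
Lemma grad_fsum_row (R : realType) (N n : nat) (f : 'I_N -> 'rV[R]_n -> R)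
    (x : 'M[R]_(N, n)) i : row i (grad (fsum f) x) = grad (f i) (row i x).
Proof.
apply/rowP => j; rewrite !mxE /derive.
rewrite (_ : (fun h => h^-1 *: ((fsum f \o shift x) (h *: delta_mx i j) - fsum f x))
  = (fun h => h^-1 *: ((f i \o shift (row i x)) (h *: delta_mx 0 j) - f i (row i x)))) //.
apply/funext => h /=; congr (_ *: _).
rewrite /fsum -sumrB (bigD1 i) //= big1 ?addr0 => [|i' ii'].
  congr (f i _ - _); apply/rowP => j'; rewrite !mxE.
  by rewrite ?ord1 ?eqxx.
rewrite (_ : row i' (h *: delta_mx i j + x) = row i' x) ?subrr //.
by apply/rowP => j'; rewrite !mxE (negPf ii') mulr0 add0r.
Qed.

Lemma integral_cst_probability (d : measure_display) (T : measurableType d)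
    (R : realType) (P : probability T R) (a : \bar R) :
  (\int[P]_w cst a w = a)%E.
Proof.
rewrite integral_cst // -[RHS]mule1; congr (_ * _)%E; exact: probability_setT.
Qed.

Section batch_variance.
Variables (R : realType) (N n : nat).
Variables (dX : 'I_N -> measure_display) (Xi : forall i, measurableType (dX i)).
Variables (law : forall i, probability (Xi i) R).
Variable (G : forall i, 'rV[R]_n -> Xi i -> 'rV[R]_n).
Variables (f : 'I_N -> 'rV[R]_n -> R) (sigma : R).
Hypothesis sg : stochastic_gradient law G f sigma.

Lemma sample_integrable i x j :
  (law i).-integrable setT (fun u => ((G x u - grad (f i) x) 0 j)%:E) /\
  (\int[law i]_u ((G x u - grad (f i) x) 0 j)%:E = 0)%E.
Proof.
have [_ meanG _] := sg i; have [intG] := meanG x j; rewrite unlock => EG.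
have intc : (law i).-integrable setT (cst (grad (f i) x 0 j)%:E).
  exact: finite_measure_integrable_cst.
have e : (fun u : Xi i => ((G x u - grad (f i) x) 0 j)%:E) =
    (fun u : Xi i => (G x u 0 j)%:E - cst (grad (f i) x 0 j)%:E u)%E.
  by apply/funext => u; rewrite !mxE EFinB.
rewrite e; split; first exact: integrableB.
rewrite integralB // EG integral_cst_probability.
by rewrite -EFinB subrr.
Qed.

(** Adding a fresh unbiased sample to a fixed vector [v]: the cross term has mean
    zero, so the second moments add up. *)
Lemma sample_second_moment i x v :
  (\int[law i]_u (enorm (v + (G x u - grad (f i) x)) ^+ 2)%:E
     <= (enorm v ^+ 2 + sigma ^+ 2)%:E)%E.
Proof.
have [_ _ varG] := sg i.
have intD j := (sample_integrable i x j).1.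
pose cross (u : Xi i) := (\sum_(j < n) ((2 * v 0 j)%:E * ((G x u - grad (f i) x) 0 j)%:E))%E.
have intcross : (law i).-integrable setT cross.
  by apply: integrable_sum => // j _; exact: integrableZl.
have cross0 : (\int[law i]_u cross u = 0)%E.
  rewrite integral_sum //=; last by move=> j; exact: integrableZl.
  rewrite big1 // => j _; rewrite integralZl // (sample_integrable i x j).2.
  by rewrite mule0.
pose F (u : Xi i) := (enorm (G x u - grad (f i) x) ^+ 2)%:E.
have mF : measurable_fun setT F.
  apply/measurable_EFinP.
  apply: (@mx_measurable_sqr_enorm _ _ _ _ _ (fun u : Xi i => G x u - grad (f i) x)).
  move=> i' j; rewrite ord1; have /measurable_int := intD j.
  by move=> /measurable_EFinP.
have F0 u : (0 <= F u)%E by rewrite lee_fin sqr_ge0.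
have Fle : (\int[law i]_u F u <= (sigma ^+ 2)%:E)%E.
  by have := varG x; rewrite unlock.
have intF : (law i).-integrable setT F.
  apply/integrableP; split=> //.
  under eq_integral do rewrite gee0_abs //.
  by apply: le_lt_trans Fle _; rewrite ltry.
have intc : (law i).-integrable setT (cst (enorm v ^+ 2)%:E).
  exact: finite_measure_integrable_cst.
have e u : (enorm (v + (G x u - grad (f i) x)) ^+ 2)%:E =
    (cst (enorm v ^+ 2)%:E u + (cross u + F u))%E.
  rewrite /cross /F sumEFin -!EFinD sqr_enormD; congr EFin.
  rewrite -addrA; congr (_ + (_ + _)).
  by rewrite /inner big_ord1 mulr_sumr; apply: eq_bigr => j _; rewrite mulrA.
under eq_integral do rewrite e.
rewrite integralD //; last exact: integrableD.
rewrite integralD // cross0 add0e integral_cst_probability EFinD.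
by rewrite leeD2l.
Qed.

Section one_batch.
Variables (d : measure_display) (T : measurableType d) (P : probability T R).
Variables (b : nat) (xi : nat -> forall i : 'I_N, 'I_b -> {RV P >-> Xi i}).
Hypothesis iid : iid_samples law xi.
Variables (L mu : R) (f_smooth : smooth_weakly_convex f L mu).

Let sample (p : nat * 'I_N * 'I_b) : T -> Xi p.1.2 := xi p.1.1 p.1.2 p.2.

(** The probability space, as seen by an observer of all the samples except [p]. *)
Definition all_but (p : nat * 'I_N * 'I_b) := g_sigma_algebraType (other_events sample p).

Variables (k : nat) (s : T -> 'M[R]_(N, n)).
Hypothesis ms : forall i j, mx_measurable (T := all_but (k, i, j)) s.

Let err i j w := G (row i (s w)) (xi k i j w) - grad (f i) (row i (s w)).
Let partial i m w := \sum_(j < b | (j < m)%N) err i j w.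

Lemma sample_measurable p : measurable_fun setT (sample p).
Proof. exact: measurable_funPT. Qed.

Lemma all_but_id p : measurable_fun setT (id : T -> all_but p).
Proof.
move=> _ B mB; rewrite setTI; exact: (other_events_measurable sample_measurable mB).
Qed.

Lemma grad_measurable d' (T' : measurableType d') (Y : T' -> 'M[R]_(N, n)) i :
  mx_measurable Y -> mx_measurable (fun w => grad (f i) (row i (Y w))).
Proof.
move=> mY; under eq_fun do rewrite -grad_fsum_row.
apply: mx_measurable_row; apply: lipschitz_mx_measurable_mx mY _.
by have [_ _ h _] := f_smooth; exact: h.
Qed.

Lemma estimate_measurable d' (T' : measurableType d') (Y : T' -> 'M[R]_(N, n)) i
    (X : T' -> Xi i) : mx_measurable Y -> measurable_fun setT X ->
  mx_measurable (fun w => G (row i (Y w)) (X w)).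
Proof.
move=> mY mX i' j; rewrite ord1; have [mG _ _] := sg i.
have mp : measurable_fun setT (fun w =>
    (row i (Y w) : g_sigma_algebraType (@open 'rV[R]_n), X w)).
  apply: measurable_fun_pair => //.
  by apply: mx_measurable_borel; exact: mx_measurable_row.
exact: (measurableT_comp (mG j) mp).
Qed.

(** The [m]-th sample is fresh with respect to both the query point and the sum of
    the first [m] errors: all of these are measurable for the sigma-algebra of the
    other samples, so they may be frozen while the fresh sample is averaged. *)
Lemma partial_second_moment i m : (m <= b)%N ->
  (\int[P]_w (enorm (partial i m w) ^+ 2)%:E <= (m%:R * sigma ^+ 2)%:E)%E.
Proof.
elim: m => [_|m IH mb].
  rewrite mul0r (_ : (fun w => _) = cst 0%E) ?integral0 //.
  apply/funext => w; rewrite /partial big_pred0; last by move=> j; rewrite ltn0.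
  by rewrite enorm0 expr0n.
pose jm := Ordinal mb; pose p0 := (k, i, jm).
have mpart : mx_measurable (T := all_but p0) (partial i m).
  apply: mx_measurable_sum => j jm'.
  have jp : (k, i, j) != p0.
    by apply/eqP => -[] /(congr1 val) /= e; rewrite e ltnn in jm'.
  apply: mx_measurableB; last exact: (@grad_measurable _ (all_but p0) s i (@ms i jm)).
  apply: (@estimate_measurable _ (all_but p0) s i (xi k i j) (@ms i jm)).
  exact: (@other_sample_measurable _ _ _ _ _ sample p0 (k, i, j) jp).
pose h (p : all_but p0 * Xi i) :=
  (enorm (partial i m p.1 + (G (row i (s p.1)) p.2 - grad (f i) (row i (s p.1)))) ^+ 2)%:E.
have m_fst (q r : nat) (Y : T -> 'M[R]_(q, r)) :
    mx_measurable (T := all_but p0) Y ->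
    mx_measurable (fun p : all_but p0 * Xi i => Y p.1).
  by move=> mY i' j'; apply: measurableT_comp (mY i' j') _; exact: measurable_fst.
have mh : measurable_fun setT h.
  apply/measurable_EFinP; apply: mx_measurable_sqr_enorm.
  apply: mx_measurableD; first exact: m_fst.
  apply: mx_measurableB.
    apply: (@estimate_measurable _ _ (fun p : all_but p0 * Xi i => s p.1) i snd).
      exact: m_fst (@ms i jm).
    exact: measurable_snd.
  exact: grad_measurable (m_fst _ _ _ (@ms i jm)).
have step w : (enorm (partial i m.+1 w) ^+ 2)%:E = h (w, xi k i jm w).
  rewrite /h /partial (bigD1 jm) //= addrC; congr ((enorm (_ + _) ^+ 2)%:E).
  by apply: eq_bigl => j; rewrite ltnS ltn_neqAle andbC.
under eq_integral do rewrite step.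
have [lawE indep] := iid.
have h0 p : (0 <= h p)%E by rewrite lee_fin sqr_ge0.
have mfub : measurable_fun setT (fubini_F (law i) h).
  exact: measurable_fun_fubini_tonelli_F.
rewrite (integral_independent (law := law i) (all_but_id (p:=p0)) _ _ mh).
- have mpart2 : measurable_fun setT (fun w => (enorm (partial i m w) ^+ 2)%:E).
    apply/measurable_EFinP; apply: mx_measurable_sqr_enorm => i' j'.
    exact: measurableT_comp (mpart i' j') (all_but_id (p := p0)).
  apply: (@le_trans _ _ (\int[P]_w ((enorm (partial i m w) ^+ 2)%:E + (sigma ^+ 2)%:E))%E).
    apply: ge0_le_integral => //.
    + by move=> w _; apply: integral_ge0 => u _; rewrite lee_fin sqr_ge0.
    + exact: (measurableT_comp mfub (all_but_id (p := p0))).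
    + by apply: emeasurable_funD => //; exact: measurable_cst.
    + move=> w _; exact: (sample_second_moment i (row i (s w)) (partial i m w)).
  rewrite ge0_integralD //; last first.
  + by move=> w _; rewrite lee_fin sqr_ge0.
  + by move=> w _; rewrite lee_fin sqr_ge0.
  rewrite integral_cst_probability -natr1 mulrDl mul1r EFinD.
  by apply: leeD => //; apply: IH; exact: ltnW.
- exact: measurable_funPT.
- move=> A B mA mB.
  have := sample_independent_of_others sample_measurable indep mA mB.
  by move=> ->; congr (_ * _)%E; exact: lawE.
- by move=> p; rewrite lee_fin sqr_ge0.
Qed.

Lemma batch_gradient_measurable d' (T' : measurableType d') (iota : T' -> T)
    (Y : T' -> 'M[R]_(N, n)) k' : mx_measurable Y ->
  (forall i j, measurable_fun setT (fun w => xi k' i j (iota w))) ->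
  mx_measurable (fun w => batch_gradient G xi k' (iota w) (Y w)).
Proof.
move=> mY mxi i j.
rewrite (_ : (fun w => _) = (fun w => (b%:R^-1 *: \sum_(j' < b)
    G (row i (Y w)) (xi k' i j' (iota w))) 0 j)); last first.
  by apply/funext => w; rewrite !mxE.
apply: (@mx_measurableZ _ _ _ _ _ _ (fun w => \sum_(j' < b)
    G (row i (Y w)) (xi k' i j' (iota w)))).
apply: mx_measurable_sum => j' _; exact: estimate_measurable mY (mxi i j').
Qed.

(** Independent samples make the error of the batch average [b] times smaller in
    mean square; the agents' errors add up. *)
Lemma batch_second_moment : (0 < b)%N ->
  (\int[P]_w (enorm (batch_gradient G xi k w (s w) - grad (fsum f) (s w)) ^+ 2)%:E
    <= (N%:R * sigma ^+ 2 / b%:R)%:E)%E.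
Proof.
move=> b0; have bR : 0 < b%:R :> R by rewrite ltr0n.
have rowE i w : row i (batch_gradient G xi k w (s w) - grad (fsum f) (s w)) =
    b%:R^-1 *: partial i b w.
  rewrite linearB /= grad_fsum_row /batch_gradient rowK.
  have -> : partial i b w = \sum_j err i j w by apply: eq_bigl => j; rewrite ltn_ord.
  rewrite sumrB scalerBr sumr_const card_ord -[grad _ _ *+ _]scaler_nat scalerA mulVf ?scale1r //.
  by rewrite gt_eqF.
have e w : (enorm (batch_gradient G xi k w (s w) - grad (fsum f) (s w)) ^+ 2)%:E =
    (\sum_(i < N) ((b%:R^-1 ^+ 2)%:E * (enorm (partial i b w) ^+ 2)%:E))%E.
  rewrite sqr_enorm_rows sumEFin; congr EFin; apply: eq_bigr => i _.
  by rewrite rowE enormZ exprMn real_normK ?num_real.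
have mp i : measurable_fun setT (fun w => (enorm (partial i b w) ^+ 2)%:E).
  apply/measurable_EFinP; apply: mx_measurable_sqr_enorm.
  apply: mx_measurable_sum => j _.
  have ms' : mx_measurable s.
    move=> i2 j2; exact: measurableT_comp (@ms i j i2 j2) (all_but_id (p := (k, i, j))).
  apply: mx_measurableB; last exact: grad_measurable.
  by apply: estimate_measurable => //; exact: measurable_funPT.
under eq_integral do rewrite e.
rewrite ge0_integral_sum //; last first.
- by move=> i w _; rewrite mule_ge0 // lee_fin sqr_ge0.
- by move=> i; apply: emeasurable_funM => //; exact: measurable_cst.
apply: (@le_trans _ _ (\sum_(i < N) (sigma ^+ 2 / b%:R)%:E)%E); last first.
  by rewrite sumEFin sumr_const card_ord -(mulr_natl (sigma ^+ 2 / b%:R)) mulrA.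
apply: lee_sum => i _.
have q0 w : setT w -> (0 <= (enorm (partial i b w) ^+ 2)%:E)%E.
  by rewrite lee_fin sqr_ge0.
have bV0 : (0 <= ((b%:R^-1 : R) ^+ 2)%:E)%E by rewrite lee_fin sqr_ge0.
rewrite (ge0_integralZl _ _ (mp i) q0 bV0) //.
apply: le_trans (lee_wpmul2l _ (partial_second_moment i (leqnn b))) _.
  by rewrite lee_fin sqr_ge0.
rewrite -EFinM lee_fin le_eqVlt; apply/orP; left; apply/eqP.
by field; rewrite gt_eqF.
Qed.

End one_batch.
End batch_variance.

(** * Measurability of the iterates, and the rate *)

Section iterates.
Variables (R : realType) (N n : nat).
Variables (dX : 'I_N -> measure_display) (Xi : forall i, measurableType (dX i)).
Variables (law : forall i, probability (Xi i) R).
Variable (G : forall i, 'rV[R]_n -> Xi i -> 'rV[R]_n).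
Variables (f : 'I_N -> 'rV[R]_n -> R) (sigma : R).
Hypothesis sg : stochastic_gradient law G f sigma.
Variables (q : 'I_N -> nat) (r : 'I_N -> 'rV[R]_n -> \bar R).
Variables (Sx : forall i, 'M[R]_(q i, n)) (Sy zeta : forall i, 'cV[R]_(q i)).
Hypothesis r_proper : forall i, proper_fun (r i).
Hypothesis r_epi : polyhedral_epigraph r Sx Sy zeta.
Hypothesis D_ex : exists x0 : 'M[R]_(N, n), dom_sum r x0.
Variables (e : rel 'I_N) (alpha beta c kappa gamma : R) (eta : nat -> R).
Hypotheses (c_gt0 : 0 < c) (kappa_gt0 : 0 < kappa) (gamma_gt0 : 0 < gamma).
Variables (d : measure_display) (T : measurableType d) (P : probability T R).
Variables (b : nat) (xi : nat -> forall i : 'I_N, 'I_b -> {RV P >-> Xi i}).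
Variables (x0 : 'M[R]_(N, n)) (x z : nat -> T -> 'M[R]_(N, n)).
Variable (lam : nat -> T -> 'M[R]_(#|edges e|, n)).
Hypothesis run : SPPDM G f r alpha beta gamma c kappa eta xi x0 x z lam.

Let s k w := x k w + eta k *: (x k w - x k.-1 w).

(** The solution of the subproblem as a function of the only combination of its
    data that matters. *)
Let solve (y : 'M[R]_(N, n)) : 'M[R]_(N, n) :=
  xget 0 (argmin (subproblem (e := e) f r c kappa gamma (- y) 0 0 0 0)).

Let solve_argmin y :
  argmin (subproblem (e := e) f r c kappa gamma (- y) 0 0 0 0) (solve y).
Proof.
have [u umin] := subproblem_exists r_proper r_epi D_ex (e := e) f
  c_gt0 kappa_gt0 gamma_gt0 (- y) 0 0 0 0.
rewrite /solve; case: xgetP => [v -> //|/(_ u) nmin].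
by exfalso; apply: nmin.
Qed.

Let sub_data0 (y : 'M[R]_(N, n)) :
  sub_data (e := e) c kappa gamma (- y) 0 0 0 0 = y.
Proof. by rewrite /sub_data !mulmx0 !scaler0 !subr0 !addr0 sub0r opprK. Qed.

Let gk_gt0 : 0 < gamma + kappa.
Proof. exact: addr_gt0. Qed.

Let solve_lip (y y' : 'M[R]_(N, n)) :
  enorm (solve y - solve y') <= (gamma + kappa)^-1 * enorm (y - y').
Proof.
have := subproblem_lip r_proper r_epi D_ex c_gt0 (solve_argmin y) (solve_argmin y').
by rewrite !sub_data0 mulrC -ler_pdivlMr // mulrC.
Qed.

Let next_iterate k w : x k.+1 w = solve (sub_data (e := e) c kappa gamma
  (batch_gradient G xi k w (s k w)) (s k w) (x k w) (z k w) (lam k.+1 w)).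
Proof.
apply/eqP; rewrite -subr_eq0; apply/eqP; apply: enorm_eq0.
have := subproblem_lip r_proper r_epi D_ex c_gt0 (sppdm_x run k w) (solve_argmin
  (sub_data (e := e) c kappa gamma (batch_gradient G xi k w (s k w)) (s k w)
     (x k w) (z k w) (lam k.+1 w))).
rewrite sub_data0 subrr enorm0 pmulr_rle0 // => h.
by apply/eqP; rewrite eq_le h enorm_ge0.
Qed.

(** [iota] lets the sigma-algebra on the probability space be smaller than the
    ambient one: only the samples drawn before step [K] need be measurable. *)
Lemma iterates_measurable d' (T' : measurableType d') (iota : T' -> T) (K : nat) :
  (forall k i j, (k < K)%N -> measurable_fun setT (fun w => xi k i j (iota w))) ->
  forall k, (k <= K)%N ->
  [/\ mx_measurable (fun w => x k (iota w)),
      mx_measurable (fun w => x k.-1 (iota w)),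
      mx_measurable (fun w => z k (iota w))
    & mx_measurable (fun w => lam k (iota w))].
Proof.
move=> mxi; elim=> [_|k IH kK] /=.
  split; under eq_fun do rewrite ?(sppdm_x0 run) ?(sppdm_z0 run) ?(sppdm_lam0 run);
    exact: mx_measurable_cst.
have [mx mxm mz ml] := IH (ltnW kK).
have ml' : mx_measurable (fun w => lam k.+1 (iota w)).
  under eq_fun do rewrite (sppdm_lam run).
  by apply: mx_measurableD => //; apply: mx_measurableZ; exact: mx_measurable_mul.
have ms : mx_measurable (fun w => s k (iota w)).
  by apply: mx_measurableD => //; apply: mx_measurableZ; exact: mx_measurableB.
have mg : mx_measurable (fun w => batch_gradient G xi k (iota w) (s k (iota w))).
  by apply: (batch_gradient_measurable sg ms) => i j; exact: mxi.
have mx' : mx_measurable (fun w => x k.+1 (iota w)).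
  under eq_fun do rewrite next_iterate.
  apply: lipschitz_mx_measurable_mx solve_lip.
  rewrite /sub_data; apply: mx_measurableD; last exact: mx_measurableZ.
  apply: mx_measurableD; last first.
    by apply: mx_measurableZ; do 2!apply: mx_measurable_mul.
  apply: mx_measurableB; last exact: mx_measurable_mul.
  by apply: mx_measurableB => //; exact: mx_measurableZ.
split => //; under eq_fun do rewrite (sppdm_z run).
by apply: mx_measurableD => //; apply: mx_measurableZ; exact: mx_measurableB.
Qed.

(** The extrapolated point of step [k] involves the samples of the earlier steps
    only, so it is independent of each sample of step [k]. *)
Lemma extrapolation_measurable k i j :
  mx_measurable (T := all_but xi (k, i, j)) (s k).
Proof.
have [|mx mxm _ _] := @iterates_measurable _ (all_but xi (k, i, j)) id k _ k (leqnn k).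
  move=> k' i' j' k'k.
  apply: (@other_sample_measurable _ _ _ _ _
    (fun p : nat * 'I_N * 'I_b => xi p.1.1 p.1.2 p.2) (k, i, j) (k', i', j')).
  by apply/eqP => -[kk _ _]; rewrite kk ltnn in k'k.
by apply: mx_measurableD => //; apply: mx_measurableZ; exact: mx_measurableB.
Qed.

End iterates.

Lemma bigmin_le_mean (R : realType) (K : nat) (a : 'I_K -> \bar R) (m : R) :
  (0 < K)%N -> (\sum_(k < K) a k <= (K%:R * m)%:E)%E ->
  (\big[mine/+oo]_(k < K) a k <= m%:E)%E.
Proof.
move=> K0 sum_le; rewrite leNgt; apply/negP => mlt.
set mn := \big[_/_]_(_ < _) _ in mlt.
have [t mt tmn] : exists2 t : R, m < t & (t%:E <= mn)%E.
  case: mn mlt => [t||] // mlt; first by exists t.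
  by exists (m + 1); rewrite ?ltrDl // leey.
have : (\sum_(k < K) t%:E <= \sum_(k < K) a k)%E.
  by apply: lee_sum => k _; apply: le_trans tmn _; exact: bigmin_le.
move=> /le_trans/(_ sum_le); rewrite sumEFin sumr_const card_ord lee_fin.
by rewrite -(mulr_natl t) ler_pM2l ?ltr0n // leNgt mt.
Qed.

Theorem theorem1 (R : realType) (N : nat) (e : rel 'I_N)
    (L mu c kappa gamma : R)
    (graph_e : connected_graph e)
    (degree_ge1 : forall i : 'I_N, (1 <= degree e i)%N)
    (L_gt0 : 0 < L) (mu_ge : - L <= mu)
    (c_gt0 : 0 < c) (kappa_gt0 : 0 < kappa) (gamma_gt0 : 0 < gamma)
    (kappa_gt : - mu < kappa) (gamma_gt : 3 * L < gamma) :
  exists tau alpha_bar : R,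
    [/\ 0 < tau, 0 < alpha_bar, alpha_bar <= c &
  forall alpha : R, 0 < alpha -> alpha <= alpha_bar ->
  forall (n : nat) (q : 'I_N -> nat)
    (Sx : forall i, 'M[R]_(q i, n)) (Sy : forall i, 'cV[R]_(q i)),
  (0 < n)%N ->
  exists beta_bar : R, [/\ 0 < beta_bar, beta_bar <= 1 &
  forall beta : R, 0 < beta -> beta < beta_bar ->
  exists C0 C1 : R, [/\ 0 < C0, 0 < C1 &
  forall (f : 'I_N -> 'rV[R]_n -> R) (r : 'I_N -> 'rV[R]_n -> \bar R)
    (zeta : forall i, 'cV[R]_(q i)) (f_low sigma : R)
    (dX : 'I_N -> measure_display) (Xi : forall i, measurableType (dX i))
    (law : forall i, probability (Xi i) R)
    (G : forall i, 'rV[R]_n -> Xi i -> 'rV[R]_n)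
    (eta : nat -> R)
    (d : measure_display) (T : measurableType d) (P : probability T R)
    (b : nat) (xi : nat -> forall i : 'I_N, 'I_b -> {RV P >-> Xi i})
    (x0 : 'M[R]_(N, n)) (x z : nat -> T -> 'M[R]_(N, n))
    (lam : nat -> T -> 'M[R]_(#|edges e|, n)) (K : nat),
  (forall i, [/\ proper_fun (r i), closed_fun (r i) & convex_fun (r i)]) ->
  feasible e r ->
  smooth_weakly_convex f L mu ->
  bounded_below e f r f_low ->
  polyhedral_epigraph r Sx Sy zeta ->
  0 < sigma ->
  stochastic_gradient law G f sigma ->
  (forall k, 0 <= eta k <= eta_bar L mu c kappa gamma) ->
  (1 <= b)%N ->
  iid_samples law xi ->
  (rsum r x0 < +oo)%E ->
  SPPDM G f r alpha beta gamma c kappa eta xi x0 x z lam ->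
  (1 <= K)%N ->
  (\big[mine/+oo]_(k < K) 'E_P[fun w => gap f r (x k w) (lam k.+1 w)]
   <= C0%:E * ((potential f r c kappa tau x0 x0 x0
                  (- (alpha *: (incidence e R *m x0))) - f_low%:E)
                 * (K%:R^-1)%:E
               + (C1 * N%:R * sigma ^+ 2 / b%:R)%:E))%E ]]].
Proof.
have [tau [alpha_bar [tau0 ab0 abc pathwise]]] := pathwise_gap_bound graph_e
  degree_ge1 L_gt0 mu_ge c_gt0 kappa_gt0 kappa_gt gamma_gt.
exists tau, alpha_bar; split=> // alpha alpha0 alpha_le n q Sx Sy n0.
have [beta_bar [bb0 bb1 {}pathwise]] := pathwise alpha alpha0 alpha_le n q Sx Sy n0.
exists beta_bar; split=> // beta beta0 beta_lt.
have [C0 [C1 [C00 C10 {}pathwise]]] := pathwise beta beta0 beta_lt.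
exists C0, C1; split=> // f r zeta f_low sigma dX Xi law G eta d T P b xi x0 x z lam K.
move=> r_reg feas f_smooth f_bdd r_epi sigma0 sg eta_bd b0 iid Dx0 run K0.
have r_proper i : proper_fun (r i) by have [] := r_reg i.
have D_ex : exists x0 : 'M[R]_(N, n), dom_sum r x0 by exists x0.
have [ph [f_low_ph phE path]] := pathwise f r zeta f_low eta x0 r_proper feas
  f_smooth f_bdd r_epi eta_bd Dx0.
rewrite phE; set bound := (X in (_ <= X)%E).
have -> : bound = (C0 * ((ph - f_low) / K%:R + C1 * N%:R * sigma ^+ 2 / b%:R))%:E.
  by [].
pose s k w := x k w + eta k *: (x k w - x k.-1 w).
pose g k w := batch_gradient G xi k w (s k w).
pose err k w := enorm (g k w - grad (fsum f) (s k w)) ^+ 2.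
pose gp k w := gap f r (x k w) (lam k.+1 w).
have gap_sum w : \sum_(k < K) gp k w <=
    C0 * ((ph - f_low) + C1 * \sum_(k < K) err k w).
  apply: (path (g ^~ w) (x ^~ w) (z ^~ w) (lam ^~ w)).
  - exact: (sppdm_x0 run).
  - exact: (sppdm_z0 run).
  - exact: (sppdm_lam0 run).
  - by move=> k; exact: (sppdm_lam run).
  - by move=> k; exact: (sppdm_x run).
  - by move=> k; exact: (sppdm_z run).
have meas k : [/\ mx_measurable (x k), mx_measurable (x k.-1), mx_measurable (z k)
    & mx_measurable (lam k)].
  apply: (iterates_measurable sg r_proper r_epi D_ex c_gt0 kappa_gt0 gamma_gt0 run
    (iota := id) (K := k)) => // k' i j _; exact: measurable_funPT.
have mgp k : measurable_fun setT (gp k).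
  have [mx _ _ _] := meas k; have [_ _ _ ml] := meas k.+1.
  apply: measurable_funD; apply: mx_measurable_sqr_enorm; last first.
    exact: mx_measurable_mul.
  apply: mx_measurableB => //.
  apply: (lipschitz_mx_measurable_mx (F := prox (rsum r)) (C := 1)); last first.
    by move=> y y'; rewrite mul1r; exact: prox_lip.
  apply: mx_measurableB; last exact: mx_measurable_mul.
  apply: mx_measurableB => //.
  apply: lipschitz_mx_measurable_mx mx _.
  by have [_ _ h _] := f_smooth; exact: h.
have ms k : mx_measurable (s k).
  have [mx mxm _ _] := meas k.
  by apply: mx_measurableD => //; apply: mx_measurableZ; exact: mx_measurableB.
have merr k : measurable_fun setT (err k).
  apply: mx_measurable_sqr_enorm; apply: mx_measurableB; last first.
    apply: lipschitz_mx_measurable_mx (ms k) _.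
    by have [_ _ h _] := f_smooth; exact: h.
  apply: (batch_gradient_measurable sg (iota := id) (ms k)) => i j.
  exact: measurable_funPT.
have gp0 k w : 0 <= gp k w by rewrite addr_ge0 ?sqr_ge0.
have err0 k w : 0 <= err k w by rewrite sqr_ge0.
have err_le k : (\int[P]_w (err k w)%:E <= (N%:R * sigma ^+ 2 / b%:R)%:E)%E.
  apply: (batch_second_moment sg iid f_smooth _ b0) => i j.
  exact: (extrapolation_measurable sg r_proper r_epi D_ex c_gt0 kappa_gt0 gamma_gt0 run).
have Kr : 0 < K%:R :> R by rewrite ltr0n.
apply: bigmin_le_mean => //.
under eq_bigr do rewrite unlock.
have mgpE k : measurable_fun setT (fun w => (gp k w)%:E) by apply/measurable_EFinP.
have merrE k : measurable_fun setT (fun w => (err k w)%:E) by apply/measurable_EFinP.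
have gpE0 k w : setT w -> (0 <= (gp k w)%:E)%E by rewrite lee_fin.
have errE0 k w : setT w -> (0 <= (err k w)%:E)%E by rewrite lee_fin.
rewrite -(ge0_integral_sum P measurableT (fun k : 'I_K => mgpE k)
  (fun k : 'I_K => @gpE0 k)).
have c0 : 0 <= C0 * (ph - f_low) by rewrite mulr_ge0 ?subr_ge0 ?(ltW C00).
have c1 : 0 <= C0 * C1 by rewrite mulr_ge0 ?(ltW C00) ?(ltW C10).
have mce k : measurable_fun setT (fun w => ((C0 * C1)%:E * (err k w)%:E)%E).
  by apply: emeasurable_funM.
have c1E : (0 <= (C0 * C1)%:E)%E by rewrite lee_fin.
have ce0 k w : setT w -> (0 <= (C0 * C1)%:E * (err k w)%:E)%E.
  by move=> ?; rewrite mule_ge0 ?errE0.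
have msum : measurable_fun setT
    (fun w => \sum_(k < K) (C0 * C1)%:E * (err k w)%:E)%E.
  by apply: emeasurable_sum => k; exact: mce.
have sum0 w : setT w -> (0 <= \sum_(k < K) (C0 * C1)%:E * (err k w)%:E)%E.
  by move=> ?; apply: sume_ge0 => k _; exact: ce0.
apply: (@le_trans _ _ (\int[P]_w (cst (C0 * (ph - f_low))%:E w
   + \sum_(k < K) (C0 * C1)%:E * (err k w)%:E))%E).
  apply: ge0_le_integral => //.
  - by move=> w _; apply: sume_ge0 => k _; exact: gpE0.
  - by apply: emeasurable_sum => k; exact: mgpE.
  - exact: emeasurable_funD.
  move=> w _.
  have -> : (\sum_(k < K) (C0 * C1)%:E * (err k w)%:E)%E =
      (C0 * C1 * \sum_(k < K) err k w)%:E by rewrite mulr_sumr -sumEFin.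
  rewrite sumEFin -[leRHS]EFinD lee_fin (le_trans (gap_sum w)) //.
  by rewrite mulrDr mulrA.
have cE0 (w : T) : setT w -> (0 <= cst (C0 * (ph - f_low))%:E w)%E by rewrite lee_fin.
rewrite (ge0_integralD P measurableT cE0 (measurable_cst _) sum0 msum).
rewrite integral_cst_probability.
rewrite (ge0_integral_sum P measurableT (fun k : 'I_K => mce k)
  (fun k : 'I_K => @ce0 k)).
apply: (@le_trans _ _ ((C0 * (ph - f_low))%:E
   + \sum_(k < K) (C0 * C1 * (N%:R * sigma ^+ 2 / b%:R))%:E)%E).
  rewrite leeD2l //; apply: lee_sum => k _.
  rewrite (ge0_integralZl P measurableT (merrE k) (@errE0 k) c1E).
  exact: (lee_wpmul2l c1E (err_le k)).
rewrite sumEFin sumr_const card_ord -EFinD lee_fin.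
rewrite -(mulr_natl (C0 * C1 * _)) le_eqVlt; apply/orP; left; apply/eqP.
have bR : b%:R != 0 :> R by rewrite pnatr_eq0 -lt0n.
by field; rewrite bR gt_eqF.
Qed.
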